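(* Let $d\ge 1$. There exists $\varepsilon_0=\varepsilon_0(d)>0$ such that the following holds for all $0<\varepsilon\le\varepsilon_0$. Let $H=\varepsilon^2\Delta_{\mathbb{Z}^d}+V_\omega$ on $\ell^2(\mathbb{Z}^d)$, where $V_\omega$ is a random potential whose values $V_\omega(n)$, $n\in\mathbb{Z}^d$, are real-valued i.i.d. random variables whose common law $\mu$ (the single site distribution) has compact support and a bounded density $\mu'=\frac{d\mu}{dx}$ with $\|\mu'\|_{L^\infty(\mathbb{R})}\le 1$. Then, almost surely, $\ell^2(\mathbb{Z}^d)$ has an orthonormal basis consisting of exponentially decaying eigenfunctions of the random operator $H$. In particular, the spectrum of $H$ is almost surely pure point, i.e. $H$ has almost surely no absolutely continuous and no singular continuous spectrum.
   Context: The discrete Laplacian on $\mathbb{Z}^d$ is the sum over nearest neighbors, $(\Delta_{\mathbb{Z}^d} f)(x)=\sum_{\pm}\sum_{j=1}^d f(x\pm e_j)$, where $e_j$ are the standard coordinate vectors (there is no diagonal term). $V_\omega$ acts on $\ell^2(\mathbb{Z}^d)$ as the multiplication (diagonal) operator $(V_\omega f)(n)=V_\omega(n)f(n)$; $\omega$ denotes a point of the underlying probability space. An eigenfunction $\psi$ is exponentially decaying if there are $C,c>0$ with $|\psi(n)|\le Ce^{-c|n|}$ for all $n\in\mathbb{Z}^d$. *)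

(* Defs.v *)
From mathcomp Require Import all_boot all_order all_algebra.
From mathcomp Require Import complex.
From mathcomp Require Import all_classical all_reals all_analysis.

Set Implicit Arguments.
Unset Strict Implicit.
Unset Printing Implicit Defensive.

Import Order.TTheory GRing.Theory Num.Theory.
Import numFieldNormedType.Exports.

Local Open Scope classical_set_scope.
Local Open Scope complex_scope.
Local Open Scope ring_scope.

Definition site (d : nat) : Type := 'rV[int]_d.

Definition wave (R : realType) (d : nat) : Type := site d -> R[i].

(* The l^1 norm on Z^d; exponential decay does not depend on the choice of
   norm, since all norms on R^d are equivalent. *)
Definition site_norm (R : realType) (d : nat) (n : site d) : R :=
  (\sum_(j < d) `|n ord0 j|)%:~R.

Definition cabs (R : realType) (z : R[i]) : R := complex.Re `|z|.

Section Ell2.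
Variables (R : realType) (d : nat).
Implicit Types f g : wave R d.

Definition ell2 : set (wave R d) :=
  [set f | (\esum_(n in [set: site d]) (cabs (f n) ^+ 2)%:E < +oo)%E].

Definition l2norm f : R :=
  Num.sqrt (fine (\esum_(n in [set: site d]) (cabs (f n) ^+ 2)%:E)%E).

(* Unconditional sums over Z^d, as differences of the sums of the positive and
   negative parts; only meaningful for absolutely summable families, such as
   those arising in [dotp] from members of [ell2]. *)
Definition rsum (u : site d -> R) : R :=
  fine (\esum_(n in [set: site d]) (Num.max (u n) 0)%:E)%E -
  fine (\esum_(n in [set: site d]) (Num.max (- u n) 0)%:E)%E.

Definition csum (u : site d -> R[i]) : R[i] :=
  (rsum (fun n => complex.Re (u n))) +i* (rsum (fun n => complex.Im (u n))).

(* Linear in the second argument. *)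
Definition dotp f g : R[i] := csum (fun n => (f n)^*%C * g n).

Definition orthonormal_basis (psi : nat -> wave R d) : Prop :=
  [/\ forall k, ell2 (psi k),
      forall k l, dotp (psi k) (psi l) = (k == l)%:R
    & forall f, ell2 f ->
        (fun N : nat => l2norm (fun n =>
           f n - \sum_(k < N) dotp (psi k) f * psi k n)) @ \oo --> (0 : R)].

Definition eigenfunction (T : wave R d -> wave R d) (psi : wave R d) : Prop :=
  [/\ ell2 psi, exists n, psi n != 0
    & exists E : R[i], forall n, T psi n = E * psi n].

Definition exp_decaying (psi : wave R d) : Prop :=
  exists C c : R, [/\ 0 < C, 0 < c
    & forall n, cabs (psi n) <= C * expR (- c * site_norm R n)].

End Ell2.

(* Spectral types of a bounded self-adjoint operator T on l^2(Z^d). *)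
Section Spectrum.
Variables (R : realType) (d : nat).
Variable T : wave R d -> wave R d.

(* The spectral measure m of T at f satisfies <f, p(T) f> = int p dm for every
   polynomial p; a boundedly supported m is determined by its moments, so this
   is the usual spectral measure <f, 1_A(T) f>. *)
Definition spectral_measure (f : wave R d)
    (m : {finite_measure set (measurableTypeR R) -> \bar R}) : Prop :=
  (exists M : R, m (~` `[- M, M]) = 0%E) /\
  forall k : nat, dotp f (iter k T f) = (\int[m]_x (x ^+ k))%R%:C.

Definition pure_point_measure
    (m : {finite_measure set (measurableTypeR R) -> \bar R}) : Prop :=
  exists2 A : set R, countable A & m (~` A) = 0%E.

Definition singular_continuous_measure
    (m : {finite_measure set (measurableTypeR R) -> \bar R}) : Prop :=
  (forall x : R, m [set x] = 0%E) /\
  exists A : set (measurableTypeR R),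
    [/\ measurable A, lebesgue_measure A = 0%E & m (~` A) = 0%E].

Definition pp_subspace : set (wave R d) :=
  [set f | ell2 f /\
     exists2 m, spectral_measure f m & pure_point_measure m].

Definition ac_subspace : set (wave R d) :=
  [set f | ell2 f /\
     exists2 m, spectral_measure f m & m `<< @lebesgue_measure R].

Definition sc_subspace : set (wave R d) :=
  [set f | ell2 f /\
     exists2 m, spectral_measure f m & singular_continuous_measure m].

(* z is in the resolvent set of the restriction of T to the subspace S when
   T - z maps S onto S and is bounded below there. *)
Definition resolvent_set_on (S : set (wave R d)) : set R[i] :=
  [set z |
    (exists2 c : R, 0 < c & forall f, S f ->
        c * l2norm f <= l2norm (fun n => T f n - z * f n)) /\
    [set (fun n => T f n - z * f n) | f in S] = S].

Definition spectrum_on (S : set (wave R d)) : set R[i] :=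
  ~` resolvent_set_on S.

Definition ac_spectrum : set R[i] := spectrum_on ac_subspace.

Definition sc_spectrum : set R[i] := spectrum_on sc_subspace.

Definition pure_point_spectrum : Prop := pp_subspace = @ell2 R d.

End Spectrum.

Section Anderson.
Variables (R : realType) (d : nat).

Definition unit_site (j : 'I_d) : site d := delta_mx ord0 j.

Definition laplacian (f : wave R d) : wave R d := fun n =>
  \sum_(j < d) (f (n + unit_site j) + f (n - unit_site j)).

Definition hamiltonian (eps : R) (V : site d -> R) (f : wave R d) : wave R d :=
  fun n => (eps ^+ 2)%:C * laplacian f n + (V n)%:C * f n.

Definition compactly_supported
    (mu : probability (measurableTypeR R) R) : Prop :=
  exists2 K : set R, compact K & mu (~` K) = 0%E.

Definition has_density (mu : probability (measurableTypeR R) R)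
    (g : measurableTypeR R -> R) : Prop :=
  [/\ measurable_fun setT g, forall x, 0 <= g x
    & forall A, measurable A -> mu A = (\int[lebesgue_measure]_(x in A) (g x)%:E)%E].

Definition iid (dO : measure_display) (Omega : measurableType dO)
    (P : probability Omega R) (I : choiceType)
    (V : I -> {RV P >-> measurableTypeR R})
    (mu : probability (measurableTypeR R) R) : Prop :=
  (forall i A, measurable A -> distribution P (V i) A = mu A) /\
  (forall (s : seq I) (A : I -> set (measurableTypeR R)), uniq s ->
     (forall i, measurable (A i)) ->
     P (\big[setI/setT]_(i <- s) (V i @^-1` A i)) =
     (\prod_(i <- s) P (V i @^-1` A i))%E).

End Anderson.

(* Main.v *)
Require Import Defs.
From HB Require Import structures.
From mathcomp Require Import all_boot all_order all_algebra.
From mathcomp Require Import complex.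
From mathcomp Require Import all_classical all_reals all_analysis.
From mathcomp Require Import measurable_realfun ess_sup_inf.
From mathcomp Require Import ring lra zify.

(* In a finite volume, every Green function entry at energy z with Im z > 0 has
   E |G(x, y; z)|^(1/2) <= 9 * 2^-|x - y|, uniformly in z and in the volume: expand
   G in the site x, use that V x is independent of the rest, and induct on the
   volume (Aizenman-Molchanov).  The bounded density then upgrades this to
   E [Im z |G(x, y; z)|^2] <= 16 * 2^-|x - y| (Graf).  Integrating over the energy
   and letting Im z -> 0 bounds the eigenfunction correlators
   sum_l |Q_l(x, y)|^2, with Q_l the spectral projections of the box; by Fatou, almost
   surely the exponentially weighted sum of the correlators stays bounded along a
   sequence of boxes exhausting Z^d.

   Given such a sequence, boundedly many eigenvectors of each box, all
   exponentially localized near x, add up to the indicator of x within any given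
   error.  Along an ultrafilter of boxes they converge to exponentially decaying
   eigenvectors on Z^d.  Hence countably many decaying eigenvectors span a dense
   subspace, and Gram-Schmidt turns them into an orthonormal basis, which stays
   made of eigenvectors because distinct eigenvalues are already orthogonal.

   The spectral measure of f is then the sum of the |<psi_k, f>|^2 delta_(e_k).
   Conversely, if a spectral measure of f has no atom, testing it against
   polynomials that decrease to the indicator of {e_k} gives <psi_k, f> = 0. *)

Set Implicit Arguments.
Unset Strict Implicit.
Unset Printing Implicit Defensive.

Import Order.TTheory GRing.Theory Num.Theory.
Import numFieldNormedType.Exports.

Local Open Scope classical_set_scope.
Local Open Scope ring_scope.

(** The exponent 1/2 is forced to lie below 1: under a bounded density the mean of 1/|V - a| may
    grow like log(1/Im a), while the mean of its square root stays bounded. The root is also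
    subadditive, and it turns the hopping eps^2 into eps. A bound at a fixed energy says nothing
    about eigenfunctions, whose energies move with the potential. The energy integral repairs this,
    and a second moment is needed there because near an eigenvalue l one has Im z |G(x, y; z)| close
    to |Q_l(x, y)|. Spectral projections are awkward as functions of the sample point. So only Green
    function entries at explicit grid energies, which are rational in the potential, are ever
    integrated; the comparison with the projections is made for one fixed potential and one fixed
    box. Projections are used instead of normalized eigenvectors so that multiple eigenvalues need
    no care. The only spectral theorem invoked is the one for finite Hermitian matrices. On Z^d
    eigenvectors are built by limits, and spectral measures are compared through their moments. *)

(** * Modulus of complex numbers *)
Section Modulus.
Variable R : realType.
Implicit Types (x y z : R[i]) (a b : R).
Local Notation Re := complex.Re.
Local Notation Im := complex.Im.

Lemma cabsE z : cabs z = Num.sqrt (Re z ^+ 2 + Im z ^+ 2).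
Proof. by case: z. Qed.

Lemma cabsC z : `|z| = (cabs z)%:C%C.
Proof. by case: z. Qed.

Lemma cabs_sqr z : cabs z ^+ 2 = Re z ^+ 2 + Im z ^+ 2.
Proof. by rewrite cabsE sqr_sqrtr// addr_ge0// sqr_ge0. Qed.

Lemma cabs_ge0 z : 0 <= cabs z.
Proof. by rewrite cabsE sqrtr_ge0. Qed.

Lemma cabsM x y : cabs (x * y) = cabs x * cabs y.
Proof. by apply: complexI; rewrite -cabsC normrM !cabsC rmorphM. Qed.

Lemma cabsD x y : cabs (x + y) <= cabs x + cabs y.
Proof. by rewrite -lecR rmorphD/= -!cabsC ler_normD. Qed.

Lemma cabsN x : cabs (- x) = cabs x.
Proof. by apply: complexI; rewrite -!cabsC normrN. Qed.

Lemma cabsB x y : cabs (x - y) <= cabs x + cabs y.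
Proof. by rewrite -(cabsN y) cabsD. Qed.

Lemma cabsV x : cabs x^-1 = (cabs x)^-1.
Proof. by apply: complexI; rewrite -cabsC normfV cabsC fmorphV. Qed.

Lemma cabs0 : cabs (0 : R[i]) = 0.
Proof. by apply: complexI; rewrite -cabsC normr0. Qed.

Lemma cabs1 : cabs (1 : R[i]) = 1.
Proof. by apply: complexI; rewrite -cabsC normr1. Qed.

Lemma cabs_eq0 x : (cabs x == 0) = (x == 0).
Proof.
apply/eqP/eqP => [h|->]; last exact: cabs0.
by apply/eqP; rewrite -[_ == _]normr_eq0 [X in X == _]cabsC h.
Qed.

Lemma cabs_gt0 x : (0 < cabs x) = (x != 0).
Proof. by rewrite lt_neqAle cabs_ge0 andbT eq_sym cabs_eq0. Qed.

Lemma cabs_real a : cabs a%:C%C = `|a|.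
Proof. by rewrite cabsE/= expr0n addr0 sqrtr_sqr. Qed.

Lemma cabs_conj z : cabs z^*%C = cabs z.
Proof. by case: z => a b; rewrite !cabsE/= sqrrN. Qed.

Lemma cabs_sum (I : Type) (r : seq I) (P : pred I) (F : I -> R[i]) :
  cabs (\sum_(i <- r | P i) F i) <= \sum_(i <- r | P i) cabs (F i).
Proof.
elim/big_rec2: _ => [|i y z _ h]; first by rewrite cabs0.
by rewrite (le_trans (cabsD _ _))// lerD2l.
Qed.

Lemma cabs_ler_dist x y : cabs x - cabs y <= cabs (x + y).
Proof.
by rewrite lerBlDr (le_trans _ (cabsB (x + y) y))// addrK.
Qed.

Lemma Re_le_cabs z : `|Re z| <= cabs z.
Proof. by rewrite cabsE -sqrtr_sqr ler_wsqrtr// lerDl sqr_ge0. Qed.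

Lemma Im_le_cabs z : `|Im z| <= cabs z.
Proof. by rewrite cabsE -sqrtr_sqr ler_wsqrtr// lerDr sqr_ge0. Qed.

Lemma cabs_sqrC z : (cabs z ^+ 2)%:C%C = z * z^*%C.
Proof. by rewrite -sqr_normc cabsC rmorphXn. Qed.

Lemma cReD x y : Re (x + y) = Re x + Re y. Proof. by case: x; case: y. Qed.
Lemma cImD x y : Im (x + y) = Im x + Im y. Proof. by case: x; case: y. Qed.
Lemma cReN x : Re (- x) = - Re x. Proof. by case: x. Qed.
Lemma cImN x : Im (- x) = - Im x. Proof. by case: x. Qed.
Lemma cReB x y : Re (x - y) = Re x - Re y. Proof. by rewrite cReD cReN. Qed.
Lemma cImB x y : Im (x - y) = Im x - Im y. Proof. by rewrite cImD cImN. Qed.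
Lemma cReM x y : Re (x * y) = Re x * Re y - Im x * Im y.
Proof. by case: x; case: y. Qed.
Lemma cImM x y : Im (x * y) = Re x * Im y + Im x * Re y.
Proof. by case: x; case: y. Qed.
Lemma cReC a : Re a%:C%C = a. Proof. by []. Qed.
Lemma cImC a : Im a%:C%C = 0. Proof. by []. Qed.
Lemma cReJ z : Re z^*%C = Re z. Proof. by case: z. Qed.
Lemma cImJ z : Im z^*%C = - Im z. Proof. by case: z. Qed.
Lemma cReZ a z : Re (a%:C%C * z) = a * Re z.
Proof. by rewrite cReM/= mul0r subr0. Qed.
Lemma cImZ a z : Im (a%:C%C * z) = a * Im z.
Proof. by rewrite cImM/= mul0r addr0. Qed.

Lemma cRe_sum (I : Type) (r : seq I) (P : pred I) (F : I -> R[i]) :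
  Re (\sum_(i <- r | P i) F i) = \sum_(i <- r | P i) Re (F i).
Proof. exact: (big_morph (fun z => Re z) cReD erefl). Qed.

Lemma cIm_sum (I : Type) (r : seq I) (P : pred I) (F : I -> R[i]) :
  Im (\sum_(i <- r | P i) F i) = \sum_(i <- r | P i) Im (F i).
Proof. exact: (big_morph (fun z => Im z) cImD erefl). Qed.

Lemma complex_eq x y : Re x = Re y -> Im x = Im y -> x = y.
Proof. by case: x; case: y => a b c d /= -> ->. Qed.

End Modulus.

(** * Measurability and averages over one site *)
Section ComplexMeasurability.
Context {dd} {T : measurableType dd} {R : realType}.
Implicit Types (f g : T -> R[i]) (h : T -> R).

Definition cmeasurable f :=
  measurable_fun setT (fun t => complex.Re (f t)) /\
  measurable_fun setT (fun t => complex.Im (f t)).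

Lemma measurable_invr_ge0 h : (forall t, 0 <= h t) ->
  measurable_fun setT h -> measurable_fun setT (fun t => (h t)^-1).
Proof.
move=> h0 mh; rewrite (_ : (fun t => _) = (fun x => x `^ (-1)) \o h).
  by apply: measurableT_comp => //; exact: measurable_powR.
by apply/funext => t /=; rewrite powR_inv1.
Qed.

Lemma measurable_sqrtr h :
  measurable_fun setT h -> measurable_fun setT (fun t => Num.sqrt (h t)).
Proof.
move=> mh; apply: (measurableT_comp (f := @Num.sqrt R)) => //.
by apply: continuous_measurable_fun; exact: sqrt_continuous.
Qed.

Lemma cmeasurable_cst (z : R[i]) : cmeasurable (fun _ => z).
Proof. by split; exact: measurable_cst. Qed.

Lemma cmeasurable_real h : measurable_fun setT h -> cmeasurable (fun t => (h t)%:C%C).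
Proof. by move=> mh; split => //=; exact: measurable_cst. Qed.

Lemma cmeasurableN f : cmeasurable f -> cmeasurable (fun t => - f t).
Proof.
move=> [f1 f2]; split.
- by under eq_fun => t do rewrite cReN; exact: measurable_funN.
- by under eq_fun => t do rewrite cImN; exact: measurable_funN.
Qed.

Lemma cmeasurableD f g : cmeasurable f -> cmeasurable g ->
  cmeasurable (fun t => f t + g t).
Proof.
move=> [f1 f2] [g1 g2]; split.
- by under eq_fun => t do rewrite cReD; exact: measurable_funD.
- by under eq_fun => t do rewrite cImD; exact: measurable_funD.
Qed.

Lemma cmeasurableM f g : cmeasurable f -> cmeasurable g ->
  cmeasurable (fun t => f t * g t).
Proof.
move=> [f1 f2] [g1 g2]; split.
- under eq_fun => t do rewrite cReM.
  by apply: measurable_funB; exact: measurable_funM.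
- under eq_fun => t do rewrite cImM.
  by apply: measurable_funD; exact: measurable_funM.
Qed.

Lemma measurable_cabs f : cmeasurable f -> measurable_fun setT (fun t => cabs (f t)).
Proof.
move=> [f1 f2]; under eq_fun => t do rewrite cabsE.
by apply: measurable_sqrtr; apply: measurable_funD; exact: measurable_funX.
Qed.

Lemma cmeasurableV f : cmeasurable f -> cmeasurable (fun t => (f t)^-1).
Proof.
move=> mf; under eq_fun => t do rewrite invc_norm cabsC -rmorphXn/= -fmorphV/=.
apply: cmeasurableM.
  apply: cmeasurable_real; apply: measurable_invr_ge0.
    by move=> t; rewrite sqr_ge0.
  by apply: measurable_funX; exact: measurable_cabs.
case: mf => f1 f2; split.
- by under eq_fun => t do rewrite cReJ.
- by under eq_fun => t do rewrite cImJ; exact: measurable_funN.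
Qed.

Lemma cmeasurable_sum (I : Type) (r : seq I) (P : pred I) (F : I -> T -> R[i]) :
  (forall i, P i -> cmeasurable (F i)) ->
  cmeasurable (fun t => \sum_(i <- r | P i) F i t).
Proof.
move=> mF; elim: r => [|i r ih].
  rewrite (_ : (fun t => _) = fun=> 0); first exact: cmeasurable_cst.
  by apply/funext => t; rewrite big_nil.
have -> : (fun t => \sum_(j <- i :: r | P j) F j t) =
    (fun t => if P i then F i t + \sum_(j <- r | P j) F j t
              else \sum_(j <- r | P j) F j t).
  by apply/funext => t; rewrite big_cons.
case Pi: (P i) => //.
by apply: cmeasurableD => //; exact: mF.
Qed.

Lemma cmeasurable_prod (I : Type) (r : seq I) (P : pred I) (F : I -> T -> R[i]) :
  (forall i, P i -> cmeasurable (F i)) ->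
  cmeasurable (fun t => \prod_(i <- r | P i) F i t).
Proof.
move=> mF; elim: r => [|i r ih].
  rewrite (_ : (fun t => _) = fun=> 1); first exact: cmeasurable_cst.
  by apply/funext => t; rewrite big_nil.
have -> : (fun t => \prod_(j <- i :: r | P j) F j t) =
    (fun t => if P i then F i t * \prod_(j <- r | P j) F j t
              else \prod_(j <- r | P j) F j t).
  by apply/funext => t; rewrite big_cons.
case Pi: (P i) => //.
by apply: cmeasurableM => //; exact: mF.
Qed.

Lemma cmeasurable_det n (A : T -> 'M[R[i]]_n) :
  (forall i j, cmeasurable (fun t => A t i j)) -> cmeasurable (fun t => \det (A t)).
Proof.
move=> mA; apply: cmeasurable_sum => s _; apply: cmeasurableM.
  exact: cmeasurable_cst.
by apply: cmeasurable_prod => i _; exact: mA.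
Qed.

Lemma cmeasurable_invmx n (A : T -> 'M[R[i]]_n) :
  (forall t, A t \in unitmx) ->
  (forall i j, cmeasurable (fun t => A t i j)) ->
  forall i j, cmeasurable (fun t => invmx (A t) i j).
Proof.
move=> uA mA i j.
under eq_fun => t do rewrite /invmx uA mxE !mxE.
apply: cmeasurableM.
  by apply: cmeasurableV; exact: cmeasurable_det.
apply: cmeasurableM; first exact: cmeasurable_cst.
by apply: cmeasurable_det => k l; under eq_fun => t do rewrite !mxE; exact: mA.
Qed.

End ComplexMeasurability.

Lemma geometric_half_sum_le (R : realType) (N : nat) :
  \sum_(n < N) (2^-1 : R) ^+ n <= 2.
Proof.
have h : \sum_(n < N) (2^-1 : R) ^+ n = 2 - 2 * 2^-1 ^+ N.
  elim: N => [|N ih]; first by rewrite big_ord0 expr0; lra.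
  by rewrite big_ord_recr/= ih exprS; lra.
by rewrite h; have := exprn_ge0 N (_ : 0 <= 2^-1 :> R); lra.
Qed.

(** * Averages of negative powers of the distance from the potential to a complex number *)

Section Concentration.
Variables (R : realType) (mu : probability (measurableTypeR R) R).

(* All that is used of the density of the single site distribution. *)
Definition concentration_bound :=
  forall c r : R, 0 < r -> (mu [set v | (`|v - c| < r)%R] <= (2 * r)%:E)%E.

Hypothesis hmu : concentration_bound.

Lemma measurable_interval (c r : R) :
  measurable ([set v : measurableTypeR R | `|v - c| < r]).
Proof.
rewrite (_ : [set v | _] = ball c r); first exact: measurable_ball.
by apply/seteqP; split => v /=; rewrite -ball_normE/= distrC.
Qed.

(** Pointwise [f] is at most [A] plus the sum of the [a n] over the balls of radius [r n] around [c]
    that contain the point, and each ball has mass at most [2 * r n]. *)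
Lemma layered_integral_le (f : measurableTypeR R -> R) (c A S : R) (a r : nat -> R) :
  measurable_fun setT f -> (forall v, 0 <= f v) -> 0 <= A ->
  (forall n, 0 <= a n) -> (forall n, 0 < r n) ->
  (forall v, f v <= A \/ exists2 n, `|v - c| < r n & f v <= a n) ->
  (forall N, \sum_(n < N) a n * (2 * r n) <= S) ->
  (\int[mu]_v (f v)%:E <= (A + S)%:E)%E.
Proof.
move=> mf f0 A0 a0 r0 hf hS.
pose B n := [set v : measurableTypeR R | `|v - c| < r n].
have mB n : measurable (B n) by exact: measurable_interval.
have mterm n : measurable_fun setT
    (fun v : measurableTypeR R => ((a n)%:E * (\1_(B n) v)%:E)%E).
  by apply: measurable_funeM; apply/measurable_EFinP; exact: measurable_indic.
have t0 n (v : measurableTypeR R) : (0 <= (a n)%:E * (\1_(B n) v)%:E :> \bar R)%E.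
  by rewrite mule_ge0// lee_fin.
apply: (@le_trans _ _ (\int[mu]_v (A%:E + \sum_(n <oo) ((a n)%:E * (\1_(B n) v)%:E)))%E).
  apply: ge0_le_integral => //.
  - by move=> v _; rewrite lee_fin.
  - exact/measurable_EFinP.
  - apply: emeasurable_funD => //; apply: ge0_emeasurable_sum => //.
  - move=> v _; have s0 : (0 <= \sum_(n <oo) ((a n)%:E * (\1_(B n) v)%:E) :> \bar R)%E.
      exact: nneseries_ge0.
    have [h|[n vn h]] := hf v.
      by rewrite (@le_trans _ _ A%:E)// leeDl.
    rewrite (@le_trans _ _ (\sum_(n <oo) ((a n)%:E * (\1_(B n) v)%:E))%E) ?leeDr//.
    apply: le_trans (nneseries_lim_ge n.+1 _) => //.
    rewrite big_mkord big_ord_recr/= indicE mem_set// mule1.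
    by rewrite (@le_trans _ _ (a n)%:E)%E ?lee_fin// leeDr// sume_ge0.
rewrite ge0_integralD//; last 2 first.
- by move=> v _; exact: nneseries_ge0.
- exact: ge0_emeasurable_sum.
have -> : (\int[mu]_(v in setT) A%:E = A%:E)%E.
  by rewrite (integral_cst _ measurableT)/= probability_setT mule1.
rewrite EFinD leeD2l//.
rewrite integral_nneseries//.
apply: lime_le; first by apply: is_cvg_nneseries => n _ _; exact: integral_ge0.
apply: nearW => N; apply: le_trans (_ : (_ <= (\sum_(n < N) a n * (2 * r n))%:E)%E) _; last first.
  by rewrite lee_fin.
rewrite big_mkord -sumEFin; apply: lee_sum => n _.
rewrite ge0_integralZl//; last 2 first.
- by apply/measurable_EFinP; exact: measurable_indic.
- by rewrite lee_fin.
by rewrite integral_indic// setIT EFinM lee_wpmul2l ?lee_fin//; exact: hmu.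
Qed.

Variable a : R[i].
Hypothesis ima : 0 < complex.Im a.
Local Notation dist v := (cabs (v%:C%C - a)).

Lemma dist_gt0 (v : R) : 0 < dist v.
Proof.
by rewrite cabs_gt0 subr_eq0; apply/eqP => h; move: ima; rewrite -h/= ltxx.
Qed.

Lemma le_dist (v : R) : `|v - complex.Re a| <= dist v.
Proof. by have := Re_le_cabs (v%:C%C - a); rewrite cReB. Qed.

Lemma measurable_dist : measurable_fun setT (fun v : measurableTypeR R => dist v).
Proof.
apply: measurable_cabs; apply: cmeasurableD; last exact: cmeasurable_cst.
by apply: cmeasurable_real; exact: measurable_id.
Qed.

(** Where the distance is at least 1 the integrand is at most 1. The rest is cut into shells with
    distance in [4^-(n+1), 4^-n), where the integrand is at most 2^(n+1); the terms 2^(n+1) * 2 *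
    4^-n sum to at most 8. The total is uniform in [a], however close to the real axis. *)
Lemma integral_inv_sqrt_dist_le :
  (\int[mu]_v ((Num.sqrt (dist v))^-1)%:E <= 9%:E)%E.
Proof.
rewrite (_ : 9 = 1 + 8 :> R); last by lra.
apply: (@layered_integral_le _ (complex.Re a) 1 8
  (fun n => 2 ^+ n.+1) (fun n => 4^-1 ^+ n)) => //.
- by apply: measurable_invr_ge0 => //; apply: measurable_sqrtr; exact: measurable_dist.
- move=> v; have d0 := dist_gt0 v.
  have [d1|d1] := leP 1 (dist v).
    left; rewrite invf_le1 ?sqrtr_gt0//.
    by rewrite -(sqrtr1 R) ler_wsqrtr.
  right; have [N hN] : exists N, 4^-1 ^+ N <= dist v.
    have /cvgrPdist_lt/(_ _ d0)[N _ /(_ N (leqnn N))] : (4^-1 : R) ^+ n @[n --> \oo] --> (0 : R).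
      by apply: cvg_expr; rewrite ger0_norm; lra.
    rewrite /= sub0r normrN ger0_norm ?exprn_ge0//.
    by move=> /ltW h; exists N.
  have ex : exists n, 4^-1 ^+ n <= dist v by exists N.
  case: (ex_minnP ex) => -[|n] hn nmin.
    by move: hn; rewrite expr0 leNgt d1.
  exists n.
    rewrite (le_lt_trans (le_dist _))// ltNge; apply/negP => /nmin.
    by rewrite ltnn.
  rewrite -[leRHS]invrK lef_pV2 ?posrE ?sqrtr_gt0 ?invr_gt0 ?exprn_gt0//.
  rewrite -(ler_sqr _ (sqrtr_ge0 _)) ?nnegrE ?invr_ge0 ?exprn_ge0//.
  rewrite sqr_sqrtr ?(ltW d0)// (le_trans _ hn)// -exprVn -exprM mulnC exprM.
  by rewrite le_eqVlt; apply/orP; left; apply/eqP; congr (_ ^+ _); rewrite ?expr2; lra.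
- move=> N; have := geometric_half_sum_le R N.
  have -> : \sum_(n < N) (2 ^+ n.+1 * (2 * 4^-1 ^+ n)) = 4 * \sum_(n < N) 2^-1 ^+ n :> R.
    rewrite mulr_sumr; apply: eq_bigr => n _; rewrite exprS.
    have -> : 2^-1 ^+ n = 2 ^+ n * 4^-1 ^+ n :> R.
      by rewrite -exprMn; congr (_ ^+ _); rewrite ?expr2; lra.
    ring.
  lra.
Qed.

(** The distance is at least b = Im a, so the shells grow outward with radii 2^n b. If n > 0 is the
    least index whose ball contains v, then |v - Re a| >= 2^(n-1) b, whence the value 4 * 4^-n /
    b^2; the terms 8 * 2^-n / b sum to at most 16 / b. The order 1/b is the one that the Ward
    identity can compensate. *)
Lemma integral_inv_sqr_dist_le :
  (\int[mu]_v ((dist v ^+ 2)^-1)%:E <= (16 / complex.Im a)%:E)%E.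
Proof.
set b := complex.Im a; have b0 : 0 < b := ima.
have b0' : b != 0 by rewrite gt_eqF.
rewrite -[16 / b]add0r.
apply: (@layered_integral_le _ (complex.Re a) 0 (16 / b)
  (fun n => 4 * 4^-1 ^+ n / b ^+ 2) (fun n => 2 ^+ n * b)) => //.
- apply: measurable_invr_ge0; first by move=> v; rewrite sqr_ge0.
  by apply: measurable_funX; exact: measurable_dist.
- by move=> v; rewrite invr_ge0 sqr_ge0.
- by move=> n; rewrite mulr_ge0 ?invr_ge0 ?sqr_ge0// mulr_ge0// exprn_ge0.
- by move=> n; rewrite mulr_gt0// exprn_gt0.
- move=> v; have d0 := dist_gt0 v; right.
  have [N hN] : exists n, `|v - complex.Re a| < 2 ^+ n * b.
    have [N] := archi_boundP (normr_ge0 ((v - complex.Re a) / b)).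
    exists (Num.bound `|(v - complex.Re a) / b|).
    have := archi_boundP (normr_ge0 ((v - complex.Re a) / b)).
    set n := Num.bound _; rewrite normrM normfV [in `|b|](gtr0_norm b0).
    rewrite ltr_pdivrMr// => /lt_trans; apply.
    by rewrite ltr_pM2r// -natrX ltr_nat ltn_expl.
  have ex : exists n, `|v - complex.Re a| < 2 ^+ n * b by exists N.
  case: (ex_minnP ex) => n hn nmin; exists n => //.
  have bd : b <= dist v.
    by have := Im_le_cabs (v%:C%C - a); rewrite cImB cImC sub0r normrN (gtr0_norm b0).
  rewrite -[leRHS]invrK lef_pV2 ?posrE ?exprn_gt0//; last first.
    by rewrite invr_gt0 divr_gt0 ?mulr_gt0 ?exprn_gt0.
  rewrite invf_div.
  case: n hn nmin => [|n] hn nmin.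
    rewrite expr0 mulr1 (@le_trans _ _ (b ^+ 2))//.
      by rewrite ler_pdivrMr// ler_peMr ?sqr_ge0//; lra.
    by rewrite ler_pXn2r ?nnegrE ?(ltW d0) ?(ltW b0).
  have hn' : 2 ^+ n * b <= dist v.
    rewrite (le_trans _ (le_dist _))// leNgt; apply/negP => /nmin.
    by rewrite ltnn.
  have -> : b ^+ 2 / (4 * 4^-1 ^+ n.+1) = (2 ^+ n * b) ^+ 2.
    rewrite exprMn mulrC; congr (_ * _); rewrite exprS mulrA divff// mul1r.
    rewrite -exprVn invrK -exprM mulnC exprM; congr (_ ^+ _); rewrite ?expr2; lra.
  by rewrite ler_pXn2r ?nnegrE ?(ltW d0)// mulr_ge0 ?(ltW b0)// exprn_ge0.
- move=> N; have := geometric_half_sum_le R N.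
  have -> : \sum_(n < N) (4 * 4^-1 ^+ n / b ^+ 2 * (2 * (2 ^+ n * b))) =
      8 / b * \sum_(n < N) 2^-1 ^+ n :> R.
    rewrite mulr_sumr; apply: eq_bigr => n _.
    have -> : 2^-1 ^+ n = 2 ^+ n * 4^-1 ^+ n :> R.
      by rewrite -exprMn; congr (_ ^+ _); rewrite ?expr2; lra.
    by field.
  move=> h; rewrite (_ : 16 / b = 8 / b * 2); last by field.
  by rewrite ler_wpM2l// divr_ge0// ltW.
Qed.

End Concentration.

(** * Independence of one site from the others *)
Lemma in_big_setI (T : Type) (I : eqType) (s : seq I) (F : I -> set T) (t : T) :
  (\big[setI/setT]_(i <- s) F i) t <-> forall i, i \in s -> F i t.
Proof.
elim: s => [|i s ih]; first by rewrite big_nil; split.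
rewrite big_cons; split=> [[Fi /ih h] j|h].
  by rewrite in_cons => /predU1P[->//|/h].
by split; [apply: h; rewrite mem_head|apply/ih => j js; apply: h; rewrite in_cons js orbT].
Qed.

Section Decoupling.
Variables (R : realType) (dO : measure_display) (Omega : measurableType dO).
Variables (P : probability Omega R) (I : choiceType).
Variables (V : I -> {RV P >-> measurableTypeR R}).
Variable (mu : probability (measurableTypeR R) R).
Hypothesis iidV : iid V mu.

Variable x : I.

Definition cylinders_off : set (set Omega) :=
  [set B | exists s : seq I, exists A : I -> set (measurableTypeR R),
    [/\ uniq s, x \notin s, forall i, measurable (A i) &
        B = \big[setI/setT]_(i <- s) (V i @^-1` A i)]].

(* [Omega] with the sigma-algebra generated by the [V i], [i != x]. *)
Definition off_type : Type := g_sigma_algebraType cylinders_off.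

HB.instance Definition _ := Measurable.on off_type.

Lemma cylinders_off_setI : setI_closed cylinders_off.
Proof.
move=> _ _ [s [A [us xs mA ->]]] [s' [A' [us' xs' mA' ->]]].
exists (undup (s ++ s')), (fun i => (if i \in s then A i else setT) `&`
  (if i \in s' then A' i else setT)); split.
- exact: undup_uniq.
- by rewrite mem_undup mem_cat negb_or xs.
- by move=> i; apply: measurableI; case: ifP.
apply/seteqP; split => w.
  move=> [/in_big_setI h /in_big_setI h']; apply/in_big_setI => i _ /=.
  by split; case: ifP => // si; [exact: h|exact: h'].
move=> /in_big_setI h; split; apply/in_big_setI => i si.
  by have := h i; rewrite mem_undup mem_cat si /= => /(_ isT) [].
by have := h i; rewrite mem_undup mem_cat si /= orbT => /(_ isT) [].
Qed.

Lemma cylinders_off_measurable (B : set Omega) : cylinders_off B -> measurable B.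
Proof.
move=> [s [A [us xs mA ->]]]; apply: bigsetI_measurable => i _.
by rewrite -[X in measurable X]setTI; exact: measurable_funP.
Qed.

Lemma measurable_off (B : set off_type) : measurable B -> measurable (B : set Omega).
Proof.
apply: smallest_sub; first exact: sigma_algebra_measurable.
exact: cylinders_off_measurable.
Qed.

Lemma measurable_to_off : measurable_fun setT (id : Omega -> off_type).
Proof. by move=> _ B mB; rewrite setTI; exact: measurable_off. Qed.

Lemma measurable_of_off dd (U : measurableType dd) (f : off_type -> U) :
  measurable_fun setT f -> measurable_fun setT (f : Omega -> U).
Proof. by move=> mf; exact: (measurableT_comp mf measurable_to_off). Qed.

Lemma measurable_off_coord (i : I) : i != x ->
  measurable_fun setT (V i : off_type -> measurableTypeR R).
Proof.
move=> ix _ A mA; rewrite setTI; apply: sub_sigma_algebra.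
exists [:: i], (fun=> A); split => //; first by rewrite inE eq_sym.
by rewrite big_seq1.
Qed.

Definition to_off : {mfun Omega >-> off_type} :=
  HB.pack (id : Omega -> off_type) (isMeasurableFun.Build _ _ _ _ _ measurable_to_off).

Definition P_off : probability off_type R := distribution P to_off.

Lemma measurable_coord_and_off :
  measurable_fun setT (fun w : Omega => (V x w, to_off w)).
Proof. by apply: measurable_fun_pair. Qed.

Lemma measurable_decoupled dd (U : measurableType dd)
    (h : measurableTypeR R * off_type -> U) :
  measurable_fun setT h -> measurable_fun setT (fun w : Omega => h (V x w, w)).
Proof. by move=> mh; exact: (measurableT_comp mh measurable_coord_and_off). Qed.

Definition coord_and_off : {mfun Omega >-> (measurableTypeR R * off_type)%type} :=
  HB.pack (fun w : Omega => (V x w, to_off w))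
    (isMeasurableFun.Build _ _ _ _ _ measurable_coord_and_off).

(** For fixed [A] both sides are finite measures in [B]. They agree on [cylinders_off] by
    independence of finitely many sites, and this family is stable under intersection and generates
    the sigma-algebra. *)
Lemma independent_off (A : set (measurableTypeR R)) (B : set off_type) :
  measurable A -> measurable B -> P (V x @^-1` A `&` B) = (mu A * P B)%E.
Proof.
move=> mA mB.
have mVA : measurable (V x @^-1` A : set Omega).
  by rewrite -[X in measurable X]setTI; exact: measurable_funP.
have muA : mu A = (fine (mu A))%:E by rewrite fineK// fin_num_measure.
have k0 : 0 <= fine (mu A) by rewrite fine_ge0.
pose m1 : {measure set Omega -> \bar R} := mrestr P mVA.
pose m2 : {measure set Omega -> \bar R} := mscale (NngNum k0) P.
rewrite setIC -[LHS]/(m1 B) (_ : (_ * _)%E = m2 B); last by rewrite muA.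
apply: (@g_sigma_algebra_measure_unique _ _ _ cylinders_off _ (fun=> setT)) => //.
- exact: cylinders_off_measurable.
- move=> _; exists [::], (fun=> setT); split => //.
  by rewrite big_nil.
- by apply/seteqP; split => // w _; exists 0%N.
- exact: cylinders_off_setI.
- move=> _ [s [C [us xs mC ->]]].
  have [dV iV] := iidV.
  rewrite /m1 /m2 /= /mrestr /mscale/= -muA.
  have hx i : i \in s -> (i == x) = false.
    by move=> si; apply: contraNF xs => /eqP <-.
  have mA' i : measurable (if i == x then A else C i).
    by case: ifP => _; [exact: mA|exact: mC].
  have := iV (x :: s) (fun i => if i == x then A else C i).
  rewrite /= xs us => /(_ isT mA').
  rewrite !big_cons eqxx.
  rewrite (eq_big_seq (fun i => V i @^-1` C i)); last by move=> i /hx ->.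
  rewrite (eq_big_seq (fun i => P (V i @^-1` C i))); last by move=> i /hx ->.
  by rewrite setIC -iV// -(dV x)// => ->.
- move=> _ /=; rewrite /m1/= /mrestr setTI.
  by rewrite (le_lt_trans (probability_le1 _ _))// ltry.
Qed.

Lemma distribution_coord_and_off (X : set (measurableTypeR R * off_type)) :
  measurable X -> (mu \x P_off)%E X = distribution P coord_and_off X.
Proof.
apply: product_measure_unique => A B mA mB.
by rewrite /distribution /pushforward/= -independent_off.
Qed.

(** Measurability of [h] on the product with [off_type] forces its second argument to act through
    the sites other than [x] only, so [V x] may be averaged alone with the rest frozen. *)
Lemma integral_decouple (h : measurableTypeR R * off_type -> \bar R) :
  measurable_fun setT h -> (forall z, (0 <= h z)%E) ->
  (\int[P]_w h (V x w, w) = \int[P]_w \int[mu]_v h (v, w))%E.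
Proof.
move=> mh h0.
transitivity (\int[distribution P coord_and_off]_z h z)%E.
  by rewrite ge0_integral_distribution.
rewrite (eq_measure_integral (mu \x P_off)%E); last first.
  by move=> A mA _; exact/esym/distribution_coord_and_off.
rewrite fubini_tonelli2// ge0_integral_distribution//.
- exact: measurable_fun_fubini_tonelli_G.
- by move=> w; exact: integral_ge0.
Qed.

Lemma integral_decouple_le (h : measurableTypeR R * off_type -> \bar R)
    (b : Omega -> \bar R) :
  measurable_fun setT h -> (forall z, (0 <= h z)%E) ->
  measurable_fun setT b ->
  (forall w, (\int[mu]_v h (v, w) <= b w)%E) ->
  (\int[P]_w h (V x w, w) <= \int[P]_w b w)%E.
Proof.
move=> mh h0 mb hb; rewrite integral_decouple//; apply: ge0_le_integral => //.
- by move=> w _; exact: integral_ge0.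
- apply: (measurableT_comp (f := fun w : off_type => (\int[mu]_v h (v, w))%E)
    (g := id : Omega -> off_type)); last exact: measurable_to_off.
  exact: measurable_fun_fubini_tonelli_G.
Qed.

End Decoupling.

(** * Finite-volume Green functions *)
Section FiniteVolume.
Variables (R : realType) (n : nat) (A : 'M[R]_n).
Hypothesis symA : forall i j, A i j = A j i.
Hypothesis diagA : forall i, A i i = 0.
Local Notation C := R[i].
Local Notation "x %:C" := (real_complex R x) : ring_scope.
Implicit Types (S : {set 'I_n}) (v : 'I_n -> R) (z : C).

(* The hamiltonian with the sites outside [S] decoupled (and given potential
   zero); keeping the index type fixed makes deleting a site a change of [S]. *)
Definition hmx S v : 'M[C]_n :=
  \matrix_(i, j) (if (i \in S) && (j \in S)
                  then A i j + (if i == j then v i else 0) else 0)%:C.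

Definition green S v z : 'M[C]_n := invmx (hmx S v - z%:M).

Lemma hmx_real S v : exists2 h : 'I_n -> 'I_n -> R,
  (forall i j, hmx S v i j = (h i j)%:C) & forall i j, h i j = h j i.
Proof.
exists (fun i j => if (i \in S) && (j \in S)
  then A i j + (if i == j then v i else 0) else 0).
  by move=> k l; rewrite mxE.
move=> k l; rewrite andbC symA eq_sym.
by case: (eqVneq l k) => [->|].
Qed.

Lemma hmx_sym S v i j : hmx S v i j = hmx S v j i.
Proof. by have [h hE hs] := hmx_real S v; rewrite !hE hs. Qed.

Lemma hmx_row_notin S v i j : i \notin S -> hmx S v i j = 0.
Proof. by move=> /negbTE iS; rewrite mxE iS. Qed.

Lemma hmx_offdiag S v i j : i \in S -> j \in S -> i != j ->
  hmx S v i j = (A i j)%:C.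
Proof. by move=> iS jS /negbTE ij; rewrite mxE iS jS ij addr0. Qed.

Lemma hmx_diag S v i : i \in S -> hmx S v i i = (v i)%:C.
Proof. by move=> iS; rewrite mxE iS eqxx diagA add0r. Qed.

Lemma hmx_delete S v x i j : i != x -> j != x ->
  hmx (S :\ x) v i j = hmx S v i j.
Proof. by move=> ix jx; rewrite !mxE !in_setD1 ix jx. Qed.

Lemma Im_quadratic_form S v (u : 'I_n -> C) :
  complex.Im (\sum_i (u i)^*%C * (\sum_j hmx S v i j * u j)) = 0.
Proof.
under eq_bigr do rewrite mulr_sumr.
set q := (X in complex.Im X).
suff qJ : q^*%C = q.
  by have := cImJ q; rewrite qJ => h; lra.
rewrite /q rmorph_sum exchange_big/=; apply: eq_bigr => i _.
rewrite rmorph_sum/=; apply: eq_bigr => j _.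
have [h hE hs] := hmx_real S v.
rewrite !rmorphM/= conjcK !hE hs conjc_real; ring.
Qed.

Lemma sum_shift (M : 'M[C]_n) z (u : 'I_n -> C) i :
  \sum_j (M - z%:M) i j * u j = \sum_j M i j * u j - z * u i.
Proof.
under eq_bigr do rewrite !mxE mulrBl.
rewrite sumrB; congr (_ - _); rewrite (bigD1 i)//= eqxx mulr1n big1 ?addr0//.
by move=> j /negbTE; rewrite eq_sym => ->; rewrite mul0r.
Qed.

(** Source of both the invertibility of [hmx S v - z%:M] off the real axis and the Ward identity. *)
Lemma Im_quadratic_shift S v z (u : 'I_n -> C) :
  complex.Im (\sum_i (u i)^*%C * (\sum_j (hmx S v - z%:M) i j * u j)) =
  - (complex.Im z * \sum_i cabs (u i) ^+ 2).
Proof.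
under eq_bigr do rewrite sum_shift mulrBr.
rewrite sumrB cImB Im_quadratic_form sub0r; congr (- _).
rewrite cIm_sum mulr_sumr; apply: eq_bigr => i _.
by rewrite mulrCA [_^*%C * _]mulrC -cabs_sqrC cImM cImC cReC mulr0 add0r.
Qed.

Lemma trmx_shift S v z : (hmx S v - z%:M)^T = hmx S v - z%:M.
Proof.
rewrite linearB/= tr_scalar_mx; congr (_ - _).
by apply/matrixP => i j; rewrite mxE hmx_sym.
Qed.

Section UpperHalfPlane.
Variable z : C.
Hypothesis imz : 0 < complex.Im z.

Lemma unitmx_shift S v : hmx S v - z%:M \in unitmx.
Proof.
rewrite -row_free_unit; apply: inj_row_free => u uD.
have Du i : \sum_j (hmx S v - z%:M) i j * u ord0 j = 0.
  have e : (u *m (hmx S v - z%:M)) ord0 i = 0 by rewrite uD mxE.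
  rewrite mxE in e; rewrite -[RHS]e; apply: eq_bigr => j _.
  by rewrite mulrC -[in LHS](trmx_shift S v z) [X in _ * X]mxE.
have := Im_quadratic_shift S v z (u ord0).
rewrite big1 => [/esym/eqP|i _]; last by rewrite Du mulr0.
rewrite oppr_eq0 mulf_eq0 gt_eqF//= psumr_eq0 => [|i _]; last by rewrite sqr_ge0.
move=> /allP h; apply/matrixP => i j; rewrite !mxE ord1.
by have := h j (mem_index_enum _); rewrite /= sqrf_eq0 cabs_eq0 => /eqP.
Qed.

Lemma green_sym S v i j : green S v z i j = green S v z j i.
Proof. by rewrite /green -{1}(trmx_shift S v z) -trmx_inv mxE. Qed.

Lemma green_eq S v i j :
  \sum_k (hmx S v - z%:M) i k * green S v z k j = (i == j)%:R.
Proof.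
have e := congr1 (fun M : 'M[C]_n => M i j) (mulmxV (unitmx_shift S v)).
by rewrite [LHS]mxE [RHS]mxE in e.
Qed.

Lemma z_neq0 : z != 0.
Proof. by apply: contraTneq imz => ->; rewrite ltxx. Qed.

Lemma green_notin S v i j : i \notin S -> i != j -> green S v z i j = 0.
Proof.
move=> iS /negbTE ij; have := green_eq S v i j.
rewrite sum_shift big1 => [|k _]; last by rewrite hmx_row_notin ?mul0r.
rewrite ij sub0r => /eqP; rewrite oppr_eq0 mulf_eq0 (negbTE z_neq0).
by move=> /eqP.
Qed.

(** Resolvent identity between [S] and [S :\ x]. The difference [W] of the two matrices lives on row
    and column [x], and the smaller Green function vanishes at (x, y), so only the hops out of [x]
    survive. *)
Lemma green_row_expansion S v x y : x \in S -> x != y ->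
  green S v z x y =
  - (green S v z x x * \sum_(b in S :\ x) (A x b)%:C * green (S :\ x) v z b y).
Proof.
move=> xS xy; set G := green S v z; set G' := green (S :\ x) v z.
have G'x j : j != x -> G' x j = 0.
  by move=> jx; rewrite green_notin ?in_setD1 ?eqxx// eq_sym.
pose W := hmx S v - hmx (S :\ x) v.
have h : G' - G *m W *m G' = G.
  rewrite (_ : W = (hmx S v - z%:M) - (hmx (S :\ x) v - z%:M)); last first.
    by rewrite opprB addrA subrK.
  rewrite mulmxBr mulmxBl mulVmx ?unitmx_shift// mul1mx.
  by rewrite -[G *m _ *m G']mulmxA mulmxV ?unitmx_shift// mulmx1 subKr.
have WE i j : W i j = hmx S v i j - hmx (S :\ x) v i j by rewrite !mxE.
have := congr1 (fun M : 'M[C]_n => M x y) h; rewrite mxE G'x 1?eq_sym// add0r => <-.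
rewrite !mxE; congr (- _).
have GW j : j != x -> (G *m W) x j = G x x * hmx S v x j.
  move=> jx; rewrite mxE (bigD1 x)//= big1 => [|k kx]; last first.
    by rewrite WE hmx_delete// subrr mulr0.
  by rewrite addr0 WE [hmx (S :\ x) v x j]hmx_row_notin ?subr0// in_setD1 eqxx.
rewrite (bigID (mem (S :\ x)))/= [X in _ + X]big1 ?addr0 => [|j]; last first.
  rewrite in_setD1 negb_and negbK => /orP[/eqP->|jS].
    by rewrite G'x ?mulr0 1?eq_sym.
  have [->|jx] := eqVneq j x; first by rewrite G'x ?mulr0 1?eq_sym.
  by rewrite GW// hmx_sym hmx_row_notin// mulr0 mul0r.
rewrite mulr_sumr; apply: eq_bigr => j; rewrite in_setD1 => /andP[jx jS].
by rewrite GW// hmx_offdiag 1?eq_sym// mulrA.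
Qed.

(* [colratio] is G(x, y) / G(y, y), and G(y, y) = 1 / (v y - selfen) is the Schur
   complement formula; neither [colratio] nor [selfen] involves [v y]. *)
Definition colratio S y v x : C :=
  - \sum_(b in S :\ y) green (S :\ y) v z x b * (A b y)%:C.

Definition selfen S y v : C := z - \sum_(j in S :\ y) (A y j)%:C * colratio S y v j.

Lemma green_col S v x y : y \in S -> x != y ->
  green S v z x y = colratio S y v x * green S v z y y.
Proof.
move=> yS xy; rewrite green_sym green_row_expansion//; last by rewrite eq_sym.
rewrite mulrC -mulNr; congr (- _ * _); apply: eq_bigr => b _.
by rewrite symA green_sym mulrC.
Qed.

Lemma green_diag S v y : y \in S ->
  green S v z y y * ((v y)%:C - selfen S y v) = 1.
Proof.
move=> yS; have := green_eq S v y y; rewrite eqxx mulr1n => <-.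
rewrite sum_shift (bigD1 y)//= hmx_diag// (bigID (mem S))/=.
rewrite [X in _ = _ + (_ + X) - _]big1 ?addr0 => [|j /andP[_ jS]]; last first.
  by rewrite hmx_sym hmx_row_notin ?mul0r.
rewrite /selfen opprB mulrDr mulrBr mulr_sumr.
have -> : \sum_(j in S :\ y) green S v z y y * ((A y j)%:C * colratio S y v j) =
    \sum_(i | (i != y) && (i \in S)) hmx S v y i * green S v z i y.
  apply: eq_big => [j|j /[!in_setD1]/andP[jy jS]]; first by rewrite in_setD1.
  by rewrite (green_col v yS jy) hmx_offdiag 1?eq_sym//; ring.
ring.
Qed.

(* The Ward identity. *)
Lemma Im_selfen S v y : y \in S ->
  complex.Im (selfen S y v) =
  complex.Im z * (1 + \sum_(x | x != y) cabs (colratio S y v x) ^+ 2).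
Proof.
(* [u] is column y of the Green function divided by its diagonal entry. It solves (H - z) u = (v y -
   selfen) delta_y with u y = 1, so the quadratic form at [u] is v y - selfen, and its imaginary
   part is known. *)
move=> yS; pose u i := if i == y then 1 else colratio S y v i.
have g0 : green S v z y y != 0.
  by apply: contra_eq_neq (green_diag v yS) => ->; rewrite mul0r eq_sym oner_neq0.
have uE i : green S v z i y = u i * green S v z y y.
  rewrite /u; case: eqVneq => [->|iy]; first by rewrite mul1r.
  by rewrite green_col.
have Du i : \sum_j (hmx S v - z%:M) i j * u j =
    if i == y then (v y)%:C - selfen S y v else 0.
  apply: (mulIf g0); rewrite mulr_suml.
  under eq_bigr do rewrite -mulrA -uE.
  by rewrite green_eq; case: eqP => _; rewrite ?mul0r// mulrC green_diag.
have := Im_quadratic_shift S v z u.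
rewrite (bigD1 y)//= [X in _ + X]big1; last first.
  by move=> i /negbTE iy; rewrite Du iy mulr0.
rewrite Du eqxx addr0 /u eqxx conjc1 mul1r cImB cImC sub0r => /oppr_inj ->.
rewrite (bigD1 y)//= eqxx cabs1 expr1n; congr (_ * (_ + _)).
by apply: eq_bigr => i /negbTE ->.
Qed.

Lemma Im_selfen_ge S v x y : y \in S -> x != y ->
  complex.Im z * (1 + cabs (colratio S y v x) ^+ 2) <= complex.Im (selfen S y v).
Proof.
move=> yS xy; rewrite Im_selfen// ler_pM2l// lerD2l (bigD1 x)//=.
by rewrite lerDl sumr_ge0// => i _; rewrite sqr_ge0.
Qed.

Lemma Im_selfen_ge_Im S v y : y \in S -> complex.Im z <= complex.Im (selfen S y v).
Proof.
move=> yS; rewrite Im_selfen// ler_peMr ?(ltW imz)// lerDl sumr_ge0// => i _.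
by rewrite sqr_ge0.
Qed.

Lemma cabs_green_diag S v y : y \in S ->
  cabs (green S v z y y) = (cabs ((v y)%:C - selfen S y v))^-1.
Proof.
move=> /(green_diag v) h; rewrite -cabsV; congr cabs.
apply: (mulIf (x := (v y)%:C - selfen S y v)); last first.
  rewrite h mulVf//; apply: contra_eq_neq h => ->.
  by rewrite mulr0 eq_sym oner_neq0.
by apply: contra_eq_neq h => ->; rewrite mulr0 eq_sym oner_neq0.
Qed.

End UpperHalfPlane.
End FiniteVolume.

(** * The lattice *)
Section Lattice.
Variable d : nat.
Implicit Types (x y w : site d) (j : 'I_d).

Definition l1norm x : nat := (\sum_j `|x ord0 j|)%N.

Lemma site_normE (R : realType) x : site_norm R x = (l1norm x)%:R.
Proof.
rewrite /site_norm /l1norm [RHS]pmulrn; congr (_%:~R).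
rewrite (big_morph Posz PoszD erefl); apply: eq_bigr => j _.
by rewrite abszE.
Qed.

Lemma l1norm0 : l1norm 0 = 0%N.
Proof. by rewrite /l1norm big1// => j _; rewrite mxE. Qed.

Lemma l1normD x y : (l1norm (x + y)%R <= l1norm x + l1norm y)%N.
Proof.
rewrite /l1norm -big_split/= leq_sum// => j _; rewrite mxE.
by rewrite -lez_nat PoszD !abszE ler_normD.
Qed.

Lemma l1normN x : l1norm (- x) = l1norm x.
Proof. by apply: eq_bigr => j _; rewrite mxE abszN. Qed.

Lemma l1norm_distC x y : l1norm (x - y)%R = l1norm (y - x)%R.
Proof. by rewrite -l1normN opprB. Qed.

Lemma l1norm_dist_triangle x y w : (l1norm (x - w)%R <= l1norm (x - y)%R + l1norm (y - w)%R)%N.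
Proof. by rewrite (leq_trans _ (l1normD _ _))// addrA subrK. Qed.

Lemma l1norm_unit j : l1norm (unit_site j) = 1%N.
Proof.
rewrite /l1norm (bigD1 j)//= mxE !eqxx big1// => k /negbTE kj.
by rewrite mxE kj andbF.
Qed.

Lemma unit_site_neq0 j : unit_site j != 0.
Proof. by apply/eqP => /(congr1 l1norm); rewrite l1norm_unit l1norm0. Qed.

(** Counting steps with multiplicity matches the double sum in [laplacian] term by term, without a
    proof that the 2 d neighbours are distinct. *)
Definition adj x y : nat :=
  (\sum_j ((y == (x + unit_site j)%R) + (y == (x - unit_site j)%R)))%N.

Lemma adjC x y : adj x y = adj y x.
Proof.
have flip (u w : site d) j : (u == w - unit_site j) = (w == u + unit_site j) :> bool.
  by rewrite eq_sym subr_eq.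
by apply: eq_bigr => j _; rewrite addnC; congr (_ + _)%N; rewrite flip.
Qed.

Lemma adjxx x : adj x x = 0%N.
Proof.
rewrite /adj big1// => j _.
rewrite -{1}[x]addr0 (inj_eq (addrI x)) eq_sym (negbTE (unit_site_neq0 j)).
rewrite -{1}[x]addr0 (inj_eq (addrI x)) eq_sym oppr_eq0.
by rewrite (negbTE (unit_site_neq0 j)).
Qed.

Lemma adj_dist x y : (0 < adj x y)%N -> l1norm (x - y)%R = 1%N.
Proof.
rewrite lt0n sum_nat_eq0 negb_forall => /existsP[j].
rewrite addn_eq0 negb_and !eqb0 !negbK => /orP[] /eqP->.
  by rewrite opprD addrA subrr add0r l1normN l1norm_unit.
by rewrite opprB addrC subrK l1norm_unit.
Qed.

Lemma adj_near x y w : (0 < adj x y)%N ->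
  (l1norm (x - w)%R <= (l1norm (y - w)%R).+1)%N.
Proof.
by move=> /adj_dist xy; rewrite (leq_trans (l1norm_dist_triangle x y w))// xy.
Qed.

Lemma sum_adj (s : seq (site d)) x : uniq s -> (\sum_(y <- s) adj x y <= d.*2)%N.
Proof.
move=> us; rewrite exchange_big/= (@leq_trans (\sum_(j < d) 2)%N)//; last first.
  by rewrite sum_nat_const card_ord muln2.
apply: leq_sum => j _; rewrite big_split/=.
have h w : (\sum_(y <- s) (y == w) <= 1)%N.
  have -> : (\sum_(y <- s) (y == w))%N = count_mem w s.
    by elim: (s) => [|a l ih]; rewrite ?big_nil ?big_cons//= ih.
  by rewrite count_uniq_mem// leq_b1.
by rewrite -[2%N]/(1 + 1)%N leq_add.
Qed.

Lemma sum_adj_inj (n : nat) (st : 'I_n -> site d) (P : pred 'I_n) x : injective st ->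
  (\sum_(i | P i) adj x (st i) <= d.*2)%N.
Proof.
move=> ist; rewrite (@leq_trans (\sum_i adj x (st i))%N)//.
  by rewrite [leqRHS](bigID P)/= leq_addr.
rewrite -(big_map st xpredT) sum_adj//.
by rewrite map_inj_uniq// /index_enum -enumT enum_uniq.
Qed.

Lemma laplacianE (R : realType) (s : seq (site d)) (f : wave R d) x : uniq s ->
  (forall y, y \notin s -> f y = 0) ->
  laplacian f x = \sum_(y <- s) (adj x y)%:R * f y.
Proof.
move=> us f0.
have h w : \sum_(y <- s) (y == w)%:R * f y = f w.
  have [ws|ws] := boolP (w \in s); last first.
    rewrite f0// big_seq big1// => y ys; case: eqP => [yw|]; last by rewrite mul0r.
    by rewrite -yw ys in ws.
  rewrite (bigD1_seq w)//= eqxx mul1r big1 ?addr0// => y /negbTE ->.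
  by rewrite mul0r.
rewrite /laplacian; under eq_bigr => j _ do rewrite -h -[f (x - _)]h -big_split/=.
rewrite exchange_big/=; apply: eq_bigr => y _.
by rewrite natr_sum mulr_suml; apply: eq_bigr => j _; rewrite natrD mulrDl.
Qed.

(* The sum over Z^d factors into d one-dimensional geometric sums. *)
Lemma lattice_sum_bounded (R : realType) (q : R) : 0 <= q < 1 ->
  exists2 K : R, 0 < K &
    forall s : seq (site d), uniq s -> \sum_(x <- s) q ^+ l1norm x <= K.
Proof.
move=> /andP[q0 q1]; exists ((2 / (1 - q)) ^+ d).
  by rewrite exprn_gt0// divr_gt0// subr_gt0.
move=> s us.
pose N := (\max_(x <- s) l1norm x)%N.
have hN x : x \in s -> (l1norm x <= N)%N by move=> xs; rewrite leq_bigmax_seq.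
(* Sign and absolute value of each coordinate. The code is injective on [s], and the sum over all
   codes is a product of d equal factors, each at most 2 / (1 - q), the 2 coming from the sign. *)
pose code (x : site d) : {ffun 'I_d -> bool * 'I_N.+1} :=
  [ffun j => (x ord0 j < 0, inord `|x ord0 j|%N)].
have le1 (x : site d) j : (`|x ord0 j| <= l1norm x)%N.
  by rewrite /l1norm (bigD1 j)//= leq_addr.
have code_val x j : x \in s -> ((code x j).2 = `|x ord0 j|%N :> nat).
  by move=> xs; rewrite ffunE/= inordK// ltnS (leq_trans (le1 x j))// hN.
have code_inj : {in s &, injective code}.
  move=> x y xs ys xy; apply/matrixP => i j; rewrite (ord1 i).
  have e2 : `|x ord0 j|%N = `|y ord0 j|%N by rewrite -!code_val// xy.
  have e1 : (x ord0 j < 0) = (y ord0 j < 0).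
    by have := congr1 (fun f : {ffun _ -> _} => (f j).1) xy; rewrite !ffunE.
  by move: e1 e2; move: (x ord0 j) (y ord0 j) => a b; lia.
pose F (f : {ffun 'I_d -> bool * 'I_N.+1}) := \prod_j q ^+ (f j).2 : R.
have FE x : x \in s -> q ^+ l1norm x = F (code x).
  move=> xs; rewrite /F /l1norm -expr_sum/=.
  by congr (q ^+ _); apply: eq_bigr => j _; rewrite code_val.
rewrite (eq_big_seq _ FE) -(big_map code xpredT F).
have F0 f : 0 <= F f by rewrite /F prodr_ge0// => j _; rewrite exprn_ge0.
rewrite (@le_trans _ _ (\sum_f F f))//.
  rewrite big_uniq ?map_inj_in_uniq//=.
  by rewrite [leRHS](bigID (mem (map code s)))/= lerDl sumr_ge0.
rewrite /F -(bigA_distr_bigA (fun (j : 'I_d) (k : bool * 'I_N.+1) => q ^+ k.2))/=.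
rewrite prodr_const card_ord.
have -> : \sum_(k : bool * 'I_N.+1) q ^+ k.2 = 2 * \sum_(k < N.+1) q ^+ k :> R.
  rewrite -(pair_bigA _ (fun (b : bool) (k : 'I_N.+1) => q ^+ k))/=.
  by rewrite big_bool/= mulr2n mulrDl mul1r.
have g0 : 0 <= 2 * \sum_(k < N.+1) q ^+ k.
  by rewrite mulr_ge0// sumr_ge0// => k _; rewrite exprn_ge0.
rewrite lerXn2r ?nnegrE ?divr_ge0 ?subr_ge0 ?(ltW q1)//.
rewrite ler_pM2l// -[leRHS]div1r ler_pdivlMr ?subr_gt0// mulrC.
rewrite -[X in X <= _]opprK -mulNr opprB -subrX1 opprB.
by rewrite lerBlDr lerDl exprn_ge0.
Qed.

End Lattice.

(** * Fractional moments *)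
Section GreenMeasurability.
Variables (R : realType) (n : nat) (A : 'M[R]_n).
Hypothesis symA : forall i j, A i j = A j i.
Hypothesis diagA : forall i, A i i = 0.
Variables (dd : measure_display) (T : measurableType dd) (v : T -> 'I_n -> R).
Variable z : R[i].
Hypothesis imz : 0 < complex.Im z.

(** Only the potentials inside [S] have to be measurable. Applied to [S :\ x], this gives
    measurability for the sigma-algebra that ignores site x. *)
Lemma cmeasurable_green (S : {set 'I_n}) :
  (forall i, i \in S -> measurable_fun setT (v^~ i)) ->
  forall i j, cmeasurable (fun t => green A S (v t) z i j).
Proof.
move=> mv; apply: cmeasurable_invmx => [t|i j]; first exact: unitmx_shift.
have -> : (fun t => (hmx A S (v t) - z%:M) i j) =
    (fun t => hmx A S (v t) i j + - (z *+ (i == j))).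
  by apply/funext => t; rewrite [LHS]mxE [(- z%:M) i j]mxE [z%:M i j]mxE.
apply: cmeasurableD; last exact: cmeasurable_cst.
have -> : (fun t => hmx A S (v t) i j) = (fun t => (if (i \in S) && (j \in S)
    then A i j + (if i == j then v t i else 0) else 0)%:C%C).
  by apply/funext => t; rewrite mxE.
apply: cmeasurable_real.
case: (boolP (i \in S)) => iS /=; last exact: measurable_cst.
case: (j \in S); last exact: measurable_cst.
apply: measurable_funD; first exact: measurable_cst.
by case: (i == j); [exact: mv|exact: measurable_cst].
Qed.

Variables (S : {set 'I_n}) (y : 'I_n).
Hypothesis mv : forall i, i != y -> measurable_fun setT (v^~ i).

Lemma cmeasurable_colratio i : cmeasurable (fun t => colratio A z S y (v t) i).
Proof.
apply: cmeasurableN; apply: cmeasurable_sum => b _.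
apply: cmeasurableM; last exact: cmeasurable_cst.
by apply: cmeasurable_green => k /setD1P[ky _]; exact: mv.
Qed.

Lemma cmeasurable_selfen : cmeasurable (fun t => selfen A z S y (v t)).
Proof.
apply: cmeasurableD; first exact: cmeasurable_cst.
apply: cmeasurableN; apply: cmeasurable_sum => b _.
apply: cmeasurableM; first exact: cmeasurable_cst.
exact: cmeasurable_colratio.
Qed.

End GreenMeasurability.

Lemma measurable_sum_cond (R : realType) (dd : measure_display)
    (T : measurableType dd) (I : Type) (r : seq I) (P : pred I) (F : I -> T -> R) :
  (forall i, P i -> measurable_fun setT (F i)) ->
  measurable_fun setT (fun t => \sum_(i <- r | P i) F i t).
Proof.
move=> mF; have [+ _] := @cmeasurable_sum _ _ _ _ r P (fun i t => (F i t)%:C%C)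
  (fun i Pi => cmeasurable_real (mF i Pi)).
by under eq_fun => t do rewrite -rmorph_sum/=.
Qed.

Lemma integral_scale (R : realType) (dd : measure_display) (T : measurableType dd)
    (m : {measure set T -> \bar R}) (c : R) (f : T -> R) :
  0 <= c -> (forall t, 0 <= f t) -> measurable_fun setT f ->
  (\int[m]_t (c * f t)%:E = c%:E * \int[m]_t (f t)%:E)%E.
Proof.
move=> c0 f0 mf; under eq_integral => t _ do rewrite EFinM.
by rewrite ge0_integralZl_EFin// => [t _|]; [rewrite lee_fin|exact/measurable_EFinP].
Qed.

Lemma integral_sum_scale (R : realType) (dd : measure_display) (T : measurableType dd)
    (m : {measure set T -> \bar R}) (I : Type) (r : seq I) (P : pred I)
    (c : I -> R) (f : I -> T -> R) :
  (forall i, 0 <= c i) -> (forall i t, 0 <= f i t) ->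
  (forall i, measurable_fun setT (f i)) ->
  (\int[m]_t (\sum_(i <- r | P i) c i * f i t)%:E =
   \sum_(i <- r | P i) ((c i)%:E * \int[m]_t (f i t)%:E))%E.
Proof.
move=> c0 f0 mf; rewrite -big_filter.
under eq_integral => t _ do rewrite -big_filter -sumEFin.
rewrite ge0_integral_sum//.
- by apply: eq_bigr => i _; rewrite integral_scale.
- by move=> i; apply/measurable_EFinP; exact: measurable_funM.
- by move=> i t _; rewrite lee_fin mulr_ge0.
Qed.

(** Plays the part of the triangle inequality for the power 1/2 of the modulus. *)
Lemma sqrt_sum_le (R : realType) (I : Type) (r : seq I) (P : pred I) (F : I -> R) :
  (forall i, P i -> 0 <= F i) ->
  Num.sqrt (\sum_(i <- r | P i) F i) <= \sum_(i <- r | P i) Num.sqrt (F i).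
Proof.
move=> F0; elim: r => [|i r ih]; first by rewrite !big_nil sqrtr0.
rewrite !big_cons; case: ifP => // Pi.
have s0 : 0 <= \sum_(j <- r | P j) F j by rewrite sumr_ge0.
rewrite (@le_trans _ _ (Num.sqrt (F i) + Num.sqrt (\sum_(j <- r | P j) F j)))//.
  rewrite -ler_sqr ?nnegrE ?addr_ge0 ?sqrtr_ge0// sqrrD !sqr_sqrtr ?addr_ge0 ?F0//.
  by rewrite addrAC lerDl mulrn_wge0// mulr_ge0 ?sqrtr_ge0.
by rewrite lerD2l.
Qed.

Section FractionalMoments.
Variables (R : realType) (d : nat).
Variables (dO : measure_display) (Omega : measurableType dO).
Variables (P : probability Omega R).
Variables (V : site d -> {RV P >-> measurableTypeR R}).
Variable (mu : probability (measurableTypeR R) R).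
Hypothesis iidV : iid V mu.
Hypothesis hmu : concentration_bound mu.
Variable eps : R.
Hypothesis eps0 : 0 <= eps.
Hypothesis eps_small : 36 * d%:R * eps <= 1.
Variables (n : nat) (st : 'I_n -> site d).
Hypothesis st_inj : injective st.

Definition hop : 'M[R]_n := \matrix_(i, j) (eps ^+ 2 * (adj (st i) (st j))%:R).

Lemma hop_sym i j : hop i j = hop j i.
Proof. by rewrite !mxE adjC. Qed.

Lemma hop_diag i : hop i i = 0.
Proof. by rewrite mxE adjxx mulr0. Qed.

Variable z : R[i].
Hypothesis imz : 0 < complex.Im z.

Let pot (w : Omega) (i : 'I_n) : R := V (st i) w.
Let G S w i j := green hop S (pot w) z i j.
Let dst i j := l1norm (st i - st j).

Lemma measurable_pot i : measurable_fun setT (pot^~ i).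
Proof. exact: (measurable_funP (V (st i))). Qed.

Lemma cmeasurable_G S i j : cmeasurable (fun w => G S w i j).
Proof.
by apply: cmeasurable_green => //; [exact: hop_sym|move=> k _; exact: measurable_pot].
Qed.

Lemma measurable_sqrt_G S i j :
  measurable_fun setT (fun w => Num.sqrt (cabs (G S w i j))).
Proof. by apply: measurable_sqrtr; apply: measurable_cabs; exact: cmeasurable_G. Qed.

Lemma measurable_off_pot x i : i != x ->
  measurable_fun setT (pot^~ i : off_type V (st x) -> measurableTypeR R).
Proof. by move=> ix; apply: measurable_off_coord; rewrite (inj_eq st_inj). Qed.

Lemma cmeasurable_off_selfen S x :
  cmeasurable (fun w : off_type V (st x) => selfen hop z S x (pot w)).
Proof.
apply: cmeasurable_selfen => //; first exact: hop_sym.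
by move=> i; exact: measurable_off_pot.
Qed.

Lemma cmeasurable_dist S x :
  cmeasurable (fun u : measurableTypeR R * off_type V (st x) =>
    u.1%:C%C - selfen hop z S x (pot u.2)).
Proof.
apply: cmeasurableD.
  by apply: cmeasurable_real; exact: measurable_fst.
apply: cmeasurableN; have [m1 m2] := cmeasurable_off_selfen S x.
split; first exact: (measurableT_comp m1 measurable_snd).
exact: (measurableT_comp m2 measurable_snd).
Qed.

Lemma Im_selfen_gt0 (S : {set 'I_n}) x w : x \in S -> 0 < complex.Im (selfen hop z S x (pot w)).
Proof.
move=> xS; apply: (lt_le_trans imz); apply: Im_selfen_ge_Im => //.
- exact: hop_sym.
- exact: hop_diag.
Qed.

Lemma sqrt_hop i j : Num.sqrt (hop i j) <= eps * (adj (st i) (st j))%:R.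
Proof.
rewrite mxE sqrtrM ?sqr_ge0// sqrtr_sqr ger0_norm// ler_wpM2l//.
rewrite -[leRHS](ger0_norm (ler0n _ _)) -sqrtr_sqr ler_wsqrtr//.
by case: adj => [|k]; rewrite ?expr0n// -natrX ler_nat leq_pmulr.
Qed.

Let half_dist (i j k : 'I_n) : (0 < adj (st i) (st j))%N ->
  (2^-1 : R) ^+ dst j k <= 2 * 2^-1 ^+ dst i k.
Proof.
move=> ij; have := adj_near (st k) ij; rewrite -/(dst i k) -/(dst j k) => h.
rewrite -[leLHS]mul1r -{1}(mulfV (_ : 2 != 0 :> R))// -mulrA -exprS ler_pM2l//.
by rewrite ler_wiXn2l//; lra.
Qed.

(** Origin of the smallness condition: at most 2 d neighbours, each with hopping eps, bound 9, and a
    factor 2 because a neighbour may be one unit closer to y; the product is 36 d eps <= 1. The 9 is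
    consumed here and returns from the average over the potential at x. *)
Let sum_hops (p : 'I_n -> bool) x y (F : 'I_n -> \bar R) :
  (forall b, p b -> (0 <= F b)%E) ->
  (forall b, p b -> (F b <= (9 * 2^-1 ^+ dst b y)%:E)%E) ->
  (\sum_(b | p b) ((eps * (adj (st x) (st b))%:R)%:E * F b) <=
   (2^-1 ^+ dst x y)%:E)%E.
Proof.
move=> F0 hF.
pose q : R := 2^-1 ^+ dst x y.
have q0 : 0 <= q by rewrite exprn_ge0.
rewrite (@le_trans _ _ (\sum_(b | p b) (eps * (adj (st x) (st b))%:R * (18 * q))%:E)%E)//.
  apply: lee_sum => b pb; rewrite [leRHS]EFinM.
  have [->|a0] := posnP (adj (st x) (st b)).
    by rewrite mulr0n mulr0 !mul0e.
  rewrite lee_wpmul2l ?lee_fin ?mulr_ge0//.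
  rewrite (le_trans (hF b pb))// lee_fin (_ : 18 = 9 * 2 :> R); last by lra.
  by rewrite -mulrA ler_pM2l// half_dist.
rewrite sumEFin lee_fin -mulr_suml -mulr_sumr -natr_sum.
have := sum_adj_inj p (st x) st_inj; rewrite -(ler_nat R) -muln2 natrM => h.
rewrite mulrA ler_piMl//.
by have := ler_wpM2l eps0 h; have := eps_small; lra.
Qed.

Let sqrt_hops (p : 'I_n -> bool) x (F : 'I_n -> R[i]) :
  Num.sqrt (cabs (\sum_(b | p b) (hop x b)%:C%C * F b)) <=
  \sum_(b | p b) eps * (adj (st x) (st b))%:R * Num.sqrt (cabs (F b)).
Proof.
rewrite (le_trans (ler_wsqrtr (cabs_sum _ _ _)))//.
rewrite (le_trans (sqrt_sum_le _ _))// => [b _|]; first exact: cabs_ge0.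
apply: ler_sum => b _; rewrite cabsM sqrtrM ?cabs_ge0// ler_wpM2r ?sqrtr_ge0//.
rewrite cabs_real ger0_norm ?sqrt_hop//.
by rewrite mxE mulr_ge0// sqr_ge0.
Qed.

(* Each step from x to a neighbour b costs eps, at most 2 d neighbours, and the
   average 9 of |V x - selfen|^(-1/2); with 36 d eps <= 1 the total is at most 1/2. *)
Lemma fractional_moment_aux (m : nat) (S : {set 'I_n}) : (#|S| <= m)%N ->
  forall x y, x \in S -> y \in S ->
  (\int[P]_w (Num.sqrt (cabs (G S w x y)))%:E <= (9 * 2^-1 ^+ dst x y)%:E)%E.
Proof.
elim: m S => [|m ih] S Sm x y xS yS.
  by move: Sm; rewrite leqn0 cards_eq0 => /eqP S0; rewrite S0 inE in xS.
have mdist := measurable_cabs (cmeasurable_dist S x).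
have mh := measurable_invr_ge0 (fun u => sqrtr_ge0 _) (measurable_sqrtr mdist).
have intmu w : (\int[mu]_v ((Num.sqrt (cabs (v%:C%C - selfen hop z S x (pot w))))^-1)%:E <= 9%:E)%E.
  by apply: integral_inv_sqrt_dist_le => //; exact: Im_selfen_gt0.
have diagE w : Num.sqrt (cabs (G S w x x)) =
    (Num.sqrt (cabs ((V (st x) w)%:C%C - selfen hop z S x (pot w))))^-1.
  by rewrite /G (cabs_green_diag hop_sym hop_diag imz)// sqrtrV// cabs_ge0.
have [<-|xy] := eqVneq x y.
  rewrite /dst subrr l1norm0 expr0 mulr1.
  under eq_integral => w _ do rewrite diagE.
  pose h (u : measurableTypeR R * off_type V (st x)) :=
    ((Num.sqrt (cabs (u.1%:C%C - selfen hop z S x (pot u.2))))^-1)%:E.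
  have := @integral_decouple_le _ _ _ _ _ _ _ iidV (st x) h (fun=> 9%:E).
  rewrite (integral_cst P measurableT)/= probability_setT mule1; apply.
  - exact/measurable_EFinP.
  - by move=> u; rewrite lee_fin invr_ge0 sqrtr_ge0.
  - exact: measurable_cst.
  - exact: intmu.
have cardS : (#|S :\ x| <= m)%N by move: Sm; rewrite (cardsD1 x) xS.
have ySx : y \in S :\ x by rewrite in_setD1 eq_sym xy.
(* [B] involves the Green function of [S :\ x] only, so it is a constant for the average over the
   potential at x. It has to be measurable twice: on [off_type] for the decoupling and on [Omega]
   for the final integral. *)
pose B w := \sum_(b in S :\ x) eps * (adj (st x) (st b))%:R *
  Num.sqrt (cabs (G (S :\ x) w b y)).
have B0 w : 0 <= B w.
  by apply: sumr_ge0 => b _; rewrite !mulr_ge0 ?sqrtr_ge0.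
have mB : measurable_fun setT (B : off_type V (st x) -> R).
  apply: measurable_sum_cond => b _; apply: measurable_funM; first exact: measurable_cst.
  apply: measurable_sqrtr; apply: measurable_cabs; apply: cmeasurable_green => //.
    exact: hop_sym.
  by move=> i /setD1P[ix _]; exact: measurable_off_pot.
have mB' : measurable_fun setT (B : Omega -> R).
  apply: measurable_sum_cond => b _; apply: measurable_funM; first exact: measurable_cst.
  exact: measurable_sqrt_G.
pose h (u : measurableTypeR R * off_type V (st x)) :=
  ((Num.sqrt (cabs (u.1%:C%C - selfen hop z S x (pot u.2))))^-1 * B u.2)%:E.
have h0 u : (0 <= h u)%E by rewrite lee_fin mulr_ge0// invr_ge0 sqrtr_ge0.
have mhB : measurable_fun setT h.
  apply/measurable_EFinP; apply: measurable_funM => //.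
  exact: (measurableT_comp mB measurable_snd).
apply: (@le_trans _ _ (\int[P]_w h (V (st x) w, w))%E).
  apply: ge0_le_integral => //.
  - by apply/measurable_EFinP; exact: measurable_sqrt_G.
  - exact: measurable_decoupled.
  - move=> w _; rewrite lee_fin.
    rewrite {1}/G (green_row_expansion hop_sym imz)// cabsN cabsM sqrtrM ?cabs_ge0//.
    by rewrite -/(G S w x x) diagE ler_wpM2l ?invr_ge0 ?sqrtr_ge0// sqrt_hops.
apply: (@le_trans _ _ (\int[P]_w (9%:E * (B w)%:E))%E).
  apply: (integral_decouple_le iidV mhB h0 (b := fun w => (9%:E * (B w)%:E)%E)).
    by apply: measurable_funeM; exact/measurable_EFinP.
  move=> w; rewrite /h/=; under eq_integral => v _ do rewrite mulrC.
  pose f (v : measurableTypeR R) := (Num.sqrt (cabs (v%:C%C - selfen hop z S x (pot w))))^-1.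
  have f0 v : 0 <= f v by rewrite invr_ge0 sqrtr_ge0.
  have mf : measurable_fun setT f.
    apply: measurable_invr_ge0; first by move=> v; rewrite sqrtr_ge0.
    by apply: measurable_sqrtr; exact: measurable_dist.
  rewrite (integral_scale mu (B0 w) f0 mf) (muleC 9%:E).
  by apply: lee_wpmul2l; [rewrite lee_fin|exact: intmu].
have -> : (\int[P]_w (9%:E * (B w)%:E) = 9%:E * \int[P]_w (B w)%:E)%E.
  exact: (integral_scale P _ B0 mB').
rewrite EFinM lee_wpmul2l ?lee_fin//.
rewrite /B integral_sum_scale; last 3 first.
- by move=> b; rewrite mulr_ge0.
- by move=> b w; rewrite sqrtr_ge0.
- by move=> b; exact: measurable_sqrt_G.
apply: sum_hops => b bS.
  by apply: integral_ge0 => w _; rewrite lee_fin sqrtr_ge0.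
exact: ih.
Qed.

Lemma fractional_moment (S : {set 'I_n}) x y : x \in S -> y \in S ->
  (\int[P]_w (Num.sqrt (cabs (G S w x y)))%:E <= (9 * 2^-1 ^+ dst x y)%:E)%E.
Proof. exact: fractional_moment_aux. Qed.

(* Graf's bound: averaging over the potential at [y] turns eta |G|^2 into a
   fractional moment, because the Ward identity controls Im (selfen) from below
   by eta (1 + |r|^2), where r = G x y / G y y does not involve V y. *)
Lemma second_moment (S : {set 'I_n}) x y : x \in S -> y \in S ->
  (\int[P]_w (complex.Im z * cabs (G S w x y) ^+ 2)%:E <=
   (16 * 2^-1 ^+ dst x y)%:E)%E.
Proof.
move=> xS yS; set eta := complex.Im z.
have eta0 : 0 < eta := imz.
pose r w : R[i] := if x == y then 1 else colratio hop z S y (pot w) x.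
pose B w := if x == y then 1 else Num.sqrt (cabs (r w)).
have GE w : cabs (G S w x y) ^+ 2 = cabs (r w) ^+ 2 *
    (cabs ((V (st y) w)%:C%C - selfen hop z S y (pot w)) ^+ 2)^-1.
  rewrite -exprVn -exprMn -(cabs_green_diag hop_sym hop_diag imz)// -cabsM.
  rewrite /r /G; case: eqVneq => [->|xy]; first by rewrite mul1r.
  by rewrite -(green_col hop_sym imz).
have mr : cmeasurable (r : off_type V (st y) -> R[i]).
  rewrite /r; case: (x == y); first exact: cmeasurable_cst.
  apply: cmeasurable_colratio => //; first exact: hop_sym.
  by move=> i; exact: measurable_off_pot.
have mB : measurable_fun setT (B : Omega -> R).
  rewrite /B; case: (x == y); first exact: measurable_cst.
  apply: measurable_sqrtr; apply: measurable_cabs.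
  have [m1 m2] := mr.
  split; first exact: measurable_of_off m1.
  exact: measurable_of_off m2.
have B0 w : 0 <= B w by rewrite /B; case: ifP => // _; rewrite sqrtr_ge0.
pose h (u : measurableTypeR R * off_type V (st y)) :=
  (eta * cabs (r u.2) ^+ 2 *
   (cabs (u.1%:C%C - selfen hop z S y (pot u.2)) ^+ 2)^-1)%:E.
have h0 u : (0 <= h u)%E.
  by rewrite lee_fin; apply: mulr_ge0; [apply: mulr_ge0; [exact: ltW|exact: sqr_ge0]|rewrite invr_ge0 sqr_ge0].
have mh : measurable_fun setT h.
  apply/measurable_EFinP; apply: measurable_funM.
    apply: measurable_funM; first exact: measurable_cst.
    apply: measurable_funX.
    exact: (measurableT_comp (measurable_cabs mr) measurable_snd).
  apply: measurable_invr_ge0; first by move=> u; rewrite sqr_ge0.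
  by apply: measurable_funX; apply: measurable_cabs; exact: cmeasurable_dist.
have Im_ge w : eta * (1 + cabs (r w) ^+ 2) <= complex.Im (selfen hop z S y (pot w)) \/
    x = y /\ eta <= complex.Im (selfen hop z S y (pot w)).
  rewrite /r; case: (eqVneq x y) => [->|xy]; [right; split=> //|left].
    exact: (Im_selfen_ge_Im hop_sym hop_diag imz).
  exact: (Im_selfen_ge hop_sym hop_diag imz).
apply: (@le_trans _ _ (\int[P]_w (16 * B w)%:E)%E).
  under eq_integral => w _ do rewrite GE mulrA.
  apply: (integral_decouple_le iidV mh h0 (b := fun w => (16 * B w)%:E)).
    by apply/measurable_EFinP; apply: measurable_funM.
  move=> w; rewrite /h/=.
  have c0 : 0 <= eta * cabs (r w) ^+ 2 by rewrite mulr_ge0 ?sqr_ge0// ltW.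
  have im0 := Im_selfen_gt0 w yS.
  rewrite integral_scale//; last 2 first.
  - by move=> v; rewrite invr_ge0 sqr_ge0.
  - apply: measurable_invr_ge0; first by move=> v; rewrite sqr_ge0.
    by apply: measurable_funX; exact: measurable_dist.
  apply: (le_trans (lee_wpmul2l _ (integral_inv_sqr_dist_le hmu im0))).
    by rewrite lee_fin.
  rewrite -EFinM lee_fin mulrCA ler_pM2l// ler_pdivrMr//.
  have [hI|[xy hI]] := Im_ge w.
    set t := cabs (r w) in hI *.
    have t0 : 0 <= t := cabs_ge0 _.
    (* Here the square turns into a square root: t^2 / (1 + t^2) <= t^(1/2), by comparing with t^2
       when t <= 1 and with 1 when t > 1. *)
    have hB : t ^+ 2 <= B w * (1 + t ^+ 2).
      rewrite /B; case: eqVneq => xy; first by rewrite mul1r; lra.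
      rewrite -/t; set u := Num.sqrt t.
      have u0 : 0 <= u := sqrtr_ge0 _.
      have -> : t = u ^+ 2 by rewrite sqr_sqrtr.
      rewrite -exprM; have [u1|u1] := leP u 1.
        have : u ^+ 4 <= u by rewrite -[leRHS]expr1 ler_wiXn2l.
        have : 0 <= u * u ^+ 4 by rewrite mulr_ge0// exprn_ge0.
        by rewrite /= => h1 h2; rewrite mulrDr mulr1; lra.
      have : u ^+ 4 <= u * u ^+ 4 by rewrite ler_peMl ?exprn_ge0// ltW.
      by move=> h1; rewrite mulrDr mulr1; lra.
    apply: (le_trans (ler_wpM2l (ltW eta0) hB)).
    by rewrite mulrCA ler_wpM2l.
  rewrite /r /B; case: eqP => // _; rewrite cabs1 expr1n mulr1 mul1r.
  exact: hI.
rewrite integral_scale//.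
rewrite EFinM lee_wpmul2l ?lee_fin//.
have [xy|xy] := eqVneq x y.
  rewrite /B xy /dst subrr l1norm0 expr0.
  under eq_integral => w _ do rewrite eqxx.
  by rewrite (integral_cst P measurableT)/= probability_setT mule1.
(* What remains is the mean of |r|^(1/2). By its definition r is one hop out of y followed by a
   Green function of [S :\ y], so [sum_hops] applies with x and y exchanged and the fractional
   moment bound closes the estimate. *)
apply: (@le_trans _ _ (\int[P]_w (\sum_(b in S :\ y)
    (eps * (adj (st y) (st b))%:R) * Num.sqrt (cabs (G (S :\ y) w b x)))%:E)%E).
  apply: ge0_le_integral => //.
  - by move=> w _; rewrite lee_fin.
  - exact/measurable_EFinP.
  - apply/measurable_EFinP; apply: measurable_sum_cond => b _.
    by apply: measurable_funM => //; exact: measurable_sqrt_G.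
  - move=> w _; rewrite lee_fin /B /r (negbTE xy) cabsN.
    rewrite (_ : \sum_(b in S :\ y) _ =
      \sum_(b in S :\ y) (hop y b)%:C%C * green hop (S :\ y) (pot w) z b x).
      exact: sqrt_hops.
    by apply: eq_bigr => b _; rewrite mulrC hop_sym green_sym//; exact: hop_sym.
rewrite integral_sum_scale; last 3 first.
- by move=> b; rewrite mulr_ge0.
- by move=> b w; rewrite sqrtr_ge0.
- by move=> b; exact: measurable_sqrt_G.
rewrite /dst l1norm_distC; apply: sum_hops => b bS.
  by apply: integral_ge0 => w _; rewrite lee_fin sqrtr_ge0.
by apply: fractional_moment; rewrite // in_setD1 xy.
Qed.

End FractionalMoments.

(** * Spectral projections of a box *)
Lemma conjC_conjc (R : realType) (x : R[i]) : Num.conj x = x^*%C.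
Proof. by []. Qed.

Section SpectralDecomposition.
Local Open Scope sesquilinear_scope.
Variables (R : realType) (n : nat).
Local Notation C := R[i].
Local Notation "x %:C" := (real_complex R x) : ring_scope.
Variable H : 'M[C]_n.
Hypothesis H_herm : forall i j, H j i = (H i j)^*%C.

(* [Q l] is the orthogonal projection on the eigenspace of [l]; [L] may contain
   reals that are not eigenvalues, with [Q l = 0]. *)
Definition spectral_family (L : seq R) (Q : R -> 'M[C]_n) :=
  [/\ uniq L,
      forall i j, \sum_(l <- L) Q l i j = (i == j)%:R,
      forall l m i j, l \in L -> m \in L ->
        \sum_k Q l i k * Q m k j = if l == m then Q l i j else 0,
      forall l i j, Q l j i = (Q l i j)^*%C &
      forall l i j, l \in L -> \sum_k H i k * Q l k j = l%:C * Q l i j].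

Lemma hermitian_eigenbasis : exists (e : 'I_n -> R) (U : 'M[C]_n),
  [/\ forall k l, \sum_i U k i * (U l i)^*%C = (k == l)%:R,
      forall i j, \sum_k (U k i)^*%C * U k j = (i == j)%:R &
      forall i j, H i j = \sum_k (U k i)^*%C * (e k)%:C * U k j].
Proof.
have Hsym : H \is hermsymmx.
  apply/is_hermitianmxP; rewrite expr0 scale1r; apply/matrixP => i j.
  by rewrite !mxE conjC_conjc -H_herm.
have Hn := hermitian_normalmx Hsym.
have Hreal := hermitian_spectral_diag_real Hsym.
set U := spectralmx H; set D := spectral_diag H.
have Uu : U \is unitarymx := spectral_unitarymx H.
have HE : H = U^t* *m diag_mx D *m U.
  by rewrite -invmx_unitary//; exact/orthomx_spectralP.
have DE k : D 0 k = (complex.Re (D 0 k))%:C.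
  by rewrite RRe_real//; have /mxOverP := Hreal; apply.
exists (fun k => complex.Re (D 0 k)), U; split.
- move=> k l; have /unitarymxP/(congr1 (fun M : 'M[C]_n => M k l)) := Uu.
  by rewrite !mxE => <-; apply: eq_bigr => i _; rewrite !mxE.
- move=> i j.
  have /(congr1 (fun M : 'M[C]_n => M i j)) : U^t* *m U = 1%:M.
    by rewrite -invmx_unitary// mulVmx// unitarymx_unit.
  by rewrite !mxE => <-; apply: eq_bigr => k _; rewrite !mxE.
- move=> i j; rewrite {1}HE mxE; apply: eq_bigr => k _; congr (_ * _).
  by rewrite mul_mx_diag !mxE -DE.
Qed.

(** Eigenvectors with the same eigenvalue are grouped, and the list of eigenvalues has no
    repetition, so that distinct entries have a positive gap when the resolvent is compared with a
    single projection. *)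
Lemma spectral_family_exists : exists L Q, spectral_family L Q.
Proof.
have [e [U [U1 U2 HE]]] := hermitian_eigenbasis.
pose Q l : 'M[C]_n := \matrix_(i, j) \sum_(k | e k == l) (U k i)^*%C * U k j.
have HU i k : \sum_j H i j * (U k j)^*%C = (e k)%:C * (U k i)^*%C.
  under eq_bigr do rewrite HE mulr_suml.
  rewrite exchange_big/= (bigD1 k)//= [X in _ + X]big1 ?addr0; last first.
    move=> l lk; under eq_bigr do rewrite -mulrA.
    by rewrite -mulr_sumr U1 (negbTE lk) mulr0.
  under eq_bigr do rewrite -mulrA.
  by rewrite -mulr_sumr U1 eqxx mulr1 mulrC.
exists (undup [seq e k | k : 'I_n]), Q; split.
- exact: undup_uniq.
- move=> i j; rewrite -U2; under eq_bigr do rewrite mxE.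
  rewrite (exchange_big_dep xpredT)//=; apply: eq_bigr => k _.
  rewrite big_mkcond (bigD1_seq (e k)) ?undup_uniq//=; last first.
    by rewrite mem_undup; apply/mapP; exists k; rewrite ?mem_enum.
  by rewrite eqxx/= big1 ?addr0// => l /negbTE; rewrite eq_sym => ->.
- move=> l m i j lL mL; under eq_bigr do rewrite !mxE mulr_suml.
  rewrite exchange_big/=.
  have h k : \sum_i0 (U k i)^*%C * U k i0 * (\sum_(k0 | e k0 == m) (U k0 i0)^*%C * U k0 j) =
      if e k == m then (U k i)^*%C * U k j else 0.
    under eq_bigr do rewrite mulr_sumr.
    rewrite exchange_big/=.
    have h2 k0 : \sum_j0 (U k i)^*%C * U k j0 * ((U k0 j0)^*%C * U k0 j) =
        (U k i)^*%C * U k0 j * (k == k0)%:R.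
      by rewrite -U1 mulr_sumr; apply: eq_bigr => j0 _; ring.
    under eq_bigr do rewrite h2.
    rewrite big_mkcond (bigD1 k)//= big1 ?addr0; last first.
      by move=> k0 kk0; rewrite (eq_sym k) (negbTE kk0) mulr0 if_same.
    by rewrite eqxx mulr1.
  under eq_bigr do rewrite h.
  case: eqVneq => [->|lm]; first by rewrite mxE; apply: eq_bigr => k ->.
  by rewrite big1// => k /eqP ->; rewrite (negbTE lm).
- move=> l i j; rewrite !mxE rmorph_sum; apply: eq_bigr => k _.
  by rewrite rmorphM/= conjcK mulrC.
- move=> l i j lL; under eq_bigr do rewrite mxE mulr_sumr.
  rewrite exchange_big/= mxE mulr_sumr; apply: eq_bigr => k /eqP <-.
  rewrite mulrA -HU mulr_suml; apply: eq_bigr => j' _; ring.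
Qed.

End SpectralDecomposition.

Section SpectralFamily.
Variables (R : realType) (n : nat).
Local Notation C := R[i].
Local Notation "x %:C" := (real_complex R x) : ring_scope.
Variables (H : 'M[C]_n) (L : seq R) (Q : R -> 'M[C]_n).
Hypothesis HQ : spectral_family H L Q.

Lemma spectral_family_sum_sqr l x : l \in L ->
  \sum_y cabs (Q l y x) ^+ 2 = complex.Re (Q l x x).
Proof.
have [_ _ Q2 Q3 _] := HQ => lL.
apply: complexI; rewrite RRe_real; last first.
  by rewrite CrealE conjC_conjc -Q3.
have := Q2 l l x x lL lL; rewrite eqxx => <-.
by rewrite rmorph_sum; apply: eq_bigr => y _; rewrite /= cabs_sqrC -Q3 mulrC.
Qed.

Lemma spectral_family_diag_ge0 l x : l \in L -> 0 <= complex.Re (Q l x x).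
Proof.
by move=> /spectral_family_sum_sqr <-; apply: sumr_ge0 => y _; rewrite sqr_ge0.
Qed.

(** Since Q l is a self-adjoint idempotent, its entries are inner products of its own columns. The
    proof expands the squared norm of column y minus t Q(x, y) times column x and takes t = 1 / Q(x,
    x). *)
Lemma spectral_family_CauchySchwarz l x y : l \in L ->
  cabs (Q l y x) ^+ 2 <= complex.Re (Q l y y) * complex.Re (Q l x x).
Proof.
move=> lL; have [_ _ Q2 Q3 _] := HQ.
have real z : Q l z z = (complex.Re (Q l z z))%:C.
  by rewrite RRe_real// CrealE conjC_conjc -Q3.
set a := complex.Re (Q l y y); set b := complex.Re (Q l x x).
have b0 : 0 <= b := spectral_family_diag_ge0 x lL.
set q := cabs (Q l y x).
have key (t : R) : 0 <= a - t * q ^+ 2 *+ 2 + t ^+ 2 * q ^+ 2 * b.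
  pose c : C := t%:C * Q l x y.
  have : \sum_k cabs (Q l k y - c * Q l k x) ^+ 2 =
     a - t * q ^+ 2 *+ 2 + t ^+ 2 * q ^+ 2 * b.
    apply: complexI; rewrite rmorph_sum/=.
    under eq_bigr do rewrite cabs_sqrC rmorphB rmorphM/= -!Q3 mulrBl !mulrBr opprB.
    have e (u v : 'I_n) : \sum_k Q l k v * Q l u k = Q l u v.
      by have := Q2 l l u v lL lL; rewrite eqxx => <-; apply: eq_bigr => k _; rewrite mulrC.
    rewrite big_split/= !sumrB.
    rewrite (_ : \sum_i Q l i y * (c^*%C * Q l x i) = c^*%C * Q l x y); last first.
      by rewrite -e mulr_sumr; apply: eq_bigr => k _; ring.
    rewrite (_ : \sum_i c * Q l i x * (c^*%C * Q l x i) = c * c^*%C * Q l x x); last first.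
      by rewrite -[in RHS]e mulr_sumr; apply: eq_bigr => k _; ring.
    rewrite (_ : \sum_i c * Q l i x * Q l y i = c * Q l y x); last first.
      by rewrite -[in RHS]e mulr_sumr; apply: eq_bigr => k _; ring.
    have cJ : c^*%C = t%:C * Q l y x by rewrite /c rmorphM/= oppr0 -Q3.
    rewrite e (real y) (real x) -/a -/b cJ /c.
    have qE : Q l x y * Q l y x = (q ^+ 2)%:C by rewrite /q cabs_sqrC -Q3 mulrC.
    move: (q ^+ 2) qE => q2 qE.
    rewrite !(rmorphD, rmorphN, rmorphM, rmorphMn, rmorphXn)/= -qE; ring.
  by move=> <-; apply: sumr_ge0 => k _; rewrite sqr_ge0.
have [b_eq0|b_neq0] := eqVneq b 0.
  have := spectral_family_sum_sqr x lL; rewrite -/b b_eq0 mulr0 => <-.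
  by rewrite (bigD1 y)//= lerDl sumr_ge0// => k _; rewrite sqr_ge0.
have := key b^-1; rewrite (_ : _ + _ = a - q ^+ 2 / b); last by field.
by rewrite subr_ge0 ler_pdivrMr// lt_def b_neq0.
Qed.

End SpectralFamily.

Lemma sum_sub_uniq_le (R : realType) (T : eqType) (s r : seq T) (F : T -> R) :
  uniq s -> {subset s <= r} -> (forall x, 0 <= F x) ->
  \sum_(x <- s) F x <= \sum_(x <- r) F x.
Proof.
move=> + + F0; elim: s r => [|a s ih] r /=.
  by move=> _ _; rewrite big_nil sumr_ge0.
move=> /andP[as_ us] sr; have ar : a \in r by rewrite sr ?mem_head.
rewrite (perm_big _ (perm_to_rem ar))/= !big_cons lerD2l ih// => x xs.
have := sr x; rewrite in_cons xs orbT => /(_ isT).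
rewrite (perm_mem (perm_to_rem ar)) in_cons => /predU1P[xa|//].
by rewrite -xa xs in as_.
Qed.

Lemma positive_lower_bound (R : realType) (s : seq R) :
  exists2 g : R, 0 < g & forall x, x \in s -> 0 < x -> g <= x.
Proof.
elim: s => [|a s [g g0 hg]]; first by exists 1.
have [a0|a0] := ltP 0 a.
  exists (Num.min a g); first by rewrite lt_min a0.
  by move=> x; rewrite in_cons ge_min => /predU1P[->|/hg h /h ->]; rewrite ?lexx ?orbT.
exists g => // x; rewrite in_cons => /predU1P[->|/hg//].
by rewrite ltNge a0.
Qed.

(** * Spectral projections from the resolvent near the real axis *)

Section SmallImaginaryPart.
Variables (R : realType) (n : nat) (A : 'M[R]_n) (v : 'I_n -> R).
Hypothesis symA : forall i j, A i j = A j i.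
Hypothesis diagA : forall i, A i i = 0.
Local Notation C := R[i].
Local Notation "x %:C" := (real_complex R x) : ring_scope.
Local Notation H := (hmx A [set: 'I_n] v).
Variables (L : seq R) (Q : R -> 'M[C]_n).
Hypothesis HQ : spectral_family H L Q.

Lemma green_spectral z : 0 < complex.Im z -> forall i j,
  green A [set: 'I_n] v z i j = \sum_(l <- L) (l%:C - z)^-1 * Q l i j.
Proof.
move=> imz i j; have [_ Q1 _ _ Q4] := HQ.
pose M : 'M[C]_n := \matrix_(i, j) \sum_(l <- L) (l%:C - z)^-1 * Q l i j.
have lz l : l%:C - z != 0.
  by rewrite subr_eq0; apply: contraTneq imz => <-; rewrite ltxx.
have HM : (H - z%:M) *m M = 1%:M.
  have ME a b : M a b = \sum_(l <- L) (l%:C - z)^-1 * Q l a b by rewrite mxE.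
  apply/matrixP => k m; rewrite mxE (sum_shift H z (M^~ m)) ME.
  under eq_bigr do rewrite ME mulr_sumr.
  rewrite exchange_big/= mulr_sumr -sumrB mxE -Q1.
  apply: eq_big_seq => l lL.
  rewrite (_ : \sum_i0 _ = (l%:C - z)^-1 * (l%:C * Q l k m)).
    by field; exact: lz.
  by rewrite -Q4// mulr_sumr; apply: eq_bigr => i0 _; ring.
have -> : green A [set: 'I_n] v z = M; last by rewrite mxE.
by rewrite /green -[invmx _]mulmx1 -HM mulKmx// unitmx_shift.
Qed.

(** Evaluate the eigenvalue equation at a site where the column of [Q l] has its largest modulus. *)
Lemma spectral_family_bounded (B D : R) : (forall i, `|v i| <= B) ->
  (forall i, \sum_j `|A i j| <= D) ->
  forall l x y, l \in L -> Q l y x != 0 -> `|l| <= B + D.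
Proof.
move=> hB hD l x y lL Qn0; have [_ _ _ _ Q4] := HQ.
pose f k := cabs (Q l k x).
have [k _ kmax] := @Order.TotalTheory.arg_maxP _ _ _ y xpredT f isT.
have fk0 : 0 < f k by rewrite (lt_le_trans _ (kmax y isT))// cabs_gt0.
rewrite -(ler_pM2r fk0) -cabs_real -cabsM -Q4//.
rewrite (le_trans (cabs_sum _ _ _))//.
have hk j : cabs (H k j * Q l j x) <= (`|A k j| + (if k == j then `|v k| else 0)) * f k.
  rewrite cabsM ler_pM ?cabs_ge0//; last exact: kmax.
  rewrite mxE !inE/= cabs_real (le_trans (ler_normD _ _))// lerD2l.
  by case: eqP => // _; rewrite normr0.
rewrite (le_trans (ler_sum _ (fun j _ => hk j)))// -mulr_suml ler_pM2r//.
rewrite big_split/= addrC lerD// -big_mkcond/= (eq_bigl (pred1 k)) ?big_pred1_eq//.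
Qed.

(** The spacing of the real parts equals the imaginary part, so every energy in the range is within
    one imaginary part of some grid point. The range [-K, K] takes 2 K (j + 1) + 1 points. *)
Definition grid_point (K j m : nat) : C :=
  Complex (m%:R / j.+1%:R - K%:R) (j.+1%:R)^-1.

(* For small h, the grid point E within h of an eigenvalue l already gives
   h^2 |G(x, y; E + i h)|^2 of the order of |Q_l(x, y)|^2. *)
Lemma spectral_family_le_green (K : nat) (W : 'I_n -> 'I_n -> R) :
  (forall x y, 0 <= W x y) ->
  (forall l x y, l \in L -> Q l y x != 0 -> `|l| + 1 <= K%:R) ->
  exists J, forall j, (J <= j)%N ->
    \sum_x \sum_y W x y * \sum_(l <- L) cabs (Q l x y) ^+ 2 <=
    4 * (\sum_x \sum_y W x y * \sum_(m < (2 * K * j.+1).+1)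
      (j.+1%:R)^-2 * cabs (green A [set: 'I_n] v (grid_point K j m) x y) ^+ 2) + 1.
Proof.
move=> W0 hK; have [uL _ _ _ _] := HQ.
have [g g0 hg] := positive_lower_bound [seq `|l - m| | l <- L, m <- L].
pose q := \sum_x \sum_y \sum_(l <- L) cabs (Q l x y).
have q0 : 0 <= q by rewrite !(sumr_ge0, cabs_ge0)// => x _; rewrite !(sumr_ge0)// => y _;
  rewrite sumr_ge0// => l _; rewrite cabs_ge0.
pose w := \sum_x \sum_y W x y.
pose c := 4 * q ^+ 2 * w * (size L)%:R.
have w0 : 0 <= w by rewrite sumr_ge0// => x _; rewrite sumr_ge0.
have c0 : 0 <= c by rewrite !mulr_ge0// sqr_ge0.
(* With h the spacing and g the smallest gap between eigenvalues, this makes T = g / h - 1 at least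
   c + 1. In units of h, T bounds from below the distance from the grid point of one eigenvalue to
   all others; the total error c / T^2 is then at most 1. *)
exists (Num.bound ((c + 2) / g)) => j Jj.
set h := (j.+1%:R : R)^-1.
have h0 : 0 < h by rewrite invr_gt0.
pose T := g / h - 1.
have cT : c + 1 <= T.
  rewrite /T lerBrDr -addrA [1 + 1](_ : _ = 2)// invrK -ler_pdivrMl// mulrC.
  rewrite ltW// (lt_le_trans (archi_boundP _))//; last by rewrite ler_nat leqW.
  by rewrite divr_ge0 ?addr_ge0// ltW.
have T1 : 1 <= T by rewrite (le_trans _ cT)// lerDr.
have T0 : 0 < T by rewrite (lt_le_trans _ T1).
pose zj m := grid_point K j m.
have imz m : 0 < complex.Im (zj m) by [].
(* Index of the last grid point at or below [l]. *)
pose idx l := Num.truncn ((l + K%:R) / h).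
pose good := [seq l <- L | `|l| + 1 <= K%:R].
have idxP l : l \in good -> (idx l)%:R <= (l + K%:R) / h < (idx l).+1%:R.
  rewrite mem_filter => /andP[lK _]; apply: Num.Theory.truncn_itv.
  rewrite divr_ge0 ?(ltW h0)//; move: lK; rewrite -lerBrDr => /ler_normlP[]; lra.
have far l m : l \in good -> m \in L -> m != l ->
    T <= `|(m - complex.Re (zj (idx l))) / h|.
  move=> lg mL ml; have lL : l \in L by move: lg; rewrite mem_filter => /andP[].
  have /hg : `|m - l| \in [seq `|l - m| | l <- L, m <- L] by apply/allpairsP; exists (m, l).
  rewrite normr_gt0 subr_eq0 => /(_ ml) gml.
  have /andP[i1 i2] := idxP _ lg.
  rewrite /zj /grid_point/=.
  set E := (idx l)%:R / _ - _.
  have -> : (m - E) / h = (m - l) / h + ((l + K%:R) / h - (idx l)%:R).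
    by rewrite /E -/h; field; rewrite gt_eqF.
  rewrite -natr1 in i2.
  have s1 : `|(l + K%:R) / h - (idx l)%:R| <= 1 by rewrite ler_norml; lra.
  have s2 : g / h <= `|(m - l) / h|.
    by rewrite normrM [`|h^-1|]gtr0_norm ?invr_gt0// ler_pM2r ?invr_gt0.
  have := ler_normB ((m - l) / h + ((l + K%:R) / h - (idx l)%:R)) ((l + K%:R) / h - (idx l)%:R).
  by rewrite addrK /T; lra.
(* Distinct eigenvalues are more than h apart, hence get distinct grid points; the sum over
   eigenvalues then embeds into the sum over the grid. *)
have idx_inj : {in good &, injective idx}.
  move=> l m lg mg lm; apply/eqP; apply: contraT => ml; have mL : m \in L.
    by move: mg; rewrite mem_filter => /andP[].
  have lL : l \in L by move: lg; rewrite mem_filter => /andP[].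
  have /hg : `|m - l| \in [seq `|l - m| | l <- L, m <- L] by apply/allpairsP; exists (m, l).
  rewrite normr_gt0 subr_eq0 eq_sym => /(_ ml) gml.
  have := idxP _ lg; have := idxP _ mg; rewrite -lm.
  move=> /andP[i1 i2] /andP[i3 i4].
  have : `|(m - l) / h| < 1.
    have -> : (m - l) / h = (m + K%:R) / h - (l + K%:R) / h by field; rewrite gt_eqF.
    by rewrite -natr1 in i2 i4; rewrite ltr_norml; lra.
  rewrite normrM [`|h^-1|]gtr0_norm ?invr_gt0// ltNge => /negP[].
  rewrite (@le_trans _ _ (g / h))// ?ler_pM2r ?invr_gt0//.
  by move: T1; rewrite /T; lra.
have main l x y : l \in good ->
    cabs (Q l x y) ^+ 2 <= 4 * (h ^+ 2 * cabs (green A [set: 'I_n] v (zj (idx l)) x y) ^+ 2)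
      + 4 * (q / T) ^+ 2.
  move=> lg; have lL : l \in L by move: lg; rewrite mem_filter => /andP[].
  set t := h * cabs (green A [set: 'I_n] v (zj (idx l)) x y).
  (* This is (m - z) / h at the grid point z of [l]: its squared modulus is at most 2 for m = l and
     its modulus at least T for every other eigenvalue, so the term of [l] dominates h G. *)
  pose den m : C := Complex ((m - complex.Re (zj (idx l))) / h) (-1).
  have denE m : h%:C * (m%:C - zj (idx l))^-1 = (den m)^-1.
    have -> : m%:C - zj (idx l) = h%:C * den m.
      apply: complex_eq; rewrite ?cReB ?cImB ?cReZ ?cImZ/=.
        by rewrite mulrCA mulfV ?mulr1// gt_eqF.
      by rewrite sub0r mulrN1.
    by rewrite invfM mulrA mulfV ?mul1r// -cabs_gt0 cabs_real gtr0_norm.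
  have tE : t = cabs (\sum_(m <- L) (den m)^-1 * Q m x y).
    rewrite /t green_spectral// -[h]ger0_norm ?(ltW h0)// -cabs_real -cabsM mulr_sumr.
    by congr cabs; apply: eq_bigr => m _; rewrite mulrA denE.
  have rest : cabs (\sum_(m <- L | m != l) (den m)^-1 * Q m x y) <= q / T.
    rewrite (le_trans (cabs_sum _ _ _))//.
    rewrite (@le_trans _ _ (\sum_(m <- L | m != l) cabs (Q m x y) / T))//.
      rewrite big_seq_cond [leRHS]big_seq_cond; apply: ler_sum => m /andP[mL ml].
      rewrite cabsM cabsV mulrC ler_wpM2l ?cabs_ge0// lef_pV2 ?posrE//; last first.
        by rewrite cabs_gt0; apply/eqP => /(congr1 (fun z => complex.Im z))/=; lra.
      exact: le_trans (far _ _ lg mL ml) (Re_le_cabs (den m)).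
    rewrite -mulr_suml ler_pM2r ?invr_gt0//.
    rewrite (@le_trans _ _ (\sum_(m <- L) cabs (Q m x y)))//.
      rewrite [leRHS](bigID (fun m => m != l))/= lerDl sumr_ge0// => m _.
      exact: cabs_ge0.
    rewrite /q (bigD1 x)//= (bigD1 y)//= -addrA lerDl addr_ge0//.
      by apply: sumr_ge0 => k _; apply: sumr_ge0 => m _; exact: cabs_ge0.
    apply: sumr_ge0 => k _; apply: sumr_ge0 => k' _; apply: sumr_ge0 => m _.
    exact: cabs_ge0.
  have den2 : cabs (den l) ^+ 2 <= 2.
    have /andP[i1 i2] := idxP _ lg.
    rewrite cabs_sqr -[complex.Im (den l)]/(-1) sqrrN expr1n.
    have -> : complex.Re (den l) = (l + K%:R) / h - (idx l)%:R.
      by rewrite /den /zj /grid_point/= -/h; field; rewrite gt_eqF.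
    rewrite -natr1 in i2; set r := _ - _.
    have : 0 <= r <= 1 by rewrite /r; lra.
    by move=> /andP[r0 r1]; rewrite (_ : 2 = 1 + 1)// lerD2r exprn_ile1.
  have den0 : den l != 0 by apply/eqP => /(congr1 (fun z => complex.Im z))/=; lra.
  have : cabs ((den l)^-1 * Q l x y) <= t + q / T.
    rewrite tE (bigD1_seq l)//= -lerBlDr.
    rewrite (le_trans _ (cabs_ler_dist _ _))// lerD2l lerN2.
    exact: rest.
  rewrite cabsM cabsV -ler_pdivlMl ?invr_gt0 ?cabs_gt0// invrK => hQ.
  have tq0 : 0 <= t + q / T.
    by rewrite addr_ge0 ?divr_ge0 ?(ltW T0)// /t mulr_ge0 ?cabs_ge0// ltW.
  (* This 2 bounds the squared modulus of [den l]; another 2 from splitting the square gives the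
     constant 4. *)
  have : cabs (Q l x y) ^+ 2 <= 2 * (t + q / T) ^+ 2.
    rewrite (@le_trans _ _ ((cabs (den l) * (t + q / T)) ^+ 2))//.
      by rewrite ler_pXn2r ?nnegrE ?cabs_ge0// mulr_ge0 ?cabs_ge0.
    by rewrite exprMn ler_wpM2r ?sqr_ge0.
  rewrite -exprMn -/t => /le_trans; apply.
  by have := sqr_ge0 (t - q / T); rewrite sqrrB sqrrD; lra.
have termle x y : \sum_(l <- L) cabs (Q l x y) ^+ 2 <=
    4 * (\sum_(m < (2 * K * j.+1).+1) h ^+ 2 *
      cabs (green A [set: 'I_n] v (zj m) x y) ^+ 2) + 4 * (q / T) ^+ 2 * (size L)%:R.
  have -> : \sum_(l <- L) cabs (Q l x y) ^+ 2 = \sum_(l <- good) cabs (Q l x y) ^+ 2.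
    rewrite /good big_filter [RHS]big_mkcond; apply: eq_big_seq => l lL.
    case: ifPn => // lK; apply/eqP; rewrite sqrf_eq0 cabs_eq0.
    by apply: contraNT lK => /hK; apply.
  rewrite (@le_trans _ _ (\sum_(l <- good) (4 * (h ^+ 2 *
      cabs (green A [set: 'I_n] v (zj (idx l)) x y) ^+ 2) + 4 * (q / T) ^+ 2)))//.
    by rewrite big_seq [leRHS]big_seq; apply: ler_sum => l lg; exact: main.
  rewrite big_split/= lerD//; last first.
    rewrite big_const_seq count_predT iter_addr_0 -[leLHS]mulr_natr ler_wpM2l//.
      by rewrite mulr_ge0// sqr_ge0.
    by rewrite ler_nat size_filter count_size.
  rewrite -mulr_sumr ler_pM2l//.
  pose F m := h ^+ 2 * cabs (green A [set: 'I_n] v (zj m) x y) ^+ 2.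
  have F0 m : 0 <= F m by rewrite mulr_ge0// sqr_ge0.
  rewrite -(big_mkord xpredT F) -[leLHS](big_map idx xpredT F).
  have uidx : uniq (map idx good) by rewrite map_inj_in_uniq// filter_uniq.
  apply: sum_sub_uniq_le => // m /mapP[l lg ->]; rewrite mem_index_iota leq0n ltnS /=.
  have /andP[i1 _] := idxP _ lg; rewrite -(ler_nat R) (le_trans i1)//.
  rewrite natrM -[j.+1%:R]invrK -/h ler_pM2r ?invr_gt0// natrM mulr_natl mulr2n.
  rewrite lerD2r; move: lg; rewrite mem_filter => /andP[lK _].
  by rewrite (le_trans (ler_norm _))// (le_trans _ lK)// lerDl.
rewrite (@le_trans _ _ (\sum_x \sum_y W x y * (4 * (\sum_(m < (2 * K * j.+1).+1)
  h ^+ 2 * cabs (green A [set: 'I_n] v (zj m) x y) ^+ 2) + 4 * (q / T) ^+ 2 * (size L)%:R)))//.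
  by apply: ler_sum => x _; apply: ler_sum => y _; rewrite ler_wpM2l.
rewrite (_ : \sum_x \sum_y _ = 4 * (\sum_x \sum_y W x y *
    \sum_(m < (2 * K * j.+1).+1) h ^+ 2 *
      cabs (green A [set: 'I_n] v (zj m) x y) ^+ 2) + c / T ^+ 2); last first.
  have -> : c / T ^+ 2 = 4 * (q / T) ^+ 2 * (size L)%:R * w.
    by rewrite /c; field; rewrite gt_eqF.
  rewrite /w !mulr_sumr -big_split/=; apply: eq_bigr => x _.
  by rewrite !mulr_sumr -big_split/=; apply: eq_bigr => y _; ring.
rewrite lerD//.
  rewrite le_eqVlt; apply/orP; left; apply/eqP; congr (_ * _).
  apply: eq_bigr => x _; apply: eq_bigr => y _; congr (_ * _).
  by apply: eq_bigr => m _; rewrite /h exprVn.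
rewrite ler_pdivrMr ?exprn_gt0// mul1r (@le_trans _ _ T)//.
  by rewrite (le_trans _ cT)// lerDl.
by rewrite expr2 ler_peMl// ltW.
Qed.

End SmallImaginaryPart.

(** * Almost sure bounds *)
Section LiminfIntegral.
Context (dd : measure_display) (T : measurableType dd) (R : realType).
Local Open Scope ereal_scope.

Lemma limn_einfE (u : nat -> \bar R) : limn_einf u = ereal_sup (range (einfs u)).
Proof.
rewrite limn_einf_lim; apply/cvg_lim => //.
by apply: ereal_nondecreasing_cvgn; exact: nondecreasing_einfs.
Qed.

Lemma limn_einf_lt_frequently (u : nat -> \bar R) (c : \bar R) : limn_einf u < c ->
  forall N, exists2 n, (N <= n)%N & u n < c.
Proof.
rewrite limn_einfE => uc N.
have : einfs u N < c by apply: le_lt_trans uc; apply: ereal_sup_ubound; exists N.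
by move=> /ereal_inf_lt[_ [n /= Nn <-] h]; exists n.
Qed.

Lemma limn_einf_le (u : nat -> \bar R) (c : \bar R) : (forall n, u n <= c) ->
  limn_einf u <= c.
Proof.
move=> uc; rewrite limn_einfE; apply: ge_ereal_sup => _ [n _ <-].
by apply: le_trans (uc n); apply: ereal_inf_lbound; exists n => /=.
Qed.

Lemma limn_einf_ge0 (u : nat -> \bar R) : (forall n, 0 <= u n) -> 0 <= limn_einf u.
Proof.
move=> u0; rewrite limn_einfE (@le_trans _ _ (einfs u 0%N))//; last first.
  by apply: ereal_sup_ubound; exists 0%N.
by apply: le_ereal_inf_tmp => _ [n _ <-].
Qed.

Lemma measurable_limn_einf (f : nat -> T -> \bar R) :
  (forall n, measurable_fun setT (f n)) ->
  measurable_fun setT (fun t => limn_einf (f^~ t)).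
Proof.
move=> mf; apply: measurableT_comp; first exact: oppe_measurable.
apply: measurable_fun_limn_esup => n.
by apply: measurableT_comp; [exact: oppe_measurable|exact: mf].
Qed.

Lemma integral_limn_einf_le (m : {measure set T -> \bar R}) (f : nat -> T -> \bar R)
    (c : \bar R) :
  (forall n, measurable_fun setT (f n)) -> (forall n t, 0 <= f n t) ->
  (forall n, \int[m]_t f n t <= c) -> \int[m]_t limn_einf (f^~ t) <= c.
Proof.
move=> mf f0 fc; apply: (le_trans (fatou m measurableT mf (fun n t _ => f0 n t))).
exact: limn_einf_le.
Qed.

Lemma integral_sum_le (m : {measure set T -> \bar R}) (I : finType)
    (c b : I -> R) (f : I -> T -> R) :
  (forall i, 0 <= c i)%R -> (forall i t, 0 <= f i t)%R ->
  (forall i, measurable_fun setT (f i)) ->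
  (forall i, \int[m]_t (f i t)%:E <= (b i)%:E) ->
  \int[m]_t (\sum_i c i * f i t)%R%:E <= (\sum_i c i * b i)%R%:E.
Proof.
move=> c0 f0 mf fb; rewrite integral_sum_scale// -sumEFin.
by apply: lee_sum => i _; rewrite EFinM; apply: lee_wpmul2l; rewrite ?lee_fin.
Qed.

End LiminfIntegral.

(** * Exhausting boxes and summable weights *)

Section Exhaustion.
Variables (R : realType) (d : nat).

(** The boxes are initial segments of an enumeration of Z^d: each site lies in all of them from some
    index on, which is what the limit over boxes asks. *)
Definition sites (L : nat) : seq (site d) := pmap pickle_inv (iota 0 L).

Lemma sites_uniq L : uniq (sites L).
Proof. by apply: (pmap_uniq pickle_invK); exact: iota_uniq. Qed.

Lemma mem_sites L (x : site d) : (pickle x < L)%N -> x \in sites L.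
Proof.
move=> xL; rewrite mem_pmap; apply/mapP; exists (pickle x).
  by rewrite mem_iota.
by rewrite pickleK_inv.
Qed.

Definition site_of (s : seq (site d)) (i : 'I_(size s)) : site d := nth 0 s i.

Lemma site_of_inj (s : seq (site d)) : uniq s -> injective (@site_of s).
Proof.
by move=> us i j /eqP; rewrite /site_of nth_uniq// => /eqP /val_inj.
Qed.

(* 3/2 < 2, so that the weights are summable against the decay 2^-|x - y|. *)
Definition weight (x y : site d) : R := 2^-1 ^+ l1norm x * (3 / 2) ^+ l1norm (x - y).

Lemma weight_ge0 x y : 0 <= weight x y.
Proof. by rewrite mulr_ge0// exprn_ge0// ?invr_ge0// divr_ge0. Qed.

(** The product of weight and decay is 2^-|x| (3/4)^|x - y|: the second factor is summed over y
    first, and the first one makes the sum over x converge. *)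
Lemma weighted_sum_bounded : exists2 B : R, 0 < B &
  forall s : seq (site d), uniq s ->
  \sum_(x < size s) \sum_(y < size s) weight (site_of x) (site_of y) *
    2^-1 ^+ l1norm (site_of x - site_of y) <= B.
Proof.
have [K1 K10 h1] := @lattice_sum_bounded d R 2^-1 ltac:(lra).
have [K2 K20 h2] := @lattice_sum_bounded d R (3 / 4) ltac:(lra).
exists (K1 * K2); first by rewrite mulr_gt0.
move=> s us; have ist := site_of_inj us.
rewrite (@le_trans _ _ (\sum_(x < size s) 2^-1 ^+ l1norm (site_of x) * K2))//.
  apply: ler_sum => x _.
  have -> : \sum_(y < size s) weight (site_of x) (site_of y) *
      2^-1 ^+ l1norm (site_of x - site_of y) =
      2^-1 ^+ l1norm (site_of x) * \sum_(y < size s) (3 / 4) ^+ l1norm (site_of x - site_of y).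
    rewrite mulr_sumr; apply: eq_bigr => y _.
    by rewrite /weight -mulrA -exprMn; congr (_ * _ ^+ _); lra.
  rewrite ler_wpM2l ?exprn_ge0 ?invr_ge0//.
  rewrite -(big_map (fun y : 'I_(size s) => site_of x - site_of y) xpredT
    (fun u => (3 / 4) ^+ l1norm u)) h2// map_inj_uniq.
    by rewrite /index_enum -enumT enum_uniq.
  by move=> y y' /addrI /oppr_inj /ist.
rewrite -mulr_suml ler_wpM2r ?(ltW K20)//.
rewrite -(big_map (@site_of s) xpredT (fun u => 2^-1 ^+ l1norm u)) h1// map_inj_uniq//.
by rewrite /index_enum -enumT enum_uniq.
Qed.

(* A discretization, on the energy grid of spacing h = 1/(j+1) in [-K, K], of
   the integral over E of h |G(x, y; E + i h)|^2, summed with weights. *)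
Definition resolvent_sum (eps : R) (K j : nat) (s : seq (site d)) (v : site d -> R) : R :=
  \sum_(x < size s) \sum_(y < size s) weight (site_of x) (site_of y) *
    \sum_(m < (2 * K * j.+1).+1) (j.+1%:R ^- 2 *
      cabs (green (hop eps (@site_of s)) [set: 'I_(size s)] (fun i => v (site_of i))
        (grid_point R K j m) x y) ^+ 2).

End Exhaustion.

Section AlmostSureBound.
Variables (R : realType) (d : nat).
Variables (dO : measure_display) (Omega : measurableType dO).
Variables (P : probability Omega R).
Variables (V : site d -> {RV P >-> measurableTypeR R}).
Variable (mu : probability (measurableTypeR R) R).
Hypothesis iidV : iid V mu.
Hypothesis hmu : concentration_bound mu.
Variable eps : R.
Hypothesis eps0 : 0 <= eps.
Hypothesis eps_small : 36 * d%:R * eps <= 1.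
Variable K : nat.

Let X j s w := resolvent_sum eps K j s (fun n => V n w).

Let mG (s : seq (site d)) j m x y : measurable_fun setT (fun w =>
  cabs (green (hop eps (@site_of d s)) [set: 'I_(size s)] (fun i => V (site_of i) w)
    (grid_point R K j m) x y) ^+ 2).
Proof.
apply: measurable_funX; apply: measurable_cabs.
by apply: cmeasurable_G; rewrite /= invr_gt0.
Qed.

Let X_ge0 j s w : 0 <= X j s w.
Proof.
apply: sumr_ge0 => x _; apply: sumr_ge0 => y _; rewrite mulr_ge0 ?weight_ge0//.
by apply: sumr_ge0 => m _; rewrite mulr_ge0 ?sqr_ge0// invr_ge0 exprn_ge0.
Qed.

Let mX j s : measurable_fun setT (fun w => (X j s w)%:E).
Proof.
apply/measurable_EFinP; apply: measurable_sum_cond => x _.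
apply: measurable_sum_cond => y _; apply: measurable_funM; first exact: measurable_cst.
apply: measurable_sum_cond => m _; apply: measurable_funM; first exact: measurable_cst.
exact: mG.
Qed.

(** With h = 1 / (j + 1), about 2 K / h grid points carry h^2 each, and Graf's bound costs 1 / h.
    The powers of h cancel up to 2 K + h <= 2 K + 1, so the constant depends neither on the box nor
    on the distance to the real axis. *)
Lemma integral_resolvent_sum : exists C : R, forall s j, uniq s ->
  (\int[P]_w (X j s w)%:E <= C%:E)%E.
Proof.
have [B B0 hB] := weighted_sum_bounded R d.
exists (16 * (2 * K + 1)%:R * B) => s j us.
have ist := site_of_inj us.
set h := (j.+1%:R : R)^-1; have h0 : 0 < h by rewrite invr_gt0.
pose dst (x y : 'I_(size s)) := l1norm (site_of x - site_of y).
have G2 m x y : (\int[P]_w (cabs (green (hop eps (@site_of d s)) [set: 'I_(size s)]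
    (fun i => V (site_of i) w) (grid_point R K j m) x y) ^+ 2)%:E <=
    (j.+1%:R * (16 * 2^-1 ^+ dst x y))%:E)%E.
  have imz : 0 < complex.Im (grid_point R K j m) by rewrite /= invr_gt0.
  have := second_moment iidV hmu eps0 eps_small ist imz (finset.in_setT x) (finset.in_setT y).
  rewrite (integral_scale P (ltW imz) _ (mG j m x y)); last by move=> w; rewrite sqr_ge0.
  by rewrite -lee_pdivlMl// /= invrK EFinM.
apply: (@le_trans _ _ (\sum_x 1 * \sum_y weight R (site_of x) (site_of y) *
    \sum_(m < (2 * K * j.+1).+1) j.+1%:R ^- 2 * (j.+1%:R * (16 * 2^-1 ^+ dst x y)))%:E).
  rewrite /X /resolvent_sum; under eq_integral => w _ do
    under eq_bigr do rewrite -[\sum_(y < _) _]mul1r.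
  apply: integral_sum_le => //.
  - move=> x w; apply: sumr_ge0 => y _; rewrite mulr_ge0 ?weight_ge0//.
    by apply: sumr_ge0 => m _; rewrite mulr_ge0 ?sqr_ge0// invr_ge0 exprn_ge0.
  - move=> x; apply: measurable_sum_cond => y _; apply: measurable_funM; first exact: measurable_cst.
    apply: measurable_sum_cond => m _; apply: measurable_funM; first exact: measurable_cst.
    exact: mG.
  move=> x; apply: integral_sum_le => //.
  - by move=> y; exact: weight_ge0.
  - move=> y w; apply: sumr_ge0 => m _.
    by rewrite mulr_ge0 ?sqr_ge0// invr_ge0 exprn_ge0.
  - move=> y.
    apply: measurable_sum_cond => m _; apply: measurable_funM; first exact: measurable_cst.
    exact: mG.
  move=> y; apply: integral_sum_le.
  - by move=> m; rewrite invr_ge0 exprn_ge0.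
  - by move=> m w; rewrite sqr_ge0.
  - by move=> m; exact: mG.
  - by move=> m; exact: G2.
rewrite lee_fin (@le_trans _ _ (\sum_x \sum_y 16 * (2 * K + 1)%:R *
    (weight R (site_of x) (site_of y) * 2^-1 ^+ dst x y)))//; last first.
  under eq_bigr do rewrite -mulr_sumr.
  by rewrite -mulr_sumr ler_wpM2l ?hB// mulr_ge0.
apply: ler_sum => x _; rewrite mul1r; apply: ler_sum => y _.
rewrite sumr_const card_ord -[X in _ * X]mulr_natl [leRHS]mulrCA ler_wpM2l ?weight_ge0//.
rewrite -[j.+1%:R]invrK -/h.
have -> : (2 * K * j.+1).+1%:R * (h^-1 ^- 2 * (h^-1 * (16 * 2^-1 ^+ dst x y))) =
    16 * ((2 * K)%:R + h) * 2^-1 ^+ dst x y.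
  rewrite -natr1 natrM -[j.+1%:R]invrK -/h; field; rewrite gt_eqF//.
rewrite ler_wpM2r ?exprn_ge0 ?invr_ge0// ler_pM2l// natrD lerD2l.
by rewrite /h invf_le1// ler1n.
Qed.

(** Two nested lower limits, Fatou being applied to each. The inner one, over the imaginary part, is
    taken in a fixed box, because the threshold beyond which the resolvent controls the projections
    depends on the box and on the potential. *)
Lemma resolvent_sum_bounded_ae : {ae P, forall w, exists C : R, forall N,
  exists2 L, (N <= L)%N & forall J, exists2 j, (J <= j)%N &
    resolvent_sum eps K j (sites d L) (fun n => V n w) <= C}.
Proof.
have [C hC] := integral_resolvent_sum.
pose Y L w := limn_einf (fun j => (X j (sites d L) w)%:E).
pose Z w := limn_einf (fun L => Y L w).
have mY L : measurable_fun setT (Y L).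
  by apply: (measurable_limn_einf (f := fun j w => (X j (sites d L) w)%:E)) => j.
have Y0 L w : (0 <= Y L w)%E.
  by apply: limn_einf_ge0 => j; rewrite lee_fin.
have mZ : measurable_fun setT Z by exact: measurable_limn_einf.
have Z0 w : (0 <= Z w)%E by exact: limn_einf_ge0.
have intY L : (\int[P]_w Y L w <= C%:E)%E.
  apply: (integral_limn_einf_le (f := fun j w => (X j (sites d L) w)%:E)) => //.
    by move=> j w; rewrite lee_fin.
  by move=> j; apply: hC; exact: sites_uniq.
have intZ : (\int[P]_w Z w <= C%:E)%E by exact: integral_limn_einf_le.
have Zint : P.-integrable setT Z.
  apply/integrableP; split => //.
  under eq_integral => w _ do rewrite gee0_abs//.
  by rewrite (le_lt_trans intZ)// ltry.
have := integrable_ae measurableT Zint; apply: filterS => w /(_ I) Zw.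
have Zlt : (Z w < (fine (Z w) + 1)%:E)%E by rewrite EFinD fineK// lteDl// lte01.
exists (fine (Z w) + 1) => N.
have [L NL YL] := limn_einf_lt_frequently Zlt N.
exists L => // J; have [j Jj Xj] := limn_einf_lt_frequently YL J.
by exists j => //; rewrite -lee_fin ltW.
Qed.

End AlmostSureBound.

(** * Localized eigenvectors of a box *)
Section FiniteVolumeLocalization.
Variables (R : realType) (d : nat) (eps : R) (v : site d -> R) (K : nat).
Local Notation C := R[i].
Local Notation "x %:C" := (real_complex R x) : ring_scope.
Hypothesis eps0 : 0 <= eps.

Definition box_matrix (s : seq (site d)) : 'M[C]_(size s) :=
  hmx (hop eps (@site_of d s)) [set: 'I_(size s)] (fun i => v (site_of i)).

Definition correlation_bounded (B : R) (s : seq (site d)) :=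
  exists L Q, [/\ spectral_family (box_matrix s) L Q,
    forall l x y, l \in L -> Q l y x != 0 -> `|l| + 1 <= K%:R &
    \sum_x \sum_y weight R (site_of x) (site_of y) *
      \sum_(l <- L) cabs (Q l x y) ^+ 2 <= B].

Lemma sum_site_of (s : seq (site d)) (F : site d -> C) :
  \sum_(y <- s) F y = \sum_(k < size s) F (site_of k).
Proof. by rewrite (big_nth 0) big_mkord. Qed.

Lemma sum_site_ofR (s : seq (site d)) (F : site d -> R) :
  \sum_(y <- s) F y = \sum_(k < size s) F (site_of k).
Proof. by rewrite (big_nth 0) big_mkord. Qed.

Lemma correlation_bounded_of_resolvent_sum (M B : R) (s : seq (site d)) : uniq s ->
  (forall n, `|v n| <= M) -> M + eps ^+ 2 * (2 * d)%:R + 1 <= K%:R ->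
  (forall J, exists2 j, (J <= j)%N & resolvent_sum eps K j s v <= B) ->
  correlation_bounded (4 * B + 1) s.
Proof.
move=> us vM hK hB.
have symA := hop_sym eps (@site_of d s).
have herm i j : box_matrix s j i = (box_matrix s i j)^*%C.
  have [h hE hs] := hmx_real symA [set: 'I_(size s)] (fun i => v (site_of i)).
  by rewrite /box_matrix !hE hs conjc_real.
have [L [Q HQ]] := spectral_family_exists herm.
have bnd l x y : l \in L -> Q l y x != 0 -> `|l| + 1 <= K%:R.
  move=> lL Qn0; rewrite (le_trans _ hK)// lerD2r.
  apply: (spectral_family_bounded HQ _ _ lL Qn0) => [i|i]; first exact: vM.
  under eq_bigr do rewrite mxE ger0_norm ?mulr_ge0 ?sqr_ge0//.
  rewrite -mulr_sumr ler_wpM2l ?sqr_ge0// -natr_sum ler_nat mul2n.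
  by apply: sum_adj_inj; exact: site_of_inj.
exists L, Q; split => //.
have [J hJ] := spectral_family_le_green symA HQ
  (fun x y => weight_ge0 R (site_of x) (site_of y)) bnd.
have [j Jj jB] := hB J.
by rewrite (le_trans (hJ j Jj))// lerD2r ler_pM2l.
Qed.

Definition indicator (x y : site d) : C := (y == x)%:R.

(** The data that survive a limit over [s]: [N], [B], [tau] and [K] are to be the same for all
    boxes. *)
Definition localized_family (x : site d) (B tau : R) (s : seq (site d)) (N : nat)
    (f : 'I_N -> wave R d) (E : 'I_N -> R) :=
  [/\ forall i, `|E i| <= K%:R,
      forall i y, y \in s -> hamiltonian eps v (f i) y = (E i)%:C * f i y,
      forall i y, cabs (f i y) ^+ 2 <= B * (2 / 3) ^+ l1norm (x - y) &
      \sum_(y <- s) cabs (indicator x y - \sum_i f i y) ^+ 2 <= tau].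

Section OneBox.
Variables (B : R) (x : site d) (s : seq (site d)).
Hypothesis us : uniq s.
Hypothesis xs : x \in s.
Variables (L : seq R) (Q : R -> 'M[C]_(size s)).
Hypothesis HQ : spectral_family (box_matrix s) L Q.
Hypothesis QK : forall l x y, l \in L -> Q l y x != 0 -> `|l| + 1 <= K%:R.
Hypothesis QB : \sum_x \sum_y weight R (site_of x) (site_of y) *
  \sum_(l <- L) cabs (Q l x y) ^+ 2 <= B.

Let a : 'I_(size s) := Ordinal (n := size s) (m := index x s)
  (eq_ind_r is_true xs (index_mem x s)).

Let site_a : site_of a = x.
Proof. by rewrite /site_of /= nth_index. Qed.

Let Cx : R := B * 2 ^+ l1norm x.

(** Extension by zero off [s]; the sum has at most one term, since [s] has no repetition. *)
Definition column (l : R) : wave R d := fun y =>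
  \sum_(k < size s | site_of k == y) Q l k a.

Lemma column_site_of l k : column l (site_of k) = Q l k a.
Proof.
rewrite /column (big_pred1 k)// => k'.
by rewrite /= (inj_eq (site_of_inj us)).
Qed.

Lemma column_notin l y : y \notin s -> column l y = 0.
Proof.
move=> ys; rewrite /column big_pred0// => k; apply: contraNF ys => /eqP <-.
by rewrite mem_nth.
Qed.

Let Qsym l i j : cabs (Q l i j) = cabs (Q l j i).
Proof. by have [_ _ _ Q3 _] := HQ; rewrite Q3 cabs_conj. Qed.

(** Only the terms of [x] are kept from the correlation bound; 2^|x| in [Cx] undoes the weight
    2^-|x|. *)
Let row_bound : \sum_y (3 / 2) ^+ l1norm (x - site_of y) *
  \sum_(l <- L) cabs (Q l y a) ^+ 2 <= Cx.
Proof.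
have := QB; rewrite (bigD1 a)//= => h.
have {}h : \sum_y weight R (site_of a) (site_of y) * \sum_(l <- L) cabs (Q l a y) ^+ 2 <= B.
  apply: le_trans h; rewrite lerDl; apply: sumr_ge0 => i _; apply: sumr_ge0 => j _.
  by rewrite mulr_ge0 ?weight_ge0// sumr_ge0// => l _; rewrite sqr_ge0.
rewrite /Cx -ler_pdivrMr ?exprn_gt0// (le_trans _ h)//.
rewrite le_eqVlt; apply/orP; left; apply/eqP.
rewrite mulr_suml; apply: eq_bigr => y _; rewrite site_a /weight exprVn mulrC mulrA.
by congr (_ * _); apply: eq_bigr => l _; rewrite Qsym.
Qed.

Lemma column_decay l y : l \in L -> cabs (column l y) ^+ 2 <= Cx * (2 / 3) ^+ l1norm (x - y).
Proof.
move=> lL.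
have F0 k : 0 <= (3 / 2) ^+ l1norm (x - site_of k) * \sum_(l <- L) cabs (Q l k a) ^+ 2.
  by rewrite mulr_ge0 ?exprn_ge0 ?divr_ge0// sumr_ge0// => m _; rewrite sqr_ge0.
have Cx0 : 0 <= Cx by apply: le_trans row_bound; apply: sumr_ge0.
have [ys|ys] := boolP (y \in s); last first.
  by rewrite column_notin// cabs0 expr0n/= mulr_ge0// exprn_ge0// divr_ge0.
have kP : (index y s < size s)%N by rewrite index_mem.
pose k := Ordinal kP.
have yk : y = site_of k by rewrite /site_of /= nth_index.
rewrite yk column_site_of -ler_pdivrMr ?exprn_gt0 ?divr_gt0// -exprVn invf_div.
apply: le_trans row_bound; rewrite (bigD1 k)//= -[leLHS]addr0 lerD ?sumr_ge0//.
rewrite mulrC ler_wpM2l ?exprn_ge0 ?divr_ge0//.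
rewrite (big_rem l)//= lerDl sumr_ge0// => m _.
by rewrite sqr_ge0.
Qed.

Lemma column_eigen l y : l \in L -> y \in s ->
  hamiltonian eps v (column l) y = l%:C * column l y.
Proof.
move=> lL ys; have [_ _ _ _ Q4] := HQ.
have kP : (index y s < size s)%N by rewrite index_mem.
pose k := Ordinal kP.
have yk : y = site_of k by rewrite /site_of /= nth_index.
rewrite /hamiltonian (laplacianE _ us (@column_notin l)) sum_site_of.
rewrite yk column_site_of -Q4//.
under eq_bigr do rewrite column_site_of.
rewrite mulr_sumr [X in _ + X](_ : _ =
    \sum_j (if k == j then (v (site_of k))%:C * Q l j a else 0)); last first.
  by rewrite -big_mkcond (big_pred1 k)// => j; rewrite eq_sym.
rewrite -big_split/=; apply: eq_bigr => j _.
rewrite /box_matrix mxE !finset.inE/= mxE rmorphD rmorphM/= mulrDl; congr (_ + _).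
  by rewrite -(rmorph_nat (real_complex R)) mulrA !rmorphM.
by case: (k == j); rewrite ?mul0r.
Qed.

Variable rad : nat.
Let close (y : site d) := (l1norm (x - y)%R <= rad)%N.
Let b l := complex.Re (Q l a a).
Let nmass l := \sum_(y | close (site_of y)) cabs (Q l y a) ^+ 2.
Let fmass l := \sum_(y | ~~ close (site_of y)) cabs (Q l y a) ^+ 2.

Let bE l : l \in L -> b l = nmass l + fmass l.
Proof.
move=> lL; rewrite /b -(spectral_family_sum_sqr HQ)//.
by rewrite (bigID (fun y => close (site_of y))).
Qed.

(* Eigenvalues whose column at [x] has at least half of its mass within distance
   [rad] of [x]: their number is bounded in terms of [rad] only, and the others
   contribute little to the indicator of [x] by the correlation bound. *)
Definition concentrated := [seq l <- L | (0 < b l) && (b l <= 2 * nmass l)].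

Let nmass_le l : l \in L -> nmass l <= (\sum_(y | close (site_of y)) complex.Re (Q l y y)) * b l.
Proof.
move=> lL; rewrite mulr_suml; apply: ler_sum => y _.
exact: (spectral_family_CauchySchwarz HQ).
Qed.

(** By Cauchy-Schwarz, having half of the mass near x forces the diagonal entries Q_l(y, y) over
    near y to add up to at least 1/2. Summed over all l each diagonal entry contributes 1, so there
    are at most twice as many such l as near sites. *)
Lemma size_concentrated (K1 : R) :
  (forall t : seq (site d), uniq t -> \sum_(u <- t) 2^-1 ^+ l1norm u <= K1) ->
  (size concentrated)%:R <= 2 * (K1 * 2 ^+ rad) :> R.
Proof.
move=> hK1; have [_ Q1 _ _ _] := HQ.
have one l : l \in concentrated -> 1 <= 2 * \sum_(y | close (site_of y)) complex.Re (Q l y y).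
  rewrite mem_filter => /andP[/andP[b0 bn] lL].
  rewrite -(ler_pM2r b0) mul1r -mulrA (le_trans bn)// ler_pM2l//.
  exact: nmass_le.
have -> : (size concentrated)%:R = \sum_(l <- concentrated) 1 :> R.
  by rewrite big_const_seq count_predT iter_addr_0.
rewrite (@le_trans _ _ (\sum_(l <- L) 2 * \sum_(y | close (site_of y)) complex.Re (Q l y y)))//.
  rewrite big_filter big_mkcond/= big_seq [leRHS]big_seq.
  apply: ler_sum => l lL; case: ifP => [h|_]; first by apply: one; rewrite mem_filter h.
  rewrite mulr_ge0// sumr_ge0// => y _.
  exact: (spectral_family_diag_ge0 HQ).
rewrite -mulr_sumr ler_pM2l// exchange_big/=.
(* Bounds the number of sites within distance [rad]: each of them has 2^-|x - y| 2^rad >= 1. *)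
rewrite (@le_trans _ _ (\sum_(y < size s) 2^-1 ^+ l1norm (x - site_of y) * 2 ^+ rad))//.
  rewrite [leLHS]big_mkcond; apply: ler_sum => y _; case: ifPn => [yn|_]; last first.
    by rewrite mulr_ge0 ?exprn_ge0 ?invr_ge0.
  have -> : \sum_(l <- L) complex.Re (Q l y y) = 1.
    by rewrite -cRe_sum Q1 eqxx.
  rewrite exprVn mulrC ler_pdivlMr ?exprn_gt0// mul1r ler_weXn2l//; lra.
rewrite -mulr_suml ler_wpM2r ?exprn_ge0//.
rewrite -(big_map (fun y : 'I_(size s) => x - site_of y) xpredT
    (fun u => 2^-1 ^+ l1norm u)) hK1// map_inj_uniq.
  by rewrite /index_enum -enumT enum_uniq.
by move=> y y' /addrI /oppr_inj /(site_of_inj us).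
Qed.

(** All columns at x add up to its indicator, so the residual is the sum of the discarded ones.
    These are orthogonal, with squared norms [b l], each at most twice the mass beyond distance
    [rad], where the weight (3/2)^|x - y| gains (2/3)^rad. *)
Lemma column_residual :
  \sum_(y <- s) cabs (indicator x y - \sum_(l <- concentrated) column l y) ^+ 2 <=
  2 * (2 / 3) ^+ rad * Cx.
Proof.
have [uL Q1 Q2 Q3 _] := HQ.
pose rest := [seq l <- L | ~~ ((0 < b l) && (b l <= 2 * nmass l))].
have restL l : l \in rest -> l \in L by rewrite mem_filter => /andP[].
rewrite sum_site_ofR.
have resE k : indicator x (site_of k) - \sum_(l <- concentrated) column l (site_of k) =
    \sum_(l <- rest) Q l k a.
  under eq_bigr do rewrite column_site_of.
  rewrite /indicator -site_a (inj_eq (site_of_inj us)) -Q1 /concentrated /rest !big_filter.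
  by rewrite (bigID (fun l => (0 < b l) && (b l <= 2 * nmass l)))/= addrAC subrr add0r.
under eq_bigr do rewrite resE.
have -> : \sum_k cabs (\sum_(l <- rest) Q l k a) ^+ 2 = \sum_(l <- rest) b l.
  apply: complexI; rewrite !rmorph_sum/=.
  under eq_bigr do rewrite cabs_sqrC rmorph_sum/= big_distrl/=.
  rewrite exchange_big/=; apply: eq_big_seq => l lr.
  under eq_bigr do rewrite big_distrr/=.
  rewrite exchange_big/= (bigD1_seq l) ?filter_uniq//=.
  rewrite [X in _ + X]big_seq_cond [X in _ + X]big1 ?addr0.
    have -> : (b l)%:C = Q l a a.
      by rewrite RRe_real// CrealE conjC_conjc -Q3.
    have := Q2 l l a a (restL _ lr) (restL _ lr); rewrite eqxx => <-.
    by apply: eq_bigr => k _; rewrite -Q3 mulrC.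
  move=> m /andP[mr ml]; have := Q2 m l a a (restL _ mr) (restL _ lr).
  rewrite (negbTE ml) => h; rewrite -[RHS]h. apply: eq_bigr => k _.
  by rewrite -Q3 mulrC.
have le_f l : l \in rest -> b l <= 2 * fmass l.
  move=> lr; have lL := restL _ lr; have := bE lL.
  have f0 : 0 <= fmass l by apply: sumr_ge0 => y _; rewrite sqr_ge0.
  move: lr; rewrite mem_filter negb_and -leNgt -ltNge => /andP[/orP[h _|h _]]; lra.
rewrite (@le_trans _ _ (\sum_(l <- L) 2 * fmass l))//.
  rewrite big_seq (@le_trans _ _ (\sum_(l <- rest | l \in rest) 2 * fmass l))//.
    by apply: ler_sum.
  rewrite -big_seq big_filter [leRHS](bigID (fun l => ~~ ((0 < b l) && (b l <= 2 * nmass l))))/=.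
  rewrite lerDl sumr_ge0// => l _; rewrite mulr_ge0// sumr_ge0// => y _.
  by rewrite sqr_ge0.
have t0 : 0 <= (2 / 3 : R) ^+ rad by rewrite exprn_ge0// divr_ge0.
rewrite -mulr_sumr -mulrA ler_pM2l// (le_trans _ (ler_wpM2l t0 row_bound))//.
rewrite exchange_big/= mulr_sumr [leLHS]big_mkcond; apply: ler_sum => y _.
have S0 : 0 <= \sum_(l <- L) cabs (Q l y a) ^+ 2.
  by rewrite sumr_ge0// => l _; rewrite sqr_ge0.
case: ifPn => [|_]; last first.
  by rewrite !mulr_ge0 ?exprn_ge0 ?divr_ge0.
rewrite /close -ltnNge => far; rewrite mulrA ler_peMl//.
rewrite (_ : 2 / 3 = (3 / 2)^-1); last by rewrite invf_div.
rewrite exprVn mulrC ler_pdivlMr ?exprn_gt0 ?divr_gt0// mul1r.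
by rewrite ler_weXn2l ?(ltnW far)//; lra.
Qed.

End OneBox.

Lemma localized_family_exists (B : R) (x : site d) (tau : R) : 0 < tau ->
  exists N Bx, forall s, uniq s -> x \in s -> correlation_bounded B s ->
  exists f E, @localized_family x Bx tau s N f E.
Proof.
move=> tau0.
have [K1 K10 hK1] := @lattice_sum_bounded d R 2^-1 ltac:(lra).
pose Cx := B * 2 ^+ l1norm x.
have [rad hrad] : exists rad, 2 * (2 / 3) ^+ rad * Cx <= tau.
  have [Cx0|Cx0] := leP Cx 0.
    by exists 0%N; rewrite expr0 mulr1; lra.
  have c0 : 0 < 2 * Cx by apply: mulr_gt0.
  have t0 : 0 < tau / (2 * Cx) by rewrite divr_gt0.
  have /cvgrPdist_lt/(_ _ t0)[r _ /(_ r (leqnn r))] : (2 / 3 : R) ^+ n @[n --> \oo] --> (0 : R).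
    by apply: cvg_expr; rewrite ger0_norm; lra.
  rewrite /= sub0r normrN ger0_norm ?exprn_ge0 ?divr_ge0// => h.
  by exists r; move: h; rewrite ltr_pdivlMr// => h; lra.
(* A common number of functions for all boxes: the concentrated columns are padded with zero
   functions, as eigenvectors for the default value 0. The maximum with 0 lets these satisfy the
   decay bound too. *)
exists (Num.bound (2 * (K1 * 2 ^+ rad))), (Num.max Cx 0) => s us xs [L [Q [HQ QK QB]]].
set N := Num.bound _.
pose kl := concentrated xs L Q rad.
have klL l : l \in kl -> l \in L by rewrite mem_filter => /andP[].
have sz : (size kl <= N)%N.
  rewrite -(ler_nat R) (le_trans (size_concentrated us xs HQ rad hK1))//.
  rewrite (le_trans (ler_norm _))// ltW// (le_lt_trans _ (archi_boundP _))//.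
    by rewrite ger0_norm// !mulr_ge0// ?ltW// exprn_gt0.
  by rewrite !mulr_ge0// ?ltW// exprn_gt0.
pose z : wave R d := fun=> 0.
pose f (i : 'I_N) : wave R d := nth z [seq column xs Q l | l <- kl] i.
pose E (i : 'I_N) : R := nth 0 kl i.
exists f, E; split.
- move=> i; rewrite /E; have [il|il] := ltnP i (size kl); last first.
    by rewrite nth_default// normr0.
  have := mem_nth 0 il; rewrite mem_filter => /andP[/andP[b0 _] lL].
  have /(QK _ _ _ lL) : Q kl`_i (Ordinal (eq_ind_r is_true xs (index_mem x s)))
      (Ordinal (eq_ind_r is_true xs (index_mem x s))) != 0.
    by apply: contraTneq b0 => ->; rewrite ltxx.
  lra.
- move=> i y ys; rewrite /f /E; have [il|il] := ltnP i (size kl); last first.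
    rewrite (@nth_default _ z) ?size_map// /hamiltonian /laplacian.
    rewrite big1 => [|j _]; first by rewrite mulr0 add0r /z !mulr0.
    exact: addr0.
  rewrite (nth_map 0)//; apply: (column_eigen us xs HQ) => //.
  by apply: klL; rewrite mem_nth.
- move=> i y; rewrite /f; have [il|il] := ltnP i (size kl); last first.
    rewrite nth_default ?size_map// /z cabs0 expr0n/=.
    by rewrite mulr_ge0 ?exprn_ge0 ?divr_ge0// le_max lexx orbT.
  rewrite (nth_map 0)// (le_trans (column_decay us xs HQ QB y (klL _ (mem_nth 0 il))))//.
  by rewrite ler_wpM2r ?exprn_ge0 ?divr_ge0// le_max lexx.
- apply: le_trans hrad; apply: le_trans (column_residual us xs HQ QB rad).
  apply: ler_sum => y _.
  suff -> : \sum_i f i y = \sum_(l <- kl) column xs Q l y by [].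
  rewrite -(big_mkord xpredT (fun i => nth z [seq column xs Q l | l <- kl] i y)).
  rewrite (big_cat_nat (leq0n _) sz)/= [X in _ + X]big_nat [X in _ + X]big1 ?addr0.
    by rewrite [RHS](big_nth 0) !big_nat; apply: eq_bigr => i /andP[_ il]; rewrite (nth_map 0).
  by move=> i /andP[il _]; rewrite nth_default ?size_map.
Qed.

End FiniteVolumeLocalization.

(** * Infinite volume *)
Section UltraLimits.
Variables (R : realType) (G : set_system nat).
Context {UG : UltraFilter G}.
Hypothesis Goo : \oo `<=` G.
Local Notation C := R[i].

Let PG : ProperFilter G := ultra_proper.

(** Compactness yields a cluster point and the ultrafilter makes it a limit. All eigenvalues and all
    values of all eigenvectors thus converge at once, without diagonal subsequences. *)
Lemma ultra_cvg_bounded (u : nat -> R) (B : R) : (forall n, `|u n| <= B) ->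
  exists l : R, u n @[n --> G] --> l.
Proof.
move=> uB.
have uA : (u @ G) `[- B, B]%classic.
  change (G (u @^-1` `[- B, B]%classic)); apply: filterS filterT => n _.
  by rewrite /= in_itv/= -ler_norml uB.
have [l [_ cl]] := @segment_compact R (- B) B (u @ G) _ uA.
exists l => A Al.
have [//|GA] := in_ultra_setVsetC (u @^-1` A) UG.
by have [y [/= + Ay]] := cl (~` A) A GA Al.
Qed.

Definition ccvg (u : nat -> C) (z : C) :=
  (complex.Re (u n) @[n --> G] --> complex.Re z) /\
  (complex.Im (u n) @[n --> G] --> complex.Im z).

Lemma ccvg_bounded (u : nat -> C) (B : R) : (forall n, cabs (u n) <= B) ->
  exists z, ccvg u z.
Proof.
move=> uB.
have [a ha] := @ultra_cvg_bounded (fun n => complex.Re (u n)) B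
  (fun n => le_trans (Re_le_cabs _) (uB n)).
have [b hb] := @ultra_cvg_bounded (fun n => complex.Im (u n)) B
  (fun n => le_trans (Im_le_cabs _) (uB n)).
by exists (Complex a b).
Qed.

Lemma ccvg_cst (z : C) : ccvg (fun=> z) z.
Proof. by split; exact: cvg_cst. Qed.

Lemma ccvg_real (u : nat -> R) (l : R) : u n @[n --> G] --> l ->
  ccvg (fun n => (u n)%:C%C) l%:C%C.
Proof. by split => //=; exact: cvg_cst. Qed.

Lemma ccvgD (u w : nat -> C) (a b : C) : ccvg u a -> ccvg w b ->
  ccvg (fun n => u n + w n) (a + b).
Proof.
move=> [u1 u2] [w1 w2]; split.
- by under eq_fun => n do rewrite cReD; rewrite cReD; exact: cvgD.
- by under eq_fun => n do rewrite cImD; rewrite cImD; exact: cvgD.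
Qed.

Lemma ccvgN (u : nat -> C) (a : C) : ccvg u a -> ccvg (fun n => - u n) (- a).
Proof.
move=> [u1 u2]; split.
- by under eq_fun => n do rewrite cReN; rewrite cReN; exact: cvgN.
- by under eq_fun => n do rewrite cImN; rewrite cImN; exact: cvgN.
Qed.

Lemma ccvgM (u w : nat -> C) (a b : C) : ccvg u a -> ccvg w b ->
  ccvg (fun n => u n * w n) (a * b).
Proof.
move=> [u1 u2] [w1 w2]; split.
- by under eq_fun => n do rewrite cReM; rewrite cReM; apply: cvgB; exact: cvgM.
- by under eq_fun => n do rewrite cImM; rewrite cImM; apply: cvgD; exact: cvgM.
Qed.

Lemma ccvg_sum (I : Type) (r : seq I) (u : I -> nat -> C) (a : I -> C) :
  (forall i, ccvg (u i) (a i)) ->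
  ccvg (fun n => \sum_(i <- r) u i n) (\sum_(i <- r) a i).
Proof.
move=> h; elim: r => [|i r ih].
  rewrite big_nil (_ : (fun _ => _) = fun=> 0); first exact: ccvg_cst.
  by apply/funext => n; rewrite big_nil.
rewrite big_cons (_ : (fun _ => _) = fun n => u i n + \sum_(j <- r) u j n).
  exact: ccvgD.
by apply/funext => n; rewrite big_cons.
Qed.

Lemma ccvg_cabs_sqr (u : nat -> C) (a : C) : ccvg u a ->
  cabs (u n) ^+ 2 @[n --> G] --> cabs a ^+ 2.
Proof.
move=> [u1 u2]; under eq_fun => n do rewrite cabs_sqr !expr2.
by rewrite cabs_sqr !expr2; apply: cvgD; exact: cvgM.
Qed.

Lemma cvg_eventually_le (u : nat -> R) (l B : R) : u n @[n --> G] --> l ->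
  (\forall n \near \oo, u n <= B) -> l <= B.
Proof. by move=> ul /Goo uB; exact: (cvgr_to_le ul uB). Qed.

Lemma ccvg_eventually_eq (u w : nat -> C) (a b : C) : ccvg u a -> ccvg w b ->
  (\forall n \near \oo, u n = w n) -> a = b.
Proof.
move=> ua wb uw; apply/eqP; rewrite -subr_eq0 -cabs_eq0 -sqrf_eq0 eq_le sqr_ge0 andbT.
have := ccvg_cabs_sqr (ccvgD ua (ccvgN wb)).
move=> /cvg_eventually_le; apply; apply: filterS uw => n ->.
by rewrite subrr cabs0 expr0n.
Qed.

End UltraLimits.

(** * The limit over boxes *)

Section InfiniteVolumeLimit.
Variables (R : realType) (d : nat) (eps : R) (v : site d -> R) (K : nat) (B : R).
Local Notation C := R[i].
Local Notation "x %:C" := (real_complex R x) : ring_scope.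
Hypothesis good : forall N, exists2 L, (N <= L)%N &
  correlation_bounded eps v K B (sites d L).

Lemma localized_eigenvectors (x : site d) (tau : R) : 0 < tau ->
  exists N (f : 'I_N -> wave R d) (E : 'I_N -> R) (Bx : R),
  [/\ forall i y, hamiltonian eps v (f i) y = (E i)%:C * f i y,
      forall i y, cabs (f i y) ^+ 2 <= Bx * (2 / 3) ^+ l1norm (x - y) &
      forall t : seq (site d), uniq t ->
        \sum_(y <- t) cabs (indicator R x y - \sum_i f i y) ^+ 2 <= tau].
Proof.
move=> tau0.
have [N [Bx hloc]] := localized_family_exists eps v K B x tau0.
(* The offset puts [x] in every chosen box, while any other site lies in all boxes from some index
   on; the eigenvalue equation, valid only inside a box, then holds everywhere in the limit. *)
have exL n : exists L, (n + (pickle x).+1 <= L)%N /\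
    correlation_bounded eps v K B (sites d L).
  by have [L h1 h2] := good (n + (pickle x).+1); exists L.
have [L hL] := choice exL.
have exfE n : exists fE : ('I_N -> wave R d) * ('I_N -> R),
    localized_family eps v K x Bx tau (sites d (L n)) fE.1 fE.2.
  have [h1 h2] := hL n.
  have xs : x \in sites d (L n).
    by apply: mem_sites; rewrite (leq_trans _ h1)// leq_addl.
  by have [f [E h]] := hloc _ (sites_uniq d _) xs h2; exists (f, E).
have [fE hfE] := choice exfE.
have [G [UG Goo]] := @ultraFilterLemma nat \oo _.
have exE i : exists l : R, (fE n).2 i @[n --> G] --> l.
  apply: (ultra_cvg_bounded (B := K%:R)) => n.
  by have [] := hfE n.
have [E hE] := choice exE.
have exf (iy : 'I_N * site d) : exists z : C, ccvg G (fun n => (fE n).1 iy.1 iy.2) z.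
  apply: (ccvg_bounded (B := Num.sqrt (Bx * (2 / 3) ^+ l1norm (x - iy.2)))) => n.
  have [_ _ h _] := hfE n.
  by rewrite -[leLHS](ger0_norm (cabs_ge0 _)) -sqrtr_sqr ler_wsqrtr.
have [f' hf'] := choice exf.
pose f (i : 'I_N) : wave R d := fun y => f' (i, y).
have hf i y : ccvg G (fun n => (fE n).1 i y) (f i y) by exact: hf' (i, y).
have sites_near y : \forall n \near \oo, y \in sites d (L n).
  exists (pickle y).+1 => // n /= yn; apply: mem_sites; have [h _] := hL n.
  by rewrite (leq_trans yn)// (leq_trans _ h)// leq_addr.
exists N, f, E, Bx; split.
- move=> i y.
  have l1 : ccvg G (fun n => hamiltonian eps v ((fE n).1 i) y) (hamiltonian eps v (f i) y).
    apply: ccvgD; apply: ccvgM; try exact: ccvg_cst; last exact: hf.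
    by apply: ccvg_sum => j; apply: ccvgD; exact: hf.
  have l2 : ccvg G (fun n => ((fE n).2 i)%:C * (fE n).1 i y) ((E i)%:C * f i y).
    by apply: ccvgM; [exact: ccvg_real|exact: hf].
  apply: (ccvg_eventually_eq Goo l1 l2); apply: filterS (sites_near y) => n.
  by have [_ h _ _] := hfE n; exact: h.
- move=> i y; apply: (cvg_eventually_le Goo (ccvg_cabs_sqr (hf i y))).
  by apply: nearW => n; have [_ _ h _] := hfE n.
- move=> t ut.
  have l1 y : ccvg G (fun n => indicator R x y - \sum_i (fE n).1 i y)
      (indicator R x y - \sum_i f i y).
    apply: ccvgD; first exact: ccvg_cst.
    by apply: ccvgN; apply: ccvg_sum => i; exact: hf.
  have l2 : \sum_(y <- t) cabs (indicator R x y - \sum_i (fE n).1 i y) ^+ 2 @[n --> G]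
      --> \sum_(y <- t) cabs (indicator R x y - \sum_i f i y) ^+ 2.
    have [+ _] := ccvg_sum t (fun y => ccvg_real (ccvg_cabs_sqr (l1 y))).
    by rewrite -rmorph_sum; under eq_fun do rewrite -rmorph_sum.
  apply: (cvg_eventually_le Goo l2).
  have tn : \forall n \near \oo, {subset t <= sites d (L n)}.
    elim: (t) => [|y t' ih]; first by apply: nearW.
    apply: filterS2 (sites_near y) ih => n yn tn u; rewrite in_cons => /predU1P[->//|].
    exact: tn.
  apply: filterS tn => n tn; have [_ _ _ h] := hfE n.
  by apply: le_trans h; apply: sum_sub_uniq_le => // y; rewrite sqr_ge0.
Qed.

End InfiniteVolumeLimit.

(** * Sums over the lattice *)
Section NonnegativeSums.
Variables (R : realType) (T : choiceType).
Implicit Types (a b : T -> R).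

Definition summable_ge0 a := (\esum_(n in [set: T]) (a n)%:E < +oo)%E.
Definition nnsum a : R := fine (\esum_(n in [set: T]) (a n)%:E)%E.

Lemma sum_le_esum a (t : seq T) : uniq t ->
  ((\sum_(n <- t) a n)%:E <= \esum_(n in [set: T]) (a n)%:E)%E.
Proof.
move=> ut; apply: esum_ge; exists [set` t]; first by split.
by rewrite -fsbig_seq// sumEFin.
Qed.

Lemma esum_le a (B : R) : (forall t, uniq t -> \sum_(n <- t) a n <= B) ->
  (\esum_(n in [set: T]) (a n)%:E <= B%:E)%E.
Proof.
move=> h; apply: ge_ereal_sup => _ [X [finX _] <-].
by rewrite fsbig_finite//= sumEFin lee_fin h// fset_uniq.
Qed.

Lemma summable_bounded a (B : R) : (forall t, uniq t -> \sum_(n <- t) a n <= B) ->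
  summable_ge0 a.
Proof. by move=> /esum_le h; rewrite /summable_ge0 (le_lt_trans h)// ltry. Qed.

Lemma nnsumK a : (forall n, 0 <= a n) -> summable_ge0 a ->
  \esum_(n in [set: T]) (a n)%:E = (nnsum a)%:E.
Proof.
move=> a0 sa; rewrite fineK// ge0_fin_numE//.
by apply: esum_ge0 => n _; rewrite lee_fin.
Qed.

Lemma sum_le_nnsum a t : (forall n, 0 <= a n) -> summable_ge0 a -> uniq t ->
  \sum_(n <- t) a n <= nnsum a.
Proof. by move=> a0 sa ut; rewrite -lee_fin -nnsumK// sum_le_esum. Qed.

Lemma nnsum_le a B : (forall n, 0 <= a n) ->
  (forall t, uniq t -> \sum_(n <- t) a n <= B) -> nnsum a <= B.
Proof.
by move=> a0 h; rewrite -lee_fin -nnsumK//; [exact: esum_le|exact: summable_bounded h].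
Qed.

Lemma nnsum_ge0 a : (forall n, 0 <= a n) -> 0 <= nnsum a.
Proof. by move=> a0; rewrite fine_ge0// esum_ge0// => n _; rewrite lee_fin. Qed.

Lemma le_summable a b : (forall n, a n <= b n) -> summable_ge0 b -> summable_ge0 a.
Proof. by move=> ab; apply: le_lt_trans; apply: le_esum => n _; rewrite lee_fin. Qed.

Lemma le_nnsum a b : (forall n, 0 <= a n) -> (forall n, a n <= b n) ->
  summable_ge0 b -> nnsum a <= nnsum b.
Proof.
move=> a0 ab sb; have b0 n : 0 <= b n := le_trans (a0 n) (ab n).
apply: nnsum_le => // t ut; rewrite (le_trans _ (sum_le_nnsum b0 sb ut))//.
exact: ler_sum.
Qed.

Lemma summable_ge0D a b : (forall n, 0 <= a n) -> (forall n, 0 <= b n) ->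
  summable_ge0 a -> summable_ge0 b -> summable_ge0 (fun n => a n + b n).
Proof.
move=> a0 b0 sa sb; apply: (@summable_bounded _ (nnsum a + nnsum b)) => t ut.
by rewrite big_split lerD// sum_le_nnsum.
Qed.

Lemma nnsumD a b : (forall n, 0 <= a n) -> (forall n, 0 <= b n) ->
  summable_ge0 a -> summable_ge0 b -> nnsum (fun n => a n + b n) = nnsum a + nnsum b.
Proof.
move=> a0 b0 sa sb; have sab := summable_ge0D a0 b0 sa sb.
apply: EFin_inj; rewrite EFinD -!nnsumK// => [|n]; last by rewrite addr_ge0.
by rewrite -esumD// => n _; rewrite lee_fin.
Qed.

Lemma summable_ge0Z c a : 0 <= c -> (forall n, 0 <= a n) -> summable_ge0 a ->
  summable_ge0 (fun n => c * a n).
Proof.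
move=> c0 a0 sa; apply: (@summable_bounded _ (c * nnsum a)) => t ut.
by rewrite -mulr_sumr ler_wpM2l// sum_le_nnsum.
Qed.

Lemma nnsumZ c a : 0 <= c -> (forall n, 0 <= a n) -> summable_ge0 a ->
  nnsum (fun n => c * a n) = c * nnsum a.
Proof.
move=> c0 a0 sa; apply/eqP; rewrite eq_le; apply/andP; split.
  apply: nnsum_le => [n|t ut]; first by rewrite mulr_ge0.
  by rewrite -mulr_sumr ler_wpM2l// sum_le_nnsum.
have [->|cn0] := eqVneq c 0.
  by rewrite mul0r nnsum_ge0// => n; rewrite mul0r.
have {}c0 : 0 < c by rewrite lt_def cn0.
rewrite -ler_pdivlMl//; apply: nnsum_le => // t ut.
rewrite ler_pdivlMl// mulr_sumr; apply: sum_le_nnsum => //.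
  by move=> n; rewrite mulr_ge0// ltW.
by apply: summable_ge0Z => //; exact: ltW.
Qed.

Lemma eq_nnsum a b : a =1 b -> nnsum a = nnsum b.
Proof. by move=> ab; congr nnsum; exact/funext. Qed.

Lemma nnsum_tail a e : (forall n, 0 <= a n) -> summable_ge0 a -> 0 < e ->
  exists2 t, uniq t & nnsum (fun n => if n \in t then 0 else a n) <= e.
Proof.
move=> a0 sa e0.
have [t ut te] : exists2 t, uniq t & nnsum a - e < \sum_(n <- t) a n.
  apply: contrapT => h; have : nnsum a <= nnsum a - e.
    apply: nnsum_le => // t ut; rewrite leNgt; apply/negP => te.
    by apply: h; exists t.
  by move=> h1; lra.
exists t => //; apply: nnsum_le => [n|t' ut']; first by case: ifP.
have : \sum_(n <- undup (t ++ t')) a n <= nnsum a by rewrite sum_le_nnsum ?undup_uniq.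
rewrite (perm_big (t ++ [seq n <- t' | n \notin t])); last first.
  apply: uniq_perm; rewrite ?undup_uniq//.
    rewrite cat_uniq ut filter_uniq// andbT; apply/hasPn => n.
    by rewrite mem_filter => /andP[].
  move=> n; rewrite mem_undup !mem_cat mem_filter.
  by case: (n \in t).
rewrite big_cat/= big_filter [X in _ + X]big_mkcond/=.
have -> : \sum_(n <- t') (if n \notin t then a n else 0) =
    \sum_(n <- t') (if n \in t then 0 else a n).
  by apply: eq_bigr => n _; case: (n \in t).
by lra.
Qed.

Lemma nnsum_bij (e : T -> T) a : bijective e -> nnsum (a \o e) = nnsum a.
Proof.
move=> be; rewrite /nnsum; congr fine.
rewrite [RHS](@reindex_esum _ _ _ setT setT e)//.
by rewrite setTT_bijective.
Qed.

Lemma summable_bij (e : T -> T) a : bijective e -> summable_ge0 a ->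
  summable_ge0 (a \o e).
Proof.
move=> be; rewrite /summable_ge0 (@reindex_esum _ _ _ setT setT e)//.
by rewrite setTT_bijective.
Qed.

End NonnegativeSums.

Section ComplexSums.
Variables (R : realType) (d : nat).
Local Notation C := R[i].
Implicit Types (u w : site d -> R) (f g h : site d -> C).

(** Positive and negative parts are not additive; additivity of [rsum] comes from allowing any
    difference of summable nonnegative families. *)
Lemma rsumE u a b : (forall n, 0 <= a n) -> (forall n, 0 <= b n) ->
  summable_ge0 a -> summable_ge0 b -> (forall n, u n = a n - b n) ->
  rsum u = nnsum a - nnsum b.
Proof.
move=> a0 b0 sa sb uE.
have p0 n : 0 <= Num.max (u n) 0 by rewrite le_max lexx orbT.
have m0 n : 0 <= Num.max (- u n) 0 by rewrite le_max lexx orbT.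
have sp : summable_ge0 (fun n => Num.max (u n) 0).
  by apply: le_summable sa => n; rewrite ge_max a0 uE gerBl b0.
have sm : summable_ge0 (fun n => Num.max (- u n) 0).
  by apply: le_summable sb => n; rewrite ge_max b0 uE opprB gerBl a0.
rewrite /rsum -!/(nnsum _); apply/eqP; rewrite subr_eq addrAC -subr_eq opprK.
rewrite -!nnsumD//; apply/eqP; apply: eq_nnsum => n; rewrite uE.
by have [h|h] := leP (a n - b n) 0; have [h'|h'] := leP (- (a n - b n)) 0; lra.
Qed.

Definition asummable f := summable_ge0 (fun n => cabs (f n)).

Lemma asummable_le f (a : site d -> R) : (forall n, cabs (f n) <= a n) ->
  summable_ge0 a -> asummable f.
Proof. exact: le_summable. Qed.

Let posp (x : R) : R := Num.max x 0.
Let posp0 x : 0 <= posp x. Proof. by rewrite le_max lexx orbT. Qed.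
Let pospE x : x = posp x - posp (- x).
Proof. by rewrite /posp; have [h|h] := leP x 0; have [h'|h'] := leP (- x) 0; lra. Qed.
Let posp_le x : posp x <= `|x|.
Proof. by rewrite ge_max ler_norm normr_ge0. Qed.

Lemma rsum_posp u : rsum u = nnsum (fun n => posp (u n)) - nnsum (fun n => posp (- u n)).
Proof. by []. Qed.

Let sposp u : summable_ge0 (fun n => `|u n|) ->
  summable_ge0 (fun n => posp (u n)) /\ summable_ge0 (fun n => posp (- u n)).
Proof.
move=> su; split; apply: le_summable su => n; first exact: posp_le.
by rewrite -normrN posp_le.
Qed.

Lemma rsumD u w : summable_ge0 (fun n => `|u n|) -> summable_ge0 (fun n => `|w n|) ->
  rsum (fun n => u n + w n) = rsum u + rsum w.
Proof.
move=> /sposp[u1 u2] /sposp[w1 w2].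
rewrite (@rsumE _ (fun n => posp (u n) + posp (w n))
  (fun n => posp (- u n) + posp (- w n))).
- by rewrite !nnsumD// !rsum_posp; lra.
- by move=> n; rewrite addr_ge0.
- by move=> n; rewrite addr_ge0.
- exact: summable_ge0D.
- exact: summable_ge0D.
- by move=> n; rewrite {1}(pospE (u n)) {1}(pospE (w n)); lra.
Qed.

Lemma rsumN u : rsum (fun n => - u n) = - rsum u.
Proof.
rewrite /rsum opprB; congr (_ - fine _); apply: eq_esum => n _.
by rewrite opprK.
Qed.

Lemma rsum_ge0E u : (forall n, 0 <= u n) -> rsum u = nnsum u.
Proof.
move=> u0; rewrite /rsum (eq_esum (b := fun n => (u n)%:E)) => [|n _]; last first.
  by rewrite max_l.
rewrite [X in _ - fine X]esum1 ?subr0// => n _.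
by rewrite max_r// oppr_le0.
Qed.

Lemma rsumZ c u : summable_ge0 (fun n => `|u n|) ->
  rsum (fun n => c * u n) = c * rsum u.
Proof.
move=> su; wlog c0 : c / 0 <= c => [hw|].
  have [c0|c0] := leP 0 c; first exact: hw.
  have := hw (- c); rewrite oppr_ge0 (ltW c0) => /(_ isT).
  move=> h; apply: oppr_inj; rewrite -mulNr -h -rsumN; congr rsum.
  by apply/funext => n; rewrite mulNr.
have [u1 u2] := sposp su.
rewrite (@rsumE _ (fun n => c * posp (u n)) (fun n => c * posp (- u n))).
- by rewrite !nnsumZ// rsum_posp mulrBr.
- by move=> n; rewrite mulr_ge0.
- by move=> n; rewrite mulr_ge0.
- exact: summable_ge0Z.
- exact: summable_ge0Z.
- by move=> n; rewrite {1}(pospE (u n)) mulrBr.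
Qed.

Lemma rsum_bij (e : site d -> site d) u : bijective e -> rsum (u \o e) = rsum u.
Proof.
move=> be; rewrite !rsum_posp.
by rewrite -(nnsum_bij (fun n => posp (u n)) be) -(nnsum_bij (fun n => posp (- u n)) be).
Qed.

Lemma asummableRe f : asummable f -> summable_ge0 (fun n => `|complex.Re (f n)|).
Proof. by apply: le_summable => n; exact: Re_le_cabs. Qed.

Lemma asummableIm f : asummable f -> summable_ge0 (fun n => `|complex.Im (f n)|).
Proof. by apply: le_summable => n; exact: Im_le_cabs. Qed.

Lemma csumD f g : asummable f -> asummable g ->
  csum (fun n => f n + g n) = csum f + csum g.
Proof.
move=> sf sg; have [f1 f2] := (asummableRe sf, asummableIm sf).
have [g1 g2] := (asummableRe sg, asummableIm sg).
apply: complex_eq; rewrite ?cReD ?cImD/=.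
- by rewrite -rsumD//; congr rsum; apply/funext => n; rewrite cReD.
- by rewrite -rsumD//; congr rsum; apply/funext => n; rewrite cImD.
Qed.

Lemma csumZ c f : asummable f -> csum (fun n => c * f n) = c * csum f.
Proof.
move=> sf; have [f1 f2] := (asummableRe sf, asummableIm sf).
have sZ k w : summable_ge0 (fun n => `|w n|) -> summable_ge0 (fun n => `|k * w n : R|).
  move=> sw; under [fun n => _]eq_fun => n do rewrite normrM.
  exact: summable_ge0Z.
apply: complex_eq; rewrite ?cReM ?cImM/=.
- rewrite -!rsumZ// -rsumN -rsumD; [|exact: sZ|].
    by congr rsum; apply/funext => n; rewrite cReM.
  by under [fun n => _]eq_fun => n do rewrite normrN; exact: sZ.
- rewrite -!rsumZ// -rsumD; [|exact: sZ|exact: sZ].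
  by congr rsum; apply/funext => n; rewrite cImM.
Qed.

Lemma csum_conj f : csum (fun n => (f n)^*%C) = (csum f)^*%C.
Proof.
apply: complex_eq; rewrite ?cReJ ?cImJ/=.
- by congr rsum; apply/funext => n; rewrite cReJ.
- by rewrite -rsumN; congr rsum; apply/funext => n; rewrite cImJ.
Qed.

Lemma csum_bij (e : site d -> site d) f : bijective e -> csum (f \o e) = csum f.
Proof.
move=> be; apply: complex_eq => /=.
- by rewrite -(rsum_bij (fun n => complex.Re (f n)) be).
- by rewrite -(rsum_bij (fun n => complex.Im (f n)) be).
Qed.

Lemma csum_real u : (forall n, 0 <= u n) -> csum (fun n => (u n)%:C%C) = (nnsum u)%:C%C.
Proof.
move=> u0; apply: complex_eq => /=; first exact: rsum_ge0E.
rewrite rsum_ge0E// /nnsum esum1//.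
Qed.

End ComplexSums.

(** * The Hilbert space structure of l^2(Z^d) *)
Section SquareSummable.
Variables (R : realType) (d : nat).
Local Notation C := R[i].
Local Notation "x %:C" := (real_complex R x) : ring_scope.
Local Notation ell2 := (@ell2 R d).
Implicit Types (f g h : wave R d) (c : C).

Definition normsq f : R := nnsum (fun n => cabs (f n) ^+ 2).

Let sq0 f n : 0 <= cabs (f n) ^+ 2. Proof. by rewrite sqr_ge0. Qed.

Lemma normsq_ge0 f : 0 <= normsq f.
Proof. exact: nnsum_ge0. Qed.

Lemma l2normE f : l2norm f = Num.sqrt (normsq f).
Proof. by []. Qed.

Lemma sqr_l2norm f : l2norm f ^+ 2 = normsq f.
Proof. by rewrite l2normE sqr_sqrtr// normsq_ge0. Qed.

Lemma l2norm_ge0 f : 0 <= l2norm f.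
Proof. by rewrite l2normE sqrtr_ge0. Qed.

Lemma cabsD_sqr_le (x y : C) : cabs (x + y) ^+ 2 <= 2 * cabs x ^+ 2 + 2 * cabs y ^+ 2.
Proof.
have := sqr_ge0 (cabs x - cabs y); rewrite sqrrB => h.
have : cabs (x + y) ^+ 2 <= (cabs x + cabs y) ^+ 2.
  by rewrite ler_pXn2r ?nnegrE ?addr_ge0 ?cabs_ge0// cabsD.
by rewrite sqrrD; lra.
Qed.

Lemma ell2_bounded f (B : R) : (forall t : seq (site d), uniq t -> \sum_(n <- t) cabs (f n) ^+ 2 <= B) ->
  ell2 f.
Proof. exact: summable_bounded. Qed.

Lemma normsq_le f (B : R) :
  (forall t : seq (site d), uniq t -> \sum_(n <- t) cabs (f n) ^+ 2 <= B) -> normsq f <= B.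
Proof. by move=> h; exact: nnsum_le. Qed.

Let summ2 f g : ell2 f -> ell2 g ->
  summable_ge0 (fun n => 2 * cabs (f n) ^+ 2 + 2 * cabs (g n) ^+ 2).
Proof.
move=> sf sg; apply: summable_ge0D; first by move=> n; rewrite mulr_ge0.
- by move=> n; rewrite mulr_ge0.
- by apply: summable_ge0Z => // n; rewrite sqr_ge0.
- by apply: summable_ge0Z => // n; rewrite sqr_ge0.
Qed.

Lemma ell2D f g : ell2 f -> ell2 g -> ell2 (fun n => f n + g n).
Proof.
by move=> sf sg; apply: le_summable (summ2 sf sg) => n; exact: cabsD_sqr_le.
Qed.

Lemma normsqD_le f g : ell2 f -> ell2 g ->
  normsq (fun n => f n + g n) <= 2 * normsq f + 2 * normsq g.
Proof.
move=> sf sg; rewrite /normsq -(nnsumZ (ler0n R 2) (sq0 f) sf).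
rewrite -(nnsumZ (ler0n R 2) (sq0 g) sg) -nnsumD.
- apply: le_nnsum; last exact: summ2.
  + by move=> n; rewrite sqr_ge0.
  + by move=> n; exact: cabsD_sqr_le.
- by move=> n; rewrite mulr_ge0.
- by move=> n; rewrite mulr_ge0.
- by apply: summable_ge0Z => // n; rewrite sqr_ge0.
- by apply: summable_ge0Z => // n; rewrite sqr_ge0.
Qed.

Lemma ell2Z c f : ell2 f -> ell2 (fun n => c * f n).
Proof.
move=> sf; apply: le_summable (summable_ge0Z (sqr_ge0 (cabs c)) (sq0 f) sf) => n.
by rewrite cabsM exprMn.
Qed.

Lemma normsqZ c f : ell2 f -> normsq (fun n => c * f n) = cabs c ^+ 2 * normsq f.
Proof.
move=> sf; rewrite -nnsumZ//; last exact: sqr_ge0.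
by apply: eq_nnsum => n; rewrite cabsM exprMn.
Qed.

Lemma ell2N f : ell2 f -> ell2 (fun n => - f n).
Proof. by apply: le_summable => n; rewrite cabsN. Qed.

Lemma ell2B f g : ell2 f -> ell2 g -> ell2 (fun n => f n - g n).
Proof. by move=> sf sg; apply: ell2D => //; exact: ell2N. Qed.

Lemma ell2_0 : ell2 (fun=> 0).
Proof.
by apply: (@ell2_bounded _ 0) => t _; rewrite big1// => n _; rewrite cabs0 expr0n.
Qed.

Lemma ell2_sum (I : Type) (r : seq I) (F : I -> wave R d) :
  (forall i, ell2 (F i)) -> ell2 (fun n => \sum_(i <- r) F i n).
Proof.
move=> sF; elim: r => [|i r ih].
  rewrite (_ : (fun _ => _) = fun=> 0); first exact: ell2_0.
  by apply/funext => n; rewrite big_nil.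
rewrite (_ : (fun _ => _) = fun n => F i n + \sum_(j <- r) F j n); first exact: ell2D.
by apply/funext => n; rewrite big_cons.
Qed.

Lemma cabs_sqr_le_normsq f n : ell2 f -> cabs (f n) ^+ 2 <= normsq f.
Proof.
by move=> sf; have := @sum_le_nnsum _ _ _ [:: n] (sq0 f) sf erefl; rewrite big_seq1.
Qed.

Lemma normsq_eq0 f : ell2 f -> normsq f = 0 -> f = fun=> 0.
Proof.
move=> sf f0; apply/funext => n; apply/eqP.
rewrite -cabs_eq0 -sqrf_eq0 eq_le sq0 andbT -f0.
exact: cabs_sqr_le_normsq.
Qed.

Lemma asummable_dotp f g : ell2 f -> ell2 g -> asummable (fun n => (f n)^*%C * g n).
Proof.
move=> sf sg; apply: asummable_le (summ2 sf sg) => n.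
rewrite cabsM cabs_conj.
have := sqr_ge0 (cabs (f n) - cabs (g n)); rewrite sqrrB.
by have := sq0 f n; have := sq0 g n; lra.
Qed.

Lemma dotpDr f g h : ell2 f -> ell2 g -> ell2 h ->
  dotp f (fun n => g n + h n) = dotp f g + dotp f h.
Proof.
move=> sf sg sh; rewrite /dotp -csumD; try exact: asummable_dotp.
by congr csum; apply/funext => n; rewrite mulrDr.
Qed.

Lemma dotpZr c f g : ell2 f -> ell2 g -> dotp f (fun n => c * g n) = c * dotp f g.
Proof.
move=> sf sg; rewrite /dotp -csumZ; last exact: asummable_dotp.
by congr csum; apply/funext => n; rewrite mulrCA.
Qed.

Lemma dotpC f g : dotp g f = (dotp f g)^*%C.
Proof.
rewrite /dotp -csum_conj; congr csum; apply/funext => n.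
by rewrite rmorphM/= conjcK mulrC.
Qed.

Lemma dotpDl f g h : ell2 f -> ell2 g -> ell2 h ->
  dotp (fun n => f n + g n) h = dotp f h + dotp g h.
Proof. by move=> sf sg sh; rewrite dotpC dotpDr// (dotpC h f) (dotpC h g); exact: rmorphD. Qed.

Lemma dotpZl c f g : ell2 f -> ell2 g ->
  dotp (fun n => c * f n) g = c^*%C * dotp f g.
Proof. by move=> sf sg; rewrite dotpC dotpZr// (dotpC g f); exact: rmorphM. Qed.

Lemma dotpNr f g : ell2 f -> ell2 g -> dotp f (fun n => - g n) = - dotp f g.
Proof.
move=> sf sg; rewrite -mulN1r -dotpZr//; congr dotp.
by apply/funext => n; rewrite mulN1r.
Qed.

Lemma dotpBr f g h : ell2 f -> ell2 g -> ell2 h ->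
  dotp f (fun n => g n - h n) = dotp f g - dotp f h.
Proof. by move=> sf sg sh; rewrite dotpDr ?dotpNr//; exact: ell2N. Qed.

Lemma dotpBl f g h : ell2 f -> ell2 g -> ell2 h ->
  dotp (fun n => f n - g n) h = dotp f h - dotp g h.
Proof. by move=> sf sg sh; rewrite dotpC dotpBr// (dotpC h f) (dotpC h g); exact: rmorphB. Qed.

Lemma dotp0r f : ell2 f -> dotp f (fun=> 0) = 0.
Proof.
move=> sf; have := dotpZr 0 sf sf; rewrite mul0r => h; rewrite -[RHS]h; congr dotp.
by apply/funext => n; rewrite mul0r.
Qed.

Lemma dotp_sumr (I : Type) (r : seq I) f (F : I -> wave R d) :
  ell2 f -> (forall i, ell2 (F i)) ->
  dotp f (fun n => \sum_(i <- r) F i n) = \sum_(i <- r) dotp f (F i).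
Proof.
move=> sf sF; elim: r => [|i r ih].
  rewrite big_nil -[RHS](dotp0r sf); congr dotp.
  by apply/funext => n; rewrite big_nil.
rewrite big_cons -ih -dotpDr//; last exact: ell2_sum.
by congr dotp; apply/funext => n; rewrite big_cons.
Qed.

Lemma dotp_suml (I : Type) (r : seq I) f (F : I -> wave R d) :
  ell2 f -> (forall i, ell2 (F i)) ->
  dotp (fun n => \sum_(i <- r) F i n) f = \sum_(i <- r) dotp (F i) f.
Proof.
move=> sf sF; rewrite dotpC dotp_sumr// rmorph_sum.
by apply: eq_bigr => i _; rewrite [RHS]dotpC.
Qed.

Lemma dotp_self f : dotp f f = (normsq f)%:C.
Proof.
rewrite /normsq -csum_real//; congr csum; apply/funext => n.
by rewrite cabs_sqrC mulrC.
Qed.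

Lemma normsqDE f g : ell2 f -> ell2 g ->
  normsq (fun n => f n + g n) = normsq f + normsq g + 2 * complex.Re (dotp f g).
Proof.
move=> sf sg; have sfg := ell2D sf sg.
have : complex.Re (dotp (fun n => f n + g n) (fun n => f n + g n)) =
    normsq f + normsq g + 2 * complex.Re (dotp f g).
  by rewrite dotpDl// !dotpDr// !dotp_self !cReD (dotpC f g) cReJ !cReC; lra.
by rewrite dotp_self.
Qed.

Lemma normsqD_orthogonal f g : ell2 f -> ell2 g -> dotp f g = 0 ->
  normsq (fun n => f n + g n) = normsq f + normsq g.
Proof. by move=> sf sg fg; rewrite normsqDE// fg/= mulr0 addr0. Qed.

Lemma dotp_CauchySchwarz f g : ell2 f -> ell2 g ->
  cabs (dotp f g) ^+ 2 <= normsq f * normsq g.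
Proof.
move=> sf sg; have [g0|g0] := eqVneq (normsq g) 0.
  by rewrite (normsq_eq0 sg g0) dotp0r// cabs0 expr0n mulr_ge0// normsq_ge0.
have gp : 0 < normsq g by rewrite lt_def g0 normsq_ge0.
(* The coefficient that minimizes the norm of f + c g. *)
set S := dotp f g; pose c := - (S^*%C / (normsq g)%:C).
have cS : complex.Re (c * S) = - (cabs S ^+ 2 / normsq g).
  have -> : c * S = - (cabs S ^+ 2 / normsq g)%:C.
    rewrite /c mulNr mulrAC [_^*%C * S]mulrC -cabs_sqrC -fmorphV -rmorphM//.
  by rewrite cReN cReC.
have c2 : cabs c ^+ 2 * normsq g = cabs S ^+ 2 / normsq g.
  rewrite /c cabsN cabsM cabsV cabs_conj cabs_real ger0_norm ?(ltW gp)//.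
  by field.
have := normsq_ge0 (fun n => f n + c * g n).
rewrite normsqDE//; last exact: ell2Z.
rewrite normsqZ// dotpZr// -/S cS c2 => h.
by rewrite -ler_pdivrMr//; lra.
Qed.

Lemma dotp_indicator f x : ell2 f -> dotp f (indicator R x) = (f x)^*%C.
Proof.
move=> sf; rewrite /dotp.
have single (a : R) : 0 <= a -> nnsum (fun n : site d => if n == x then a else 0) = a.
  move=> a0; have p0 (n : site d) : 0 <= (if n == x then a else 0) by case: ifP.
  have hb t : uniq t -> \sum_(n <- t) (if n == x then a else 0) <= a.
    move=> ut; have [xt|xt] := boolP (x \in t).
      by rewrite (bigD1_seq x)//= eqxx big1 ?addr0// => n /negbTE ->.
    rewrite big_seq big1// => n nt; case: eqP => // nx.
    by rewrite -nx nt in xt.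
  apply/eqP; rewrite eq_le nnsum_le//=.
  have := @sum_le_nnsum _ _ _ [:: x] p0 (summable_bounded hb) erefl.
  by rewrite big_seq1 eqxx.
have rsingle (a : R) : rsum (fun n : site d => if n == x then a else 0) = a.
  rewrite rsum_posp.
  rewrite (_ : (fun n : site d => Num.max _ 0) = fun n => if n == x then Num.max a 0 else 0).
    rewrite (_ : (fun n : site d => Num.max _ 0) = fun n => if n == x then Num.max (- a) 0 else 0).
      rewrite !single ?le_max ?lexx ?orbT//.
      by have [h|h] := leP a 0; have [h'|h'] := leP (- a) 0; lra.
    by apply/funext => n; case: eqP => // _; rewrite oppr0 maxxx.
  by apply/funext => n; case: eqP => // _; rewrite maxxx.
apply: complex_eq => /=.
- rewrite -[RHS]rsingle; congr rsum; apply/funext => n; rewrite /indicator.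
  by case: eqP => [->|_]; rewrite ?mulr1 ?mulr0.
- rewrite -[RHS]rsingle; congr rsum; apply/funext => n; rewrite /indicator.
  by case: eqP => [->|_]; rewrite ?mulr1 ?mulr0.
Qed.

Lemma ell2_indicator x : ell2 (indicator R x).
Proof.
apply: (@ell2_bounded _ 1) => t ut; have [xt|xt] := boolP (x \in t).
  rewrite (bigD1_seq x)//= /indicator eqxx cabs1 expr1n big1 ?addr0// => n /negbTE ->.
  by rewrite cabs0 expr0n.
rewrite big_seq big1// => n nt; rewrite /indicator; case: eqP => [nx|_].
  by rewrite -nx nt in xt.
by rewrite cabs0 expr0n.
Qed.

Lemma normsq_indicator x : normsq (indicator R x) = 1.
Proof.
apply: (@complexI R); rewrite -dotp_self dotp_indicator; last exact: ell2_indicator.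
by rewrite /indicator eqxx conjc1.
Qed.

End SquareSummable.

(** * Orthogonal projection on finitely many vectors *)

Section OrthonormalProjection.
Variables (R : realType) (d : nat).
Local Notation C := R[i].
Local Notation "x %:C" := (real_complex R x) : ring_scope.
Local Notation ell2 := (@ell2 R d).
Variables (u : nat -> wave R d) (N : nat).
Hypothesis su : forall i, ell2 (u i).
Hypothesis ou : forall i j, (i < N)%N -> (j < N)%N -> dotp (u i) (u j) = (i == j)%:R.

Definition residual (f : wave R d) : wave R d :=
  fun n => f n - \sum_(k < N) dotp (u k) f * u k n.

Lemma ell2_combination (a : nat -> C) : ell2 (fun n => \sum_(k < N) a k * u k n).
Proof. by apply: ell2_sum => k; exact: ell2Z. Qed.

Lemma ell2_residual f : ell2 f -> ell2 (residual f).
Proof. by move=> sf; apply: ell2B => //; exact: (ell2_combination (fun k => dotp (u k) f)). Qed.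

Lemma dotp_combination f (a : nat -> C) : ell2 f ->
  dotp f (fun n => \sum_(k < N) a k * u k n) = \sum_(k < N) a k * dotp f (u k).
Proof.
move=> sf; rewrite dotp_sumr//; last by move=> k; exact: ell2Z.
by apply: eq_bigr => k _; rewrite dotpZr.
Qed.

Lemma dotp_residual f k : ell2 f -> (k < N)%N -> dotp (u k) (residual f) = 0.
Proof.
move=> sf kN; rewrite dotpBr//; last exact: (ell2_combination (fun k => dotp (u k) f)).
rewrite (dotp_combination (fun k => dotp (u k) f))// (bigD1 (Ordinal kN))//=.
rewrite ou// eqxx mulr1 big1 ?addr0 ?subrr// => j jk.
rewrite ou// (_ : (k == j :> nat) = false) ?mulr0//.
by apply: contraNF jk => /eqP kj; apply/eqP/val_inj.
Qed.

Lemma dotp_residual_combination f (a : nat -> C) : ell2 f ->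
  dotp (residual f) (fun n => \sum_(k < N) a k * u k n) = 0.
Proof.
move=> sf; rewrite (dotp_combination a); last exact: ell2_residual.
by rewrite big1// => k _; rewrite dotpC dotp_residual// conjc0 mulr0.
Qed.

Lemma normsq_combination (a : nat -> C) :
  normsq (fun n => \sum_(k < N) a k * u k n) = \sum_(k < N) cabs (a k) ^+ 2.
Proof.
apply: (@complexI R); rewrite -dotp_self (dotp_combination a); last exact: ell2_combination.
rewrite rmorph_sum; apply: eq_bigr => k _ /=.
rewrite cabs_sqrC dotpC (dotp_combination a)// (bigD1 k)//= ou// eqxx mulr1.
rewrite big1 ?addr0// => j jk; rewrite ou// (_ : (k == j :> nat) = false) ?mulr0//.
by apply: contraNF jk => /eqP kj; apply/eqP/val_inj.
Qed.

Lemma normsq_residual f : ell2 f ->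
  normsq (residual f) = normsq f - \sum_(k < N) cabs (dotp (u k) f) ^+ 2.
Proof.
move=> sf; have sr := ell2_residual sf.
have := normsqD_orthogonal sr (ell2_combination (fun k => dotp (u k) f))
  (dotp_residual_combination _ sf).
rewrite (normsq_combination (fun k => dotp (u k) f)).
rewrite (_ : (fun n => residual f n + _) = f); first by move=> ->; rewrite addrK.
by apply/funext => n; rewrite /residual subrK.
Qed.

Lemma normsq_residual_min f (a : nat -> C) : ell2 f ->
  normsq (residual f) <= normsq (fun n => f n - \sum_(k < N) a k * u k n).
Proof.
move=> sf; have sr := ell2_residual sf.
have sc := ell2_combination (fun k => dotp (u k) f - a k).
rewrite (_ : (fun n => f n - _) = fun n => residual f n +
    \sum_(k < N) (dotp (u k) f - a k) * u k n); last first.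
  apply/funext => n; rewrite /residual -addrA; congr (_ + _).
  have -> : \sum_(k < N) (dotp (u k) f - a k) * u k n =
      \sum_(k < N) dotp (u k) f * u k n - \sum_(k < N) a k * u k n.
    by rewrite -sumrB; apply: eq_bigr => k _; rewrite mulrBl.
  by rewrite addKr.
rewrite (normsqD_orthogonal sr sc) ?lerDl ?normsq_ge0//.
exact: (dotp_residual_combination (fun k => dotp (u k) f - a k) sf).
Qed.

End OrthonormalProjection.

(** * Orthonormal eigenbasis *)
Section Hamiltonian.
Variables (R : realType) (d : nat) (eps : R) (v : site d -> R) (M : R).
Local Notation C := R[i].
Local Notation "x %:C" := (real_complex R x) : ring_scope.
Local Notation ell2 := (@ell2 R d).
Local Notation H := (hamiltonian eps v).
Implicit Types (f g : wave R d).
Hypothesis vM : forall n, `|v n| <= M.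

Let shift_bij (a : site d) : bijective (fun n => n + a).
Proof. by exists (fun n => n - a) => n; rewrite ?addrK ?subrK. Qed.

Lemma ell2_shift f a : ell2 f -> ell2 (fun n => f (n + a)).
Proof. exact: (summable_bij (shift_bij a)). Qed.

Lemma dotp_shift f g a : dotp f (fun n => g (n + a)) = dotp (fun n => f (n - a)) g.
Proof.
rewrite /dotp -(csum_bij (fun n => (f (n - a))^*%C * g n) (shift_bij a)).
by congr csum; apply/funext => n /=; rewrite addrK.
Qed.

Lemma ell2_laplacian f : ell2 f -> ell2 (laplacian f).
Proof.
move=> sf; apply: ell2_sum => j.
by apply: ell2D; [exact: ell2_shift|exact: (ell2_shift (- unit_site j))].
Qed.

Lemma ell2_potential f : ell2 f -> ell2 (fun n => (v n)%:C * f n).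
Proof.
move=> sf; have M0 : 0 <= M := le_trans (normr_ge0 _) (vM 0).
apply: le_summable (ell2Z M%:C sf) => n.
rewrite !cabsM !cabs_real ler_pXn2r ?nnegrE ?mulr_ge0 ?cabs_ge0//.
by rewrite ler_wpM2r ?cabs_ge0// (ger0_norm M0).
Qed.

Lemma ell2_hamiltonian f : ell2 f -> ell2 (H f).
Proof.
by move=> sf; apply: ell2D; [apply: ell2Z; exact: ell2_laplacian|exact: ell2_potential].
Qed.

Lemma hamiltonian_sum (I : Type) (r : seq I) (a : I -> C) (F : I -> wave R d) n :
  H (fun m => \sum_(i <- r) a i * F i m) n = \sum_(i <- r) a i * H (F i) n.
Proof.
rewrite /hamiltonian /laplacian.
under [in RHS]eq_bigr do rewrite mulrDr.
rewrite [RHS]big_split/=; congr (_ + _); last first.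
  by rewrite mulr_sumr; apply: eq_bigr => i _; rewrite mulrCA.
under eq_bigr do rewrite -big_split/=.
rewrite exchange_big/= mulr_sumr; apply: eq_bigr => i _.
rewrite mulrCA; congr (_ * _); rewrite mulr_sumr; apply: eq_bigr => j _.
by rewrite mulrDr.
Qed.

Lemma hamiltonianD f g n : H (fun m => f m + g m) n = H f n + H g n.
Proof.
rewrite /hamiltonian /laplacian.
under eq_bigr do rewrite addrACA.
by rewrite big_split/= !mulrDr addrACA.
Qed.

Lemma hamiltonianZ c f n : H (fun m => c * f m) n = c * H f n.
Proof.
rewrite /hamiltonian /laplacian mulrDr; congr (_ + _); last exact: mulrCA.
rewrite mulrCA; congr (_ * _); rewrite mulr_sumr; apply: eq_bigr => j _.
by rewrite mulrDr.
Qed.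

Lemma dotp_hamiltonian f g : ell2 f -> ell2 g -> dotp f (H g) = dotp (H f) g.
Proof.
move=> sf sg.
have sLf := ell2_laplacian sf; have sLg := ell2_laplacian sg.
rewrite dotpDr//; [|exact: ell2Z|exact: ell2_potential].
rewrite dotpDl//; [|exact: ell2Z|exact: ell2_potential].
rewrite dotpZr// dotpZl// conjc_real; congr (_ * _ + _); last first.
  rewrite /dotp; congr csum; apply/funext => n.
  by rewrite rmorphM/= oppr0 mulrCA mulrA.
have sterm h j : ell2 h -> ell2 (fun n => h (n + unit_site j) + h (n - unit_site j)).
  by move=> sh; apply: ell2D; [exact: ell2_shift|exact: (ell2_shift (- unit_site j))].
rewrite dotp_sumr//; last by move=> j; exact: sterm.
rewrite dotp_suml//; last by move=> j; exact: sterm.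
apply: eq_bigr => j _.
have sfp := ell2_shift (unit_site j) sf; have sfm := ell2_shift (- unit_site j) sf.
have sgp := ell2_shift (unit_site j) sg; have sgm := ell2_shift (- unit_site j) sg.
rewrite dotpDr// dotpDl// (dotp_shift f g) (dotp_shift f g (- unit_site j)) addrC.
by congr (dotp _ g + _); apply/funext => n; rewrite opprK.
Qed.

Lemma eigenvectors_orthogonal f g (E E' : R) : ell2 f -> ell2 g ->
  (forall n, H f n = E%:C * f n) -> (forall n, H g n = E'%:C * g n) ->
  E != E' -> dotp f g = 0.
Proof.
move=> sf sg fE gE EE'; have := dotp_hamiltonian sf sg.
rewrite (_ : H g = fun n => E'%:C * g n); last exact/funext.
rewrite (_ : H f = fun n => E%:C * f n); last exact/funext.
rewrite dotpZr// dotpZl// conjc_real => h; apply/eqP.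
have /eqP : (E'%:C - E%:C) * dotp f g = 0 by rewrite mulrBl h subrr.
rewrite mulf_eq0 => /orP[|//]; rewrite subr_eq0 => /eqP/complexI h'.
by rewrite h' eqxx in EE'.
Qed.

End Hamiltonian.

(** * Gram-Schmidt among decaying eigenvectors *)

Section GramSchmidt.
Variables (R : realType) (d : nat) (eps : R) (v : site d -> R) (M : R).
Local Notation C := R[i].
Local Notation "x %:C" := (real_complex R x) : ring_scope.
Local Notation ell2 := (@ell2 R d).
Local Notation H := (hamiltonian eps v).
Hypothesis vM : forall n, `|v n| <= M.

Definition decaying (f : wave R d) :=
  exists B : R, forall n, cabs (f n) ^+ 2 <= B * (2 / 3) ^+ l1norm n.

Lemma decaying_ell2 f : decaying f -> ell2 f.
Proof.
move=> [B hB]; have [K K0 hK] := @lattice_sum_bounded d R (2 / 3) ltac:(lra).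
have B0 : 0 <= B.
  by have := hB 0; rewrite l1norm0 expr0 mulr1; apply: le_trans; rewrite sqr_ge0.
apply: (@ell2_bounded _ _ _ (B * K)) => t ut.
rewrite (@le_trans _ _ (\sum_(n <- t) B * (2 / 3) ^+ l1norm n))//.
  exact: ler_sum.
by rewrite -mulr_sumr ler_wpM2l// hK.
Qed.

Lemma decayingD f g : decaying f -> decaying g -> decaying (fun n => f n + g n).
Proof.
move=> [B hB] [B' hB']; exists (2 * B + 2 * B') => n.
apply: (le_trans (cabsD_sqr_le _ _)).
by have := hB n; have := hB' n; lra.
Qed.

Lemma decayingZ c f : decaying f -> decaying (fun n => c * f n).
Proof.
move=> [B hB]; exists (cabs c ^+ 2 * B) => n.
by rewrite cabsM exprMn -mulrA ler_wpM2l ?sqr_ge0.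
Qed.

Lemma decaying0 : decaying (fun=> 0).
Proof. by exists 0 => n; rewrite cabs0 expr0n mul0r. Qed.

Lemma decaying_sum (I : Type) (r : seq I) (F : I -> wave R d) :
  (forall i, decaying (F i)) -> decaying (fun n => \sum_(i <- r) F i n).
Proof.
move=> hF; elim: r => [|i r ih].
  rewrite (_ : (fun _ => _) = fun=> 0); first exact: decaying0.
  by apply/funext => n; rewrite big_nil.
rewrite (_ : (fun _ => _) = fun n => F i n + \sum_(j <- r) F j n); first exact: decayingD.
by apply/funext => n; rewrite big_cons.
Qed.

Lemma decaying_exp_decaying f : decaying f -> exp_decaying f.
Proof.
move=> [B hB].
have B0 : 0 <= B.
  by have := hB 0; rewrite l1norm0 expr0 mulr1; apply: le_trans; rewrite sqr_ge0.
have l0 : 0 < ln (3 / 2 : R) by rewrite ln_gt0//; lra.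
(* The rate satisfies exp(-2 c) = 2/3, and B <= (B + 1)^2 with B + 1 positive even when B = 0. *)
exists (B + 1), (ln (3 / 2) / 2); split; [lra|lra|move=> n].
rewrite site_normE; set m := l1norm n.
have e2 : expR (- (ln (3 / 2) / 2) * m%:R) ^+ 2 = (2 / 3) ^+ m :> R.
  rewrite -expRM_natr (_ : _ * 2%:R = - ln (3 / 2) * m%:R); last by field.
  rewrite expRM_natr expRN lnK ?posrE; last lra.
  by congr (_ ^+ _); field.
rewrite -(@ler_pXn2r _ 2) ?nnegrE ?cabs_ge0 ?mulr_ge0 ?expR_ge0//; last lra.
rewrite exprMn e2 (le_trans (hB n))// ler_wpM2r ?exprn_ge0 ?divr_ge0//.
by have := sqr_ge0 B; rewrite sqrrD; lra.
Qed.

Variables (w : nat -> wave R d) (E : nat -> R).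
Hypothesis w_decay : forall k, decaying (w k).
Hypothesis w_eigen : forall k n, H (w k) n = (E k)%:C * w k n.
Hypothesis w_dense : forall x tau, 0 < tau -> exists N (a : nat -> C),
  normsq (fun n => indicator R x n - \sum_(k < N) a k * w k n) <= tau.
Hypothesis d_gt0 : (0 < d)%N.

Let z0 : wave R d := fun=> 0.

(** A growing list, since a vector depending on the previous ones is dropped and positions no longer
    match stages. *)
Fixpoint schmidt_seq (n : nat) : seq (wave R d) :=
  if n is n'.+1 then
    let s := schmidt_seq n' in
    let r := residual (nth z0 s) (size s) (w n') in
    if normsq r == 0 then s
    else rcons s (fun m => (Num.sqrt (normsq r))^-1%:C * r m)
  else [::].

Let u n := nth z0 (schmidt_seq n).
Let sz n := size (schmidt_seq n).

Lemma schmidt_prefix n m i : (n <= m)%N -> (i < sz n)%N -> (i < sz m)%N /\ u m i = u n i.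
Proof.
elim: m => [|m ih]; first by rewrite leqn0 => /eqP ->.
rewrite leq_eqVlt => /orP[/eqP ->//|]; rewrite ltnS => /ih{}ih /ih[im umi].
rewrite /sz /u /=; case: ifP => // _.
by rewrite size_rcons nth_rcons (ltnW (n := (size _).+1))// im.
Qed.

Lemma schmidt_good n :
  (forall i, decaying (u n i) /\ exists e : R, forall m, H (u n i) m = e%:C * u n i m) /\
  (forall i j, (i < sz n)%N -> (j < sz n)%N -> dotp (u n i) (u n j) = (i == j)%:R).
Proof.
have H0 m : H z0 m = 0.
  by have := hamiltonianZ eps v 0 z0 m; rewrite mul0r => <-; congr (H _ m); apply/funext => k; rewrite mul0r.
elim: n => [|n [ih1 ih2]].
  split => // i; rewrite /u nth_nil; split; first exact: decaying0.
  by exists 0 => m; rewrite H0 mul0r.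
have su i : ell2 (u n i) by apply: decaying_ell2; have [] := ih1 i.
set r := residual (u n) (sz n) (w n).
have sw := decaying_ell2 (w_decay n).
have sr : ell2 r by exact: ell2_residual.
have dr : decaying r.
  rewrite (_ : r = fun m => w n m + -1 * \sum_(k < sz n) dotp (u n k) (w n) * u n k m).
    apply: decayingD => //; apply: decayingZ; apply: decaying_sum => k.
    by apply: decayingZ; have [] := ih1 k.
  by apply/funext => m; rewrite mulN1r.
have er m : H r m = (E n)%:C * r m.
  rewrite (_ : r = fun m => w n m + -1 * \sum_(k < sz n) dotp (u n k) (w n) * u n k m); last first.
    by apply/funext => k; rewrite mulN1r.
  rewrite hamiltonianD hamiltonianZ hamiltonian_sum w_eigen mulrDr; congr (_ + _).
  rewrite mulrCA; congr (_ * _); rewrite mulr_sumr; apply: eq_bigr => k _.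
  have [_ [e he]] := ih1 k; rewrite he.
  have [->|eE] := eqVneq e (E n); first by rewrite mulrCA.
  by rewrite (eigenvectors_orthogonal vM (su k) sw he (w_eigen n) eE) !mul0r mulr0.
have sE : schmidt_seq n.+1 = if normsq r == 0 then schmidt_seq n
    else rcons (schmidt_seq n) (fun m => (Num.sqrt (normsq r))^-1%:C * r m) by [].
rewrite /u /sz sE; case: eqP => [//|/eqP r0].
set c := (Num.sqrt (normsq r))^-1.
have uE i : nth z0 (rcons (schmidt_seq n) (fun m => c%:C * r m)) i =
    if (i == sz n) then (fun m => c%:C * r m) else u n i.
  rewrite nth_rcons -/(sz n); case: ltngtP => // h.
  by rewrite /u nth_default// ltnW.
have rp : 0 < normsq r by rewrite lt_def r0 normsq_ge0.
have newr k : (k < sz n)%N -> dotp (u n k) (fun m => c%:C * r m) = 0.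
  by move=> kn; rewrite dotpZr// dotp_residual// mulr0.
split=> [i|i j].
  rewrite uE; case: eqP => _; last exact: ih1.
  split; first exact: decayingZ.
  by exists (E n) => m; rewrite hamiltonianZ er mulrCA.
rewrite size_rcons !ltnS !uE -/(sz n) => iN jN.
have [ie|ie] := eqVneq i (sz n); have [je|je] := eqVneq j (sz n).
- rewrite ie je eqxx dotp_self normsqZ// cabs_real real_normK ?num_real//.
  by rewrite /c exprVn sqr_sqrtr ?normsq_ge0// mulVf.
- have jN' : (j < sz n)%N by rewrite ltn_neqAle je.
  by rewrite dotpC newr// conjc0 ie eq_sym (negbTE je).
- have iN' : (i < sz n)%N by rewrite ltn_neqAle ie.
  by rewrite newr// je (negbTE ie).
- by apply: ih2; rewrite ltn_neqAle ?ie ?je.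
Qed.

Lemma schmidt_ell2 n i : ell2 (u n i).
Proof. by apply: decaying_ell2; have [+ _] := schmidt_good n; move=> /(_ i)[]. Qed.

Lemma schmidt_orthonormal n i j : (i < sz n)%N -> (j < sz n)%N ->
  dotp (u n i) (u n j) = (i == j)%:R.
Proof. by have [_] := schmidt_good n; apply. Qed.

Lemma schmidt_span k n : (k < n)%N -> exists a : nat -> C,
  w k = fun m => \sum_(i < sz n) a i * u n i m.
Proof.
elim: n => // n ih; rewrite ltnS => kn.
set r := residual (u n) (sz n) (w n).
have sE : schmidt_seq n.+1 = if normsq r == 0 then schmidt_seq n
    else rcons (schmidt_seq n) (fun m => (Num.sqrt (normsq r))^-1%:C * r m) by [].
have rE m : w n m = \sum_(i < sz n) dotp (u n i) (w n) * u n i m + r m.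
  by rewrite /r /residual addrC subrK.
have sr : ell2 r.
  by apply: ell2_residual; [exact: schmidt_ell2|exact: decaying_ell2].
rewrite /u /sz sE; case: eqP => [r0|/eqP r0].
  move: kn; rewrite leq_eqVlt => /orP[/eqP ->|/ih//].
  exists (fun i => dotp (u n i) (w n)); apply/funext => m.
  by rewrite {1}rE (normsq_eq0 sr r0) addr0.
set c := (Num.sqrt (normsq r))^-1.
have c0 : c%:C != 0 :> C.
  rewrite -cabs_gt0 cabs_real normr_gt0 invr_eq0 gt_eqF// sqrtr_gt0.
  by rewrite lt_def r0 normsq_ge0.
have ext (a : nat -> C) (t : C) m :
    \sum_(i < (sz n).+1) (if (i < sz n)%N then a i else t) *
      nth z0 (rcons (schmidt_seq n) (fun m => c%:C * r m)) i m =
    \sum_(i < sz n) a i * u n i m + t * (c%:C * r m).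
  rewrite big_ord_recr/= ltnn nth_rcons ltnn eqxx; congr (_ + _).
  by apply: eq_bigr => i _; rewrite ltn_ord nth_rcons -/(sz n) ltn_ord.
rewrite size_rcons -/(sz n).
move: kn; rewrite leq_eqVlt => /orP[/eqP ->|/ih[a wk]].
  exists (fun i => if (i < sz n)%N then dotp (u n i) (w n) else c%:C^-1).
  apply/funext => m; rewrite (ext (fun i => dotp (u n i) (w n)) c%:C^-1 m).
  by rewrite mulrA mulVf// mul1r -rE.
exists (fun i => if (i < sz n)%N then a i else 0); apply/funext => m.
by rewrite (ext a 0 m) mul0r addr0 wk.
Qed.

Lemma schmidt_dense x tau : 0 < tau -> exists n,
  normsq (residual (u n) (sz n) (indicator R x)) <= tau.
Proof.
move=> tau0; have [N [a ha]] := w_dense x tau0; exists N.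
have exb (k : 'I_N) : exists b : nat -> C, w k = fun m => \sum_(i < sz N) b i * u N i m.
  exact: schmidt_span.
have [b hb] := choice exb.
apply: le_trans ha.
rewrite (_ : (fun n => _ - _) = fun n => indicator R x n -
    \sum_(i < sz N) (\sum_(k < N) a k * b k i) * u N i n); last first.
  apply/funext => n; congr (_ - _).
  under eq_bigr do rewrite hb mulr_sumr.
  rewrite exchange_big/=; apply: eq_bigr => i _; rewrite mulr_suml.
  by apply: eq_bigr => k _; rewrite mulrA.
apply: (normsq_residual_min (schmidt_ell2 N) (@schmidt_orthonormal N)
  (fun i => \sum_(k < N) a k * b k i)).
exact: ell2_indicator.
Qed.

Lemma schmidt_residual_anti n m f : (n <= m)%N -> ell2 f ->
  normsq (residual (u m) (sz m) f) <= normsq (residual (u n) (sz n) f).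
Proof.
move=> nm sf; rewrite !normsq_residual//; try exact: schmidt_ell2; try exact: schmidt_orthonormal.
rewrite lerD2l lerN2.
have szle : (sz n <= sz m)%N.
  have [->//|n0] := posnP (sz n).
  have h : ((sz n).-1 < sz n)%N by rewrite prednK.
  by have [+ _] := schmidt_prefix nm h; rewrite prednK.
rewrite -(big_mkord xpredT (fun k => cabs (dotp (u m k) f) ^+ 2)).
rewrite (big_cat_nat (leq0n _) szle)/= big_mkord.
have -> : \sum_(k < sz n) cabs (dotp (u m k) f) ^+ 2 =
    \sum_(k < sz n) cabs (dotp (u n k) f) ^+ 2.
  by apply: eq_bigr => k _; have [_ ->] := schmidt_prefix nm (ltn_ord k).
by rewrite lerDl sumr_ge0// => k _; rewrite sqr_ge0.
Qed.

(** A basis indexed by [nat] needs infinitely many vectors. If the lists had at most K entries, K +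
    1 site indicators would lie within squared distance tau of their span; summing the |u_i(x)|^2
    over these sites and over i gives (K + 1) (1 - tau) <= K, which tau = 1 / (2 (K + 1))
    excludes. *)
Lemma schmidt_unbounded K : exists n, (K < sz n)%N.
Proof.
apply: contrapT => /forallNP hK.
have {}hK n : (sz n <= K)%N by rewrite leqNgt; apply/negP.
pose x0 (k : nat) : site d := \row_j k%:Z.
have x0_inj : injective x0.
  move=> k l /matrixP/(_ ord0 (Ordinal d_gt0)); rewrite !mxE.
  by move=> /eqP; rewrite eqz_nat => /eqP.
pose t := [seq x0 k | k <- iota 0 K.+1].
have ut : uniq t by rewrite map_inj_uniq// iota_uniq.
pose tau : R := (2 * K.+1%:R)^-1.
have tau0 : 0 < tau by rewrite invr_gt0 mulr_gt0.
have [n hn] : exists n, forall x, x \in t ->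
    normsq (residual (u n) (sz n) (indicator R x)) <= tau.
  elim: (t) => [|x t' [n hn]]; first by exists 0%N.
  have [m hm] := schmidt_dense x tau0; exists (maxn n m) => y.
  rewrite in_cons => /predU1P[->|/hn yn].
    by apply: le_trans hm; apply: schmidt_residual_anti; [exact: leq_maxr|exact: ell2_indicator].
  by apply: le_trans yn; apply: schmidt_residual_anti; [exact: leq_maxl|exact: ell2_indicator].
have : \sum_(x <- t) (1 - tau) <= K%:R.
  rewrite (@le_trans _ _ (\sum_(x <- t) \sum_(i < sz n) cabs (u n i x) ^+ 2))//.
    rewrite big_seq [leRHS]big_seq; apply: ler_sum => x /hn.
    rewrite normsq_residual; [|exact: schmidt_ell2|exact: schmidt_orthonormal|exact: ell2_indicator].
    rewrite normsq_indicator lerBlDr => h; rewrite lerBlDr addrC (le_trans h)// lerD2l.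
    apply: ler_sum => i _; rewrite dotp_indicator ?cabs_conj//; exact: schmidt_ell2.
  rewrite exchange_big/= (@le_trans _ _ (\sum_(i < sz n) 1))//; last first.
    by rewrite sumr_const card_ord ler_nat.
  apply: ler_sum => i _; have sui := schmidt_ell2 n i.
  have <- : normsq (u n i) = 1.
    by apply: (@complexI R); rewrite -dotp_self schmidt_orthonormal// eqxx.
  by apply: sum_le_nnsum => // k; rewrite sqr_ge0.
have -> : \sum_(x <- t) (1 - tau) = K.+1%:R * (1 - tau).
  by rewrite big_const_seq count_predT size_map size_iota iter_addr_0 mulr_natl.
have half : K.+1%:R * tau = 2^-1 :> R by rewrite /tau; field; rewrite nat1r.
by rewrite mulrBr mulr1 half -natr1; lra.
Qed.

Lemma orthonormal_eigenbasis_exists : exists psi : nat -> wave R d,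
  [/\ forall k, decaying (psi k),
      forall k, exists e : R, forall n, H (psi k) n = e%:C * psi k n,
      forall k l, dotp (psi k) (psi l) = (k == l)%:R &
      forall f, ell2 f -> forall tau, 0 < tau -> exists N0, forall N, (N0 <= N)%N ->
        normsq (residual psi N f) <= tau].
Proof.
have [nk hnk] := choice schmidt_unbounded.
(* Stage [nk k] has more than k vectors, and entry k never changes afterwards. *)
pose psi k := u (nk k) k.
have psiE n k : (k < sz n)%N -> psi k = u n k.
  move=> kn; rewrite /psi; have [_ <-] := schmidt_prefix (leq_maxl n (nk k)) kn.
  by have [_ <-] := schmidt_prefix (leq_maxr n (nk k)) (hnk k).
have good k := (schmidt_good (nk k)).1 k.
have ON k l : dotp (psi k) (psi l) = (k == l)%:R.
  have [kn ek] := schmidt_prefix (leq_maxl (nk k) (nk l)) (hnk k).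
  have [ln el] := schmidt_prefix (leq_maxr (nk k) (nk l)) (hnk l).
  by rewrite /psi -ek -el schmidt_orthonormal.
have spsi k : ell2 (psi k) by exact: schmidt_ell2.
exists psi; split => //; first by move=> k; have [] := good k.
  by move=> k; have [] := good k.
have anti N N' f : ell2 f -> (N <= N')%N ->
    normsq (residual psi N' f) <= normsq (residual psi N f).
  move=> sf NN'; rewrite !normsq_residual// lerD2l lerN2.
  rewrite -(big_mkord xpredT (fun k => cabs (dotp (psi k) f) ^+ 2)).
  rewrite -[leRHS](big_mkord xpredT (fun k => cabs (dotp (psi k) f) ^+ 2)).
  rewrite (big_cat_nat (leq0n _) NN')/= lerDl sumr_ge0// => k _.
  by rewrite sqr_ge0.
have dense x tau : 0 < tau -> exists N0, forall N, (N0 <= N)%N ->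
    normsq (residual psi N (indicator R x)) <= tau.
  move=> tau0; have [n hn] := schmidt_dense x tau0; exists (sz n) => N nN.
  apply: le_trans (anti _ _ _ (ell2_indicator R x) nN) _.
  apply: le_trans hn; rewrite le_eqVlt; apply/orP; left; apply/eqP; congr normsq.
  apply/funext => m; rewrite /residual; congr (_ - _); apply: eq_bigr => k _.
  by rewrite (psiE n).
move=> f sf tau tau0.
have tau4 : 0 < tau / 4 by rewrite divr_gt0.
(* From indicators to all of l^2: the projection is at least as close to [f] as the combination of
   projected indicators over [t]. That error is the tail of [f] plus finitely many small residuals,
   each of squared norm at most tau / 4, and [normsqD_le] doubles both. *)
have [t ut ht] := nnsum_tail (fun n => sqr_ge0 (cabs (f n))) sf tau4.
pose S N : wave R d := fun n => \sum_(x <- t) f x * residual psi N (indicator R x) n.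
have sres N x : ell2 (residual psi N (indicator R x)).
  by apply: ell2_residual => //; exact: ell2_indicator.
have small : forall s : seq (site d), forall tau', 0 < tau' -> exists N0, forall N, (N0 <= N)%N ->
    normsq (fun n => \sum_(x <- s) f x * residual psi N (indicator R x) n) <= tau'.
  elim=> [|x s ih] tau' tau'0.
    exists 0%N => N _; rewrite (_ : (fun _ => _) = fun=> 0).
      by apply: normsq_le => t' _; rewrite big1 ?ltW// => n _; rewrite cabs0 expr0n.
    by apply/funext => n; rewrite big_nil.
  have t1 : 0 < tau' / 4 by rewrite divr_gt0.
  have fx0 : 0 <= cabs (f x) ^+ 2 by rewrite sqr_ge0.
  have t2 : 0 < tau' / 4 / (cabs (f x) ^+ 2 + 1) by rewrite divr_gt0// ltr_wpDl.
  have [N1 h1] := ih _ t1; have [N2 h2] := dense x _ t2.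
  exists (maxn N1 N2) => N; rewrite geq_max => /andP[/h1{}h1 /h2{}h2].
  have sZ : ell2 (fun n => f x * residual psi N (indicator R x) n) by exact: ell2Z.
  have sS : ell2 (fun n => \sum_(j <- s) f j * residual psi N (indicator R j) n).
    by apply: ell2_sum => j; exact: ell2Z.
  rewrite (_ : (fun _ => _) = fun n => f x * residual psi N (indicator R x) n +
      \sum_(j <- s) f j * residual psi N (indicator R j) n); last first.
    by apply/funext => n; rewrite big_cons.
  apply: (le_trans (normsqD_le sZ sS)); rewrite normsqZ//.
  have : cabs (f x) ^+ 2 * normsq (residual psi N (indicator R x)) <= tau' / 4.
    rewrite ler_pdivlMr ?ltr_wpDl// in h2.
    have r0 := normsq_ge0 (residual psi N (indicator R x)).
    by rewrite mulrDr mulr1 mulrC in h2; lra.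
  by move: h1; lra.
have [N0 hN0] := small t _ tau4.
exists N0 => N /hN0 hN.
pose tail : wave R d := fun n => if n \in t then 0 else f n.
have stail : ell2 tail.
  by apply: le_summable sf => n; rewrite /tail; case: ifP; rewrite ?cabs0 ?expr0n ?sqr_ge0.
have ntail : normsq tail <= tau / 4.
  apply: le_trans ht; rewrite le_eqVlt; apply/orP; left; apply/eqP; apply: eq_nnsum => n.
  by rewrite /tail; case: ifP; rewrite ?cabs0 ?expr0n.
have sS : ell2 (S N) by apply: ell2_sum => x; exact: ell2Z.
apply: (@le_trans _ _ (normsq (fun n => f n -
    \sum_(k < N) (\sum_(x <- t) f x * dotp (psi k) (indicator R x)) * psi k n))).
  exact: (normsq_residual_min spsi (fun i j _ _ => ON i j)
    (fun k => \sum_(x <- t) f x * dotp (psi k) (indicator R x)) sf).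
rewrite (_ : (fun n => f n - _) = fun n => tail n + S N n); last first.
  apply/funext => n; rewrite /S /residual.
  under [in RHS]eq_bigr do rewrite mulrBr.
  rewrite sumrB addrA; congr (_ - _).
    have [nt|nt] := boolP (n \in t).
      rewrite /tail nt add0r (bigD1_seq n)//= /indicator eqxx mulr1 big1 ?addr0// => x /negbTE xn.
      by rewrite eq_sym xn mulr0.
    rewrite /tail (negbTE nt) big_seq big1 ?addr0// => x xt; rewrite /indicator.
    by case: eqP => [nx|_]; [rewrite nx xt in nt|rewrite mulr0].
  under eq_bigr do rewrite mulr_suml.
  rewrite exchange_big/=; apply: eq_bigr => x _; rewrite mulr_sumr.
  by apply: eq_bigr => k _; rewrite mulrA.
apply: (le_trans (normsqD_le stail sS)); move: ntail hN; rewrite -/(S N); lra.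
Qed.

End GramSchmidt.

(** * Point masses and moments *)
Section PointMasses.
Variables (R : realType) (a e : nat -> R) (A B : R).
Hypotheses (a0 : forall k, 0 <= a k) (eB : forall k, `|e k| <= B).
Hypothesis aA : forall N : nat, \sum_(k < N) a k <= A.
Local Notation T := (measurableTypeR R).

Let mass k : {measure set T -> \bar R} := mscale (NngNum (a0 k)) (dirac (e k : T)).
Local Notation point_masses := (mseries mass 0).

Lemma integral_point_masses (g : T -> R) (G : R) : measurable_fun setT g ->
  (forall x, 0 <= g x) -> (forall k, g (e k) <= G) ->
  exists2 I : R, (\int[point_masses]_x (g x)%:E = I%:E)%E &
    (fun N : nat => \sum_(k < N) a k * g (e k)) @ \oo --> I.
Proof.
move=> mg g0 gG; set u := fun N : nat => \sum_(k < N) a k * g (e k).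
have ag0 k : 0 <= a k * g (e k) by rewrite mulr_ge0.
have cu : cvgn u.
  apply: nondecreasing_is_cvgn.
    by apply/nondecreasing_seqP => n; rewrite /u big_ord_recr/= lerDl.
  exists (A * G) => _ [N _ <-]; have G0 : 0 <= G := le_trans (g0 _) (gG 0%N).
  apply: le_trans (ler_wpM2r G0 (aA N)); rewrite mulr_suml.
  by apply: ler_sum => k _; rewrite ler_wpM2l.
exists (limn u); last exact: cu.
have mg' : measurable_fun setT (EFin \o g) by exact/measurable_EFinP.
rewrite ge0_integral_measure_series//; last by move=> t _; rewrite lee_fin.
rewrite -EFin_lim//; congr (limn _); apply/funext => N.
rewrite /u /= -sumEFin big_mkord; apply: eq_bigr => k _.
rewrite ge0_integral_mscale//; last by move=> t _; rewrite lee_fin.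
by rewrite integral_dirac// diracT mul1e.
Qed.

Lemma point_masses_null (S : set T) : measurable S -> (forall k, ~ S (e k)) ->
  point_masses S = 0%E.
Proof.
move=> mS Se; rewrite /mseries eseries0// => k _ _.
by rewrite /mass /= /mscale /= diracE memNset ?mule0.
Qed.

Lemma point_masses_finite : fin_num_fun point_masses.
Proof.
move=> S mS; have [I IE _] := @integral_point_masses (fun=> 1) 1
  (measurable_cst _) (fun=> ler01) (fun=> lexx _).
rewrite ge0_fin_numE ?measure_ge0//.
have : (point_masses S <= point_masses setT)%E by apply: le_measure; rewrite ?inE.
move: IE; rewrite integral_cst// mul1e => IE; move/le_lt_trans; apply.
by have -> : point_masses setT = I%:E by []; rewrite ltry.
Qed.

(** Odd powers change sign, so a moment is computed as the difference of two convergent series of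
    nonnegative terms and then identified with the given limit [L]. *)
Lemma point_masses_exist : exists m : {finite_measure set T -> \bar R},
  [/\ m (~` `[- B, B]) = 0%E, pure_point_measure m &
    forall j L, (fun N : nat => \sum_(k < N) a k * e k ^+ j) @ \oo --> L ->
      \int[m]_x (x ^+ j) = L].
Proof.
pose fm := Measure_isFinite.Build _ _ _ _ point_masses_finite.
pose m : {finite_measure set T -> \bar R} := HB.pack point_masses fm.
exists m; split.
- apply: point_masses_null; first exact: measurableC.
  by move=> k /=; rewrite in_itv/= -ler_norml; apply.
- exists (range e); first exact: card_image_le.
  apply: point_masses_null; last by move=> k; apply; exists k.
  apply: measurableC; rewrite (_ : range e = \bigcup_k [set e k]).
    by apply: bigcup_measurable => k _; exact: measurable_set1.
  by apply/seteqP; split=> [_ [k _ <-]|x [k _ ->]]; exists k.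
move=> j L hL; pose f := fun x : T => (x ^+ j : R).
have mf : measurable_fun setT f by exact: exprn_measurable.
pose gp x := Num.max (f x) 0; pose gn x := Num.max (- f x) 0.
have feB k : `|f (e k)| <= B ^+ j.
  by rewrite /f normrX lerXn2r ?nnegrE ?normr_ge0 ?eB// (le_trans (normr_ge0 _) (eB 0)).
have [Ip IpE cp] := @integral_point_masses gp (B ^+ j)
  (measurable_maxr mf (measurable_cst _)) ltac:(by move=> x; rewrite le_max lexx orbT)
  ltac:(move=> k; rewrite ge_max (le_trans (ler_norm _) (feB k)) (le_trans (normr_ge0 _) (feB k))//).
have mNf : measurable_fun setT (fun x => - f x) by apply: measurableT_comp.
have [In InE cn] := @integral_point_masses gn (B ^+ j)
  (measurable_maxr mNf (measurable_cst _)) ltac:(by move=> x; rewrite le_max lexx orbT)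
  ltac:(move=> k; rewrite ge_max (le_trans (ler_norm _)) ?normrN ?feB// (le_trans (normr_ge0 _) (feB k))//).
have -> : L = Ip - In.
  apply: (cvg_unique _ hL) => //.
  suff <- : (fun N : nat => \sum_(k < N) a k * gp (e k)) \-
      (fun N : nat => \sum_(k < N) a k * gn (e k)) =
      (fun N : nat => \sum_(k < N) a k * e k ^+ j) by exact: cvgB.
  apply/funext => N /=; rewrite -sumrB; apply: eq_bigr => k _; rewrite -mulrBr; congr (_ * _).
  rewrite /gp /gn /f; have /orP[h|h] := le_total 0 (e k ^+ j).
    by rewrite (max_l h) max_r ?oppr_le0// subr0.
  by rewrite (max_r h) max_l ?oppr_ge0// sub0r opprK.
rewrite /Rintegral integralE.
have -> : ((fun x : T => (x ^+ j)%:E)^\+)%E = (fun x => (gp x)%:E).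
  by apply/funext => x; rewrite funeposE EFin_max.
have -> : ((fun x : T => (x ^+ j)%:E)^\-)%E = (fun x => (gn x)%:E).
  by apply/funext => x; rewrite funenegE EFin_max.
by rewrite [X in fine (X - _)]IpE [X in fine (_ - X)]InE.
Qed.

End PointMasses.

(** * Detecting an atom from moments *)

Section Peak.
Variables (R : realType) (M E : R).
Hypothesis EM : E \in `[- M, M].

(* Its powers decrease on [-M, M] to the indicator of {E}. *)
Definition peak : {poly R} := 1 - ((2 * M) ^- 2) *: ('X - E%:P) ^+ 2.

Lemma horner_peak x : peak.[x] = 1 - ((x - E) / (2 * M)) ^+ 2.
Proof. by rewrite /peak !(hornerD, hornerN, hornerZ, horner_exp, hornerX, hornerC) expr_div_n mulrC. Qed.

Lemma peak_center : peak.[E] = 1.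
Proof. by rewrite horner_peak subrr mul0r expr0n subr0. Qed.

Lemma peak_itv x : x \in `[- M, M] ->
  [/\ 0 <= peak.[x], peak.[x] <= 1 & x != E -> peak.[x] < 1].
Proof.
rewrite horner_peak in_itv/= => /andP[x1 x2]; move: EM; rewrite in_itv/= => /andP[E1 E2].
have [M00|Mp] := eqVneq M 0.
  have -> : x = E by lra.
  by rewrite subrr mul0r expr0n subr0 eqxx.
have {}Mp : 0 < 2 * M by rewrite mulr_gt0// lt_neqAle eq_sym Mp; lra.
rewrite subr_ge0 -real_normK ?num_real//; split.
- rewrite expr_le1// normrM normfV ler_pdivrMr ?mul1r ?normr_gt0 ?gt_eqF// (gtr0_norm Mp) ler_norml.
  by apply/andP; split; lra.
- by rewrite gerBl exprn_ge0.
- move=> xE; rewrite gtrBl exprn_gt0// normr_gt0 mulf_neq0 ?subr_eq0//.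
  by rewrite invr_eq0 gt_eqF.
Qed.

End Peak.

Section Moments.
Variables (R : realType) (m : {finite_measure set (measurableTypeR R) -> \bar R}) (M : R).
Hypothesis m_bounded : m (~` `[- M, M]) = 0%E.
Local Notation T := (measurableTypeR R).
Let D : set T := `[- M, M].
Let mD : measurable D. Proof. exact: measurable_itv. Qed.
Let mDC : measurable (~` D). Proof. exact: measurableC. Qed.

Lemma integrable_horner (p : {poly R}) : m.-integrable D (fun x => (p.[x])%:E).
Proof.
apply: (@measurable_bounded_integrable _ _ _ _ (fun x : T => p.[x])) => //.
- by rewrite -ge0_fin_numE ?measure_ge0//; exact: fin_num_measure.
- by apply: measurable_funTS; apply: continuous_measurable_fun; exact: continuous_horner.
- have : compact (horner p @` `[- M, M]).
    apply: continuous_compact; last exact: segment_compact.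
    by apply: continuous_subspaceT; exact: continuous_horner.
  move=> /compact_bounded[N [Nr hN]]; exists N; split=> // y Ny x Dx /=.
  by apply: hN => //; exists x.
Qed.

Lemma Rintegral_bounded_support (f : T -> R) : measurable_fun setT f ->
  \int[m]_x f x = \int[m]_(x in D) f x.
Proof.
move=> mf; rewrite /Rintegral; congr fine; rewrite integralE [RHS]integralE.
have mf' : measurable_fun setT (EFin \o f) by exact/measurable_EFinP.
have DE : setT `\` ~` D = D by rewrite setTD setCK.
by congr (_ - _)%E;
  rewrite (@ge0_negligible_integral _ _ _ m setT (~` D))// ?DE//;
  [exact: measurable_funepos|exact: measurable_funeneg].
Qed.

(** The left side involves moments only, which is all that [spectral_measure] provides. *)
Lemma sum_moments (p : {poly R}) :
  \sum_(i < size p) p`_i * \int[m]_x (x ^+ i) = \int[m]_(x in D) p.[x].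
Proof.
under [RHS]eq_Rintegral => x _ do rewrite horner_coef.
rewrite /Rintegral; under [in RHS]eq_integral do rewrite -sumEFin.
rewrite integral_sum//; last first.
  move=> i; have := integrable_horner (p`_i *: 'X^i).
  by under [fun x => _]eq_fun do rewrite hornerZ hornerXn.
rewrite -sum_fine//; last first.
  move=> i _; apply: integrable_fin_num => //; have := integrable_horner (p`_i *: 'X^i).
  by under [fun x => _]eq_fun do rewrite hornerZ hornerXn.
apply: eq_bigr => i _; transitivity (p`_i * \int[m]_(x in D) (x ^+ i)).
  by congr (_ * _); apply: Rintegral_bounded_support; exact: exprn_measurable.
rewrite -RintegralZl//; have := integrable_horner 'X^i.
by under [fun x => _]eq_fun do rewrite hornerXn.
Qed.

Lemma moments_peak_cvg (E : R) : E \in `[- M, M] -> m [set E] = 0%E ->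
  (fun n => \sum_(i < size (peak M E ^+ n)) (peak M E ^+ n)`_i * \int[m]_x (x ^+ i))
    @ \oo --> (0 : R).
Proof.
move=> EM mE; set q := peak M E.
have q01 x : D x -> [/\ 0 <= q.[x] , q.[x] <= 1 & (x != E -> q.[x] < 1)] by exact: peak_itv.
have := @dominated_cvg _ _ _ m D mD (fun n x => ((q ^+ n).[x])%:E)
  (fun x => (\1_[set E] x)%:E) (fun=> 1%E).
have mq n : measurable_fun D (fun x : T => ((q ^+ n).[x])%:E).
  by have /integrableP[] := integrable_horner (q ^+ n).
move=> /(_ mq); have lim x : D x -> (fun n => ((q ^+ n).[x])%:E) @ \oo --> (\1_[set E] x)%:E.
  move=> Dx; have [q0 q1 q2] := q01 x Dx; apply/cvg_EFin; first by near=> n.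
  rewrite indicE; case: (eqVneq x E) => [->|xE].
    rewrite mem_set//; apply: cvg_near_cst; apply: nearW => n /=.
    by rewrite horner_exp peak_center expr1n.
  rewrite memNset//; last by move=> /= xE'; rewrite xE' eqxx in xE.
  have := @cvg_geometric R 1 q.[x]; rewrite ger0_norm// => /(_ (q2 xE)).
  by apply: cvg_trans; apply: near_eq_cvg; near=> n; rewrite /= mul1r horner_exp.
have i1 : m.-integrable D (fun=> 1%E).
  by have := integrable_horner 1; under [fun x => _]eq_fun do rewrite hornerC.
move=> /(_ lim (fun _ _ => isT) i1); have dom n x : D x -> (`|(((q ^+ n).[x])%:E : \bar R)| <= 1%E)%E.
  move=> Dx; have [q0 q1 _] := q01 x Dx.
  by rewrite /= lee_fin horner_exp ger0_norm ?exprn_ge0// exprn_ile1.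
move=> /(_ dom); rewrite integral_indic// => h.
have m0 : m ([set E] `&` D) = 0%E.
  by apply/eqP; rewrite eq_le measure_ge0 andbT -mE le_measure ?inE//; exact: measurableI.
have /fine_cvg : (fun n => \int[m]_(x in D) ((q ^+ n).[x])%:E)%E @ \oo --> (0%:E : \bar R).
  by rewrite -[0%:E]m0; exact: h.
apply: cvg_trans; apply: near_eq_cvg; near=> n.
by rewrite /= sum_moments.
Unshelve. all: by end_near.
Qed.

End Moments.

(** * Spectral types *)
Section SpectralTypes.
Variables (R : realType) (d : nat) (eps : R) (v : site d -> R) (M : R).
Local Notation C := R[i].
Local Notation "x %:C" := (real_complex R x) : ring_scope.
Local Notation ell2 := (@ell2 R d).
Local Notation H := (hamiltonian eps v).
Hypothesis vM : forall n, `|v n| <= M.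
Variables (psi : nat -> wave R d) (e : nat -> R).
Hypothesis psi_ell2 : forall k, ell2 (psi k).
Hypothesis psi_eigen : forall k n, H (psi k) n = (e k)%:C * psi k n.
Hypothesis psi_orthonormal : forall k l, dotp (psi k) (psi l) = (k == l)%:R.
Hypothesis psi_complete : forall f, ell2 f -> forall tau, 0 < tau ->
  exists N0, forall N, (N0 <= N)%N -> normsq (residual psi N f) <= tau.

Let opb := eps ^+ 2 * (2 * d)%:R + M.

Lemma normsq_psi k : normsq (psi k) = 1.
Proof. by apply: (@complexI R); rewrite -dotp_self psi_orthonormal eqxx. Qed.

Lemma psi_neq0 k : exists n, psi k n != 0.
Proof.
apply: contrapT => h; have p0 : psi k = fun=> 0.
  by apply/funext => n; apply/eqP/negPn/negP => pn; apply: h; exists n.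
have := normsq_psi k; rewrite p0 /normsq => /eqP; rewrite eq_le => /andP[_].
rewrite leNgt => /negP; apply; rewrite (@le_lt_trans _ _ 0)//; apply: nnsum_le => [n|t _].
  exact: sqr_ge0.
by rewrite big1// => n _; rewrite cabs0 expr0n.
Qed.

Lemma hamiltonian_le (f : wave R d) (S : R) : (forall n, cabs (f n) <= S) ->
  forall n, cabs (H f n) <= opb * S.
Proof.
move=> fS n; have S0 : 0 <= S := le_trans (cabs_ge0 _) (fS 0).
rewrite /hamiltonian (le_trans (cabsD _ _))// !cabsM !cabs_real mulrDl lerD//; last first.
  by rewrite ler_pM// cabs_ge0.
rewrite ger0_norm ?sqr_ge0// -mulrA ler_wpM2l ?sqr_ge0// (le_trans (cabs_sum _ _ _))//.
apply: (@le_trans _ _ (\sum_(j < d) (2 * S))).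
  by apply: ler_sum => j _; rewrite (le_trans (cabsD _ _))// mulr_natl mulr2n lerD.
by rewrite sumr_const card_ord natrM mulrAC [leRHS]mulr_natr.
Qed.

(* Compare the supremum of |psi k| with that of |H (psi k)|. *)
Lemma eigenvalue_le k : `|e k| <= opb.
Proof.
rewrite leNgt; apply/negP => ek; pose X := range (fun n => cabs (psi k n)).
have X1 : has_ubound X.
  exists 1 => _ [n _ <-]; rewrite -(@ler_pXn2r _ 2)// ?nnegrE ?cabs_ge0// expr1n.
  by rewrite -(normsq_psi k); exact: cabs_sqr_le_normsq.
have leS n : cabs (psi k n) <= sup X by apply: ub_le_sup => //; exists n.
have [n0 n0P] := psi_neq0 k.
have S0 : 0 < sup X by apply: lt_le_trans (leS n0); rewrite cabs_gt0.
have b0 : 0 <= opb.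
  have := hamiltonian_le leS n0; rewrite -(pmulr_lge0 _ S0); exact/le_trans/cabs_ge0.
have e0 : 0 < `|e k| := le_lt_trans b0 ek.
have : sup X <= opb * sup X / `|e k|.
  apply: ge_sup; first by exists (cabs (psi k n0)); exists n0.
  move=> _ [n _ <-]; rewrite ler_pdivlMr// mulrC.
  by have := hamiltonian_le leS n; rewrite psi_eigen cabsM cabs_real.
by rewrite ler_pdivlMr// mulrC ler_pM2r// leNgt ek.
Qed.

Lemma ell2_iter_hamiltonian f j : ell2 f -> ell2 (iter j H f).
Proof. by move=> sf; elim: j => //= j ih; exact: ell2_hamiltonian. Qed.

Lemma dotp_eigen_iter f k j : ell2 f ->
  dotp (psi k) (iter j H f) = (e k ^+ j)%:C * dotp (psi k) f.
Proof.
move=> sf; elim: j => [|j ih] /=; first by rewrite expr0 mul1r.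
have sj := ell2_iter_hamiltonian j sf.
rewrite (dotp_hamiltonian eps vM)// (_ : H (psi k) = fun n => (e k)%:C * psi k n); last exact/funext.
by rewrite dotpZl// conjc_real ih mulrA -rmorphM/= exprS.
Qed.

Let weight f k := cabs (dotp (psi k) f) ^+ 2.

Lemma sum_weight_le f N : ell2 f -> \sum_(k < N) weight f k <= normsq f.
Proof.
move=> sf; rewrite -subr_ge0 -(normsq_residual psi_ell2)// ?normsq_ge0//.
Qed.

(** Only the first copy of [f] is expanded; symmetry of H then moves its powers onto the
    eigenvectors. *)
Lemma dotp_residual_moment f j N : ell2 f -> dotp f (iter j H f) =
  dotp (residual psi N f) (iter j H f) + (\sum_(k < N) weight f k * e k ^+ j)%:C.
Proof.
move=> sf; have sj := ell2_iter_hamiltonian j sf.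
have scomb := ell2_combination N psi_ell2 (fun k => dotp (psi k) f).
rewrite /residual dotpBl// -[LHS]addr0 -addrA; congr (_ + _).
apply/eqP; rewrite eq_sym addrC subr_eq0 eq_sym; apply/eqP.
rewrite dotp_suml//; last by move=> k; exact: ell2Z.
rewrite rmorph_sum; apply: eq_bigr => k _ /=.
by rewrite dotpZl// dotp_eigen_iter// rmorphM/= cabs_sqrC mulrCA [RHS]mulrC (mulrC (dotp _ _)).
Qed.

(** By Cauchy-Schwarz the error is at most the norm of the residual times that of H^j f, to whose
    square 1 is added to divide safely. The limit is real because the partial sums are. *)
Lemma moment_cvg f j : ell2 f -> exists2 L : R, dotp f (iter j H f) = L%:C &
  (fun N : nat => \sum_(k < N) weight f k * e k ^+ j) @ \oo --> L.
Proof.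
move=> sf; have sj := ell2_iter_hamiltonian j sf; set z := dotp f _.
have small del : 0 < del -> exists N0, forall N, (N0 <= N)%N ->
    cabs (z - (\sum_(k < N) weight f k * e k ^+ j)%:C) <= del.
  move=> del0; have G0 : 0 < normsq (iter j H f) + 1 by rewrite ltr_wpDl// normsq_ge0.
  have [N0 hN0] := psi_complete sf (divr_gt0 (exprn_gt0 2 del0) G0).
  exists N0 => N NN0; rewrite /z (dotp_residual_moment j N)// addrK.
  rewrite -(@ler_pXn2r _ 2)// ?nnegrE ?cabs_ge0 ?(ltW del0)//.
  have sr := ell2_residual N psi_ell2 sf.
   apply: (le_trans (dotp_CauchySchwarz sr sj)).
  have := hN0 _ NN0; rewrite ler_pdivlMr//; apply: le_trans.
  by rewrite ler_wpM2l ?normsq_ge0// lerDl.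
exists (complex.Re z).
  apply: complex_eq => //=; apply/eqP; rewrite -normr_le0; apply/ler_addgt0Pl => del del0.
  have [N0 /(_ N0 (leqnn _))] := small _ del0; rewrite addr0; apply: le_trans.
  by apply: le_trans (Im_le_cabs _); rewrite cImB cImC subr0.
apply/cvgrPdist_le => del del0; have [N0 hN0] := small _ del0.
exists N0 => // N /hN0; apply: le_trans.
by apply: le_trans (Re_le_cabs _); rewrite cReB cReC.
Qed.

Lemma hamiltonian_pure_point : pure_point_spectrum H.
Proof.
apply/seteqP; split=> [f [sf _]//|f sf]; split=> //.
have [m [mB mpp mom]] := @point_masses_exist R (weight f) e (normsq f) opb
  (fun k => sqr_ge0 _) eigenvalue_le (fun N => sum_weight_le N sf).
exists m => //; split; first by exists opb.
by move=> j; have [L -> /mom ->] := moment_cvg j sf.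
Qed.

Lemma continuous_part_eq0 f m : ell2 f -> spectral_measure H f m ->
  (forall x : R, m [set x] = 0%E) -> f = fun=> 0.
Proof.
(* The interval must carry [m] and contain all eigenvalues, since the peaks are controlled on it
   only. *)
move=> sf [[M1 mM1] mom] m0; pose B := Num.max M1 opb.
have mB : m (~` `[- B, B]) = 0%E.
  apply/eqP; rewrite eq_le measure_ge0 andbT -mM1 le_measure ?inE//.
  - exact: measurableC.
  - exact: measurableC.
  - apply: subsetC => x /=; rewrite !in_itv/= -!ler_norml => /le_trans; apply.
    by rewrite /B le_max lexx.
have eB k : e k \in `[- B, B].
  by rewrite in_itv/= -ler_norml (le_trans (eigenvalue_le k))// /B le_max lexx orbT.
pose moment i := \int[m]_x (x ^+ i).
have momL i : (fun N : nat => \sum_(k < N) weight f k * e k ^+ i) @ \oo --> moment i.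
  by have [L + hL] := moment_cvg i sf; rewrite mom => /complexI; rewrite -/(moment i) => ->.
(* The moments of [m] are those of the point masses, so the right side is the limit of the sums of
   weight times p over the eigenvalues, all terms being nonnegative; one term is kept. *)
have weight_le (p : {poly R}) k : (forall x, x \in `[- B, B] -> 0 <= p.[x]) ->
    weight f k * p.[e k] <= \sum_(i < size p) p`_i * moment i.
  move=> p0; have cp : (fun N : nat => \sum_(l < N) weight f l * p.[e l]) @ \oo -->
      \sum_(i < size p) p`_i * moment i.
    rewrite (_ : (fun _ => _) = fun N : nat => \sum_(i < size p) p`_i *
        \sum_(l < N) weight f l * e l ^+ i); last first.
      apply/funext => N; under eq_bigr => l _ do rewrite horner_coef mulr_sumr.
      rewrite exchange_big/=; apply: eq_bigr => i _; rewrite mulr_sumr.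
      by apply: eq_bigr => l _; rewrite mulrCA.
    apply: cvg_big => [x|i _]; first exact: add_continuous.
    by apply: cvgM; [exact: cvg_cst|exact: momL].
  apply: (cvgr_to_ge cp); exists k.+1 => // N kN.
  rewrite /= (bigD1 (Ordinal kN))//= lerDl sumr_ge0// => l _.
  by rewrite mulr_ge0 ?sqr_ge0// p0.
have w0 k : dotp (psi k) f = 0.
  apply/eqP; rewrite -cabs_eq0 -sqrf_eq0 eq_le sqr_ge0 andbT.
  have := moments_peak_cvg mB (eB k) (m0 (e k)).
  move/cvgr_to_ge; apply; apply: nearW => n.
  have := @weight_le (peak B (e k) ^+ n) k; rewrite horner_exp peak_center expr1n mulr1.
  by apply => x xB; rewrite horner_exp exprn_ge0//; have [] := peak_itv (eB k) xB.
apply: (normsq_eq0 sf); apply/eqP; rewrite eq_le normsq_ge0 andbT.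
apply/ler_addgt0Pl => tau tau0; have [N0 /(_ N0 (leqnn _))] := psi_complete sf tau0.
by rewrite (normsq_residual psi_ell2)// big1 ?subr0 ?addr0// => k _; rewrite w0 cabs0 expr0n.
Qed.

(** On the zero subspace H - z is trivially onto and bounded below for every z, which empties the
    spectrum; an inclusion suffices, as the same holds on the empty set. *)
Lemma resolvent_set_on_zero (S : set (wave R d)) : S `<=` [set fun=> 0] ->
  resolvent_set_on H S = setT.
Proof.
move=> S0; apply/seteqP; split=> // z _; have H0 : (fun n => H (fun=> 0) n - z * 0) = fun=> 0.
  apply/funext => n; rewrite mulr0 subr0 /hamiltonian /laplacian mulr0 addr0.
  by rewrite big1 ?mulr0// => j _; rewrite addr0.
split.
  by exists 1 => // f /S0 ->; rewrite mul1r H0.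
apply/seteqP; split=> [_ [f /[dup] Sf /S0 f0 <-]|f /[dup] Sf /S0 f0].
  by move: Sf; rewrite f0 H0.
by exists f => //; rewrite f0 H0.
Qed.

Lemma hamiltonian_continuous_spectra : ac_spectrum H = set0 /\ sc_spectrum H = set0.
Proof.
split; rewrite /ac_spectrum /sc_spectrum /spectrum_on resolvent_set_on_zero ?setCT//.
- move=> f [sf [m mf /null_content_dominatesP mac]]; apply: (continuous_part_eq0 sf mf) => x.
  by apply: mac; [exact: measurable_set1|exact: lebesgue_measure_set1].
- by move=> f [sf [m mf [mc _]]]; exact: (continuous_part_eq0 sf mf).
Qed.

End SpectralTypes.

(** * The theorem *)
Section CountableEigenvectors.
Variables (R : realType) (d : nat) (eps : R) (v : site d -> R) (K : nat) (B : R).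
Local Notation C := R[i].
Local Notation "x %:C" := (real_complex R x) : ring_scope.
Local Notation H := (hamiltonian eps v).
Hypothesis good : forall N, exists2 L, (N <= L)%N & correlation_bounded eps v K B (sites d L).

Lemma hamiltonian0 n : H (fun=> 0) n = 0.
Proof.
rewrite /hamiltonian /laplacian mulr0 addr0.
by rewrite big1 ?mulr0// => j _; rewrite addr0.
Qed.

Lemma decaying_translate (f : wave R d) (x : site d) (Bx : R) :
  (forall y, cabs (f y) ^+ 2 <= Bx * (2 / 3) ^+ l1norm (x - y)) -> decaying f.
Proof.
move=> hf; have B0 : 0 <= Bx.
  by have := hf x; rewrite subrr l1norm0 expr0 mulr1; apply/le_trans/sqr_ge0.
exists (Bx * (3 / 2) ^+ l1norm x) => y; apply: le_trans (hf y) _; rewrite -mulrA ler_wpM2l//.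
have r0 : 0 < (2 / 3 : R) by lra.
have -> : (3 / 2 : R) = (2 / 3)^-1 by rewrite invf_div.
rewrite exprVn ler_pdivlMl ?exprn_gt0// -exprD ler_wiXn2l ?ltW//; first by lra.
by have := l1norm_dist_triangle 0 x y; rewrite !sub0r !l1normN.
Qed.

(** The finite family is packed into one value of a fixed type, indexed by [nat] and padded with
    zero functions, so that a choice can be made for all x and tau at once. *)
Lemma eigenvectors_approximating_indicator (x : site d) (tau : R) : 0 < tau ->
  exists F : nat * (nat -> wave R d) * (nat -> R),
  [/\ forall i y, H (F.1.2 i) y = (F.2 i)%:C * F.1.2 i y,
      forall i, decaying (F.1.2 i) &
      normsq (fun y => indicator R x y - \sum_(i < F.1.1) F.1.2 i y) <= tau].
Proof.
move=> tau0; have [N [f [E [Bx [fE fB fx]]]]] := localized_eigenvectors good x tau0.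
pose g i : wave R d := if insub i is Some j then f j else fun=> 0.
pose E' i : R := if insub i is Some j then E j else 0.
exists (N, g, E'); split=> /=.
- move=> i y; rewrite /g /E'; case: insubP => [j _ _|_]; first exact: fE.
  by rewrite hamiltonian0 mulr0.
- move=> i; rewrite /g; case: insubP => [j _ _|_]; first exact: decaying_translate (fB j).
  by exists 0 => n; rewrite cabs0 expr0n mul0r.
- apply: normsq_le => t ut; apply: le_trans (fx t ut); apply: ler_sum => y _.
  by under eq_bigr do rewrite /g valK.
Qed.

Lemma countable_eigenvectors_exist : exists (w : nat -> wave R d) (E : nat -> R),
  [/\ forall k, decaying (w k), forall k n, H (w k) n = (E k)%:C * w k n &
    forall x tau, 0 < tau -> exists N (a : nat -> C),
      normsq (fun n => indicator R x n - \sum_(k < N) a k * w k n) <= tau].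
Proof.
have [G hG] := choice (fun p : site d * nat =>
  @eigenvectors_approximating_indicator p.1 p.2.+1%:R^-1 ltac:(by rewrite invr_gt0)).
pose w k : wave R d := if unpickle k is Some (p, i) then (G p).1.2 i else fun=> 0.
pose E k : R := if unpickle k is Some (p, i) then (G p).2 i else 0.
exists w, E; split.
- move=> k; rewrite /w; case: unpickle => [[p i]|]; first by have [] := hG p.
  by exists 0 => n; rewrite cabs0 expr0n mul0r.
- move=> k n; rewrite /w /E; case: unpickle => [[p i]|]; first by have [->] := hG p.
  by rewrite hamiltonian0 mulr0.
move=> x tau tau0; pose n := Num.truncn tau^-1; pose p : site d * nat := (x, n).
have [c wc] : exists c : nat -> nat, forall i, w (c i) = (G p).1.2 i.
  by exists (fun i => pickle (p, i)) => i; rewrite /w pickleK.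
(* The approximant is a plain sum of eigenvectors, so the coefficient of [w k] counts the indices
   [i] whose code is k. *)
exists (\max_(i < (G p).1.1) c i).+1, (fun k => \sum_(i < (G p).1.1) (k == c i)%:R).
have [_ _] := hG p; set s := (fun y => _ - _) => hs.
rewrite (_ : (fun _ => _) = s).
  apply: le_trans hs _; rewrite -[leRHS]invrK lef_pV2 ?posrE ?invr_gt0//.
  by rewrite ltW// truncnS_gt.
apply/funext => y; rewrite /s; congr (_ - _).
under eq_bigr do rewrite mulr_suml; rewrite exchange_big/=; apply: eq_bigr => i _.
have ci : (c i < (\max_(i < (G p).1.1) c i).+1)%N.
  by rewrite ltnS (leq_bigmax (F := fun i : 'I_(G p).1.1 => c i)).
rewrite (bigD1 (Ordinal ci))//= eqxx mul1r wc big1 ?addr0//.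
by move=> k; rewrite -val_eqE/= => /negPf ->; rewrite mul0r.
Qed.

End CountableEigenvectors.

Lemma density_concentration (R : realType) (mu : probability (measurableTypeR R) R) g :
  has_density mu g -> ('N[@lebesgue_measure R]_+oo[EFin \o g] <= 1%:E)%E ->
  concentration_bound mu.
Proof.
move=> [mg g0 muE] gN c r r0.
have gle : {ae @lebesgue_measure R, forall x, (g x <= 1)%R}.
  (* The norm at infinity is an essential supremum when the total measure is positive; the unit ball
     witnesses this for Lebesgue measure. *)
  move: gN; rewrite unlock ifT; last first.
    rewrite (@lt_le_trans _ _ (@lebesgue_measure R (ball 0 1)))//.
      by rewrite lebesgue_measure_ball// lte_fin.
    by rewrite le_measure ?inE//; exact: measurable_ball.
  move=> /ess_supP; apply: filterS => x /=; rewrite lee_fin; exact/le_trans/ler_norm.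
have -> : [set x : R | `|x - c| < r] = ball c r.
  by apply/seteqP; split=> x; rewrite /ball/= distrC.
have mB : measurable (ball c r : set (measurableTypeR R)) by exact: measurable_ball.
rewrite muE//; apply: (@le_trans _ _ (\int[lebesgue_measure]_(x in ball c r) 1%:E)%E).
  apply: ae_ge0_le_integral => //.
  - by move=> x _; rewrite lee_fin.
  - by apply: measurable_funTS; exact/measurable_EFinP.
  - by apply: filterS gle => x gx _; rewrite lee_fin.
by rewrite integral_cst// mul1e mulr_natl -(lebesgue_measure_ball c (ltW r0)).
Qed.

Lemma iid_bounded_ae (R : realType) (d : nat) (dO : measure_display)
  (Omega : measurableType dO) (P : probability Omega R)
  (V : site d -> {RV P >-> measurableTypeR R}) (mu : probability (measurableTypeR R) R) :
  iid V mu -> compactly_supported mu ->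
  exists M : R, {ae P, forall w, forall n, `|V n w| <= M}.
Proof.
move=> [Vmu _] [K cK muK]; have [M [_ hM]] := compact_bounded cK.
(* Boundedness of [K] holds for every bound strictly above [M], whence the 1. *)
exists (M + 1); pose S : set (measurableTypeR R) := [set x | `|x| <= M + 1].
have mS : measurable S.
  rewrite (_ : S = `[- (M + 1), M + 1]%classic); first exact: measurable_itv.
  by apply/seteqP; split=> x; rewrite /S/= in_itv/= ler_norml.
have muS : mu (~` S) = 0%E.
  have mK : measurable (K : set (measurableTypeR R)) by exact: compact_measurable.
  apply/eqP; rewrite eq_le measure_ge0 andbT -muK le_measure ?inE//.
  - exact: measurableC.
  - exact: measurableC.
  - by apply: subsetC => x Kx; apply: (hM (M + 1) _ x Kx); rewrite ltrDl.
pose Bad n : set Omega := V n @^-1` (~` S).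
have PBad n : P.-negligible (Bad n).
  exists (Bad n); split => //; last by have := Vmu n _ (measurableC mS); rewrite muS.
  rewrite -[Bad n]setTI; apply: (measurable_funP (V n)) => //; exact: measurableC.
have : P.-negligible (\bigcup_k (if unpickle k is Some n then Bad n else set0)).
  apply: negligible_bigcup => k; case: unpickle => [n|]; [exact: PBad|exact: negligible_set0].
apply: negligibleS => w /= /existsNP[n hn]; exists (pickle n) => //; rewrite pickleK.
exact: hn.
Qed.

(** The deterministic half of the theorem: one bounded potential with bounded correlations along
    boxes. *)
Lemma localization_of_bounded_correlations (R : realType) (d : nat) (eps : R) (v : site d -> R)
    (K : nat) (B M : R) : (0 < d)%N -> (forall n, `|v n| <= M) ->
  (forall N, exists2 L, (N <= L)%N & correlation_bounded eps v K B (sites d L)) ->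
  let H := hamiltonian eps v in
  (exists2 psi : nat -> wave R d, orthonormal_basis psi &
     forall k, eigenfunction H (psi k) /\ exp_decaying (psi k)) /\
  [/\ pure_point_spectrum H, ac_spectrum H = set0 & sc_spectrum H = set0].
Proof.
move=> d0 vM good H.
have [w [E [wd wE wdense]]] := countable_eigenvectors_exist good.
have [psi [psid psiE psiO psiC]] := orthonormal_eigenbasis_exists vM wd wE wdense d0.
have psi2 k : ell2 (psi k) by exact: decaying_ell2.
have [e eE] := choice psiE.
split; last first.
  split; first exact: (hamiltonian_pure_point vM psi2 eE psiO psiC).
    by have [] := hamiltonian_continuous_spectra vM psi2 eE psiO psiC.
  by have [] := hamiltonian_continuous_spectra vM psi2 eE psiO psiC.
exists psi.
  split=> // f sf; apply/cvgrPdist_le => tau tau0.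
  have [N0 hN0] := psiC f sf _ (exprn_gt0 2 tau0); exists N0 => // N /= /hN0 h.
  rewrite sub0r normrN ger0_norm; last exact: l2norm_ge0.
  rewrite -(@ler_pXn2r _ 2)// ?nnegrE ?l2norm_ge0 ?(ltW tau0)// sqr_l2norm.
  exact: h.
move=> k; split; last exact: decaying_exp_decaying.
split=> //; first exact: (psi_neq0 psiO).
by exists (real_complex R (e k)).
Qed.

Theorem theorem3p5 (R : realType) (d : nat) (d_ge1 : (1 <= d)%N) :
  exists2 eps0 : R, 0 < eps0 &
  forall eps : R, 0 < eps -> eps <= eps0 ->
  forall (dO : measure_display) (Omega : measurableType dO)
    (P : probability Omega R)
    (V : site d -> {RV P >-> measurableTypeR R})
    (mu : probability (measurableTypeR R) R)
    (g : measurableTypeR R -> R),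
  iid V mu ->
  compactly_supported mu ->
  has_density mu g ->
  ('N[@lebesgue_measure R]_+oo[EFin \o g] <= 1%:E)%E ->
  {ae P, forall w : Omega,
     let H := hamiltonian eps (fun n => V n w) in
     (exists2 psi : nat -> wave R d, orthonormal_basis psi &
        forall k, eigenfunction H (psi k) /\ exp_decaying (psi k)) /\
     [/\ pure_point_spectrum H,
         ac_spectrum H = set0
       & sc_spectrum H = set0]}.
Proof.
have d0 : 0 < d%:R :> R by rewrite ltr0n.
(* The condition of [sum_hops]: 2 d neighbours, times the average 9, times 2 for one unit of
   distance. *)
exists (36 * d%:R)^-1; first by rewrite invr_gt0 mulr_gt0.
move=> eps eps0 eps1 dO Omega P V mu g iidV muc mug gN.
have hmu := density_concentration mug gN.
have [M VM] := iid_bounded_ae iidV muc.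
have eps_small : 36 * d%:R * eps <= 1.
  by move: eps1; rewrite -[_^-1]mulr1 ler_pdivlMl ?mulr_gt0.
(* An energy window that contains the eigenvalues of all boxes with margin 1. It depends on the
   almost sure bound [M] only, so it is fixed before the sample point. *)
pose K := (Num.truncn (M + eps ^+ 2 * (2 * d)%:R + 1)).+1.
have hK : M + eps ^+ 2 * (2 * d)%:R + 1 <= K%:R by rewrite ltW// truncnS_gt.
have := resolvent_sum_bounded_ae iidV hmu (ltW eps0) eps_small K.
apply: filterS2 VM => w Vw [C hC].
apply: (localization_of_bounded_correlations (K := K) (B := 4 * C + 1) d_ge1 Vw) => N.
have [L NL hL] := hC N; exists L => //.
exact: (correlation_bounded_of_resolvent_sum (ltW eps0) (sites_uniq d L) Vw hK hL).
Qed.
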